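(* Let $\mathfrak U$ be a monster model of $\mathsf{DOAG}$, the theory of divisible ordered abelian groups in the language $\{+,0,-,<\}$. Then $\otimes$ respects $\geq_{\mathrm D}$ (so $\widetilde{\mathrm{Inv}}(\mathfrak U)$ is well-defined), $\widetilde{\mathrm{Inv}}(\mathfrak U)=\overline{\mathrm{Inv}}(\mathfrak U)$ (i.e. $\sim_{\mathrm D}$ and $\equiv_{\mathrm D}$ coincide), and \[(\widetilde{\mathrm{Inv}}(\mathfrak U),\otimes,\geq_{\mathrm D},\perp^{\mathrm w})\cong(\mathscr P_{\mathrm{fin}}(X),\cup,\supseteq,D),\] where $X$ is the set of invariant convex subgroups of $\mathfrak U$, $\mathscr P_{\mathrm{fin}}(X)$ is the set of finite subsets of $X$, and $D(x,y)$ holds iff $x\cap y=\emptyset$.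
   Context: $\mathfrak U$ is $\kappa$-saturated and $\kappa$-strongly homogeneous for a large strong limit $\kappa$; ''small'' means size $<\kappa$. A global type $p(x)$ (complete type over $\mathfrak U$) is $A$-invariant ($A$ small) if for all parameter-free $\phi(x,y)$ and $a\equiv_A b$ in $\mathfrak U$, $p\vdash\phi(x,a)\leftrightarrow\phi(x,b)$; invariant if $A$-invariant for some small $A$; $S^{\mathrm{inv}}(\mathfrak U)$ is the set of these. $\phi(x,y)\in p(x)\otimes q(y)$ iff $\phi(x,b)\in p\mid\mathfrak U b$ for $b\models q$, where $p\mid\mathfrak U b$ is the unique $A$-invariant extension. $p\geq_{\mathrm D}q$ iff there are a small $A$ and a complete type $r(x,y)$ over $A$ extending $(p\restriction A)\cup(q\restriction A)$ with $p\cup r\vdash q$; $\sim_{\mathrm D}$ is the induced equivalence; $p\equiv_{\mathrm D}q$ iff one $r$ witnesses both. $p\perp^{\mathrm w}q$ iff $p(x)\cup q(y)$ implies a complete type over $\mathfrak U$. $\widetilde{\mathrm{Inv}}(\mathfrak U)=S^{\mathrm{inv}}(\mathfrak U)/\sim_{\mathrm D}$ with induced order and induced relation $\perp^{\mathrm w}$; $\overline{\mathrm{Inv}}(\mathfrak U)=S^{\mathrm{inv}}(\mathfrak U)/\equiv_{\mathrm D}$. ''$\otimes$ respects $\geq_{\mathrm D}$'': $p_0\geq_{\mathrm D}p_1$ implies $p_0\otimes q\geq_{\mathrm D}p_1\otimes q$ and $q\otimes p_0\geq_{\mathrm D}q\otimes p_1$ for invariant $q$. A convex subgroup $H$ of $\mathfrak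 U$ is invariant if it is fixed setwise by the automorphisms of $\mathfrak U$ fixing some small set pointwise. *)

(* Defs.v *)
From HB Require Import structures.
From mathcomp Require Import all_boot all_order all_algebra.
From mathcomp Require Import boolp classical_sets functions cardinality.

Set Implicit Arguments.
Unset Strict Implicit.
Unset Printing Implicit Defensive.

Import Order.TTheory GRing.Theory Num.Theory.
Local Open Scope ring_scope.
Local Open Scope classical_set_scope.
Local Open Scope card_scope.

(* First-order formulas in the language {+, 0, -, <}, with free variables in an
   arbitrary type V; under the quantifier, None is the bound variable. *)
Inductive term (V : Type) : Type :=
| TVar of V
| TZero
| TAdd of term V & term V
| TOpp of term V.

Inductive formula (V : Type) : Type :=
| FEq of term V & term V
| FLt of term V & term V
| FNot of formula V
| FAnd of formula V & formula V
| FEx of formula (option V).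

Arguments TZero {V}.

Definition FImp (V : Type) (phi psi : formula V) := FNot (FAnd phi (FNot psi)).
Definition FIff (V : Type) (phi psi : formula V) :=
  FAnd (FImp phi psi) (FImp psi phi).

Fixpoint term_rename (V W : Type) (f : V -> W) (t : term V) : term W :=
  match t with
  | TVar v => TVar (f v)
  | TZero => TZero
  | TAdd t1 t2 => TAdd (term_rename f t1) (term_rename f t2)
  | TOpp t1 => TOpp (term_rename f t1)
  end.

Fixpoint rename (V W : Type) (f : V -> W) (phi : formula V) : formula W :=
  match phi with
  | FEq t1 t2 => FEq (term_rename f t1) (term_rename f t2)
  | FLt t1 t2 => FLt (term_rename f t1) (term_rename f t2)
  | FNot phi1 => FNot (rename f phi1)
  | FAnd phi1 phi2 => FAnd (rename f phi1) (rename f phi2)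
  | FEx phi1 => FEx (rename (omap f) phi1)
  end.

Fixpoint term_vars (V : Type) (t : term V) : set V :=
  match t with
  | TVar v => [set v]
  | TZero => set0
  | TAdd t1 t2 => term_vars t1 `|` term_vars t2
  | TOpp t1 => term_vars t1
  end.

Fixpoint free_vars (V : Type) (phi : formula V) : set V :=
  match phi with
  | FEq t1 t2 => term_vars t1 `|` term_vars t2
  | FLt t1 t2 => term_vars t1 `|` term_vars t2
  | FNot phi1 => free_vars phi1
  | FAnd phi1 phi2 => free_vars phi1 `|` free_vars phi2
  | FEx phi1 => Some @^-1` free_vars phi1
  end.

Definition sum_map (A B C D : Type) (f : A -> C) (g : B -> D) (s : A + B) :
    C + D :=
  match s with inl a => inl (f a) | inr b => inr (g b) end.

Definition card_lt (S T : Type) (A : set S) (B : set T) : Prop :=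
  (A #<= B) /\ ~ (B #<= A).

(* Cardinals are represented by types: here kappa is the cardinality of K. *)
Definition uncountable_strong_limit (K : Type) : Prop :=
  card_lt [set: nat] [set: K] /\
  forall Y : set K, card_lt Y [set: K] ->
    card_lt [set Z : set K | Z `<=` Y] [set: K].

Section Structure.
Context (U : porderZmodType).

Definition DOAG : Prop :=
  [/\ forall x y : U, (x <= y) || (y <= x),
      forall x y z : U, y < z -> x + y < x + z,
      forall (n : nat) (x : U), (0 < n)%N -> exists y : U, y *+ n = x &
      exists x : U, x != 0].

Fixpoint eval (V : Type) (e : V -> U) (t : term V) : U :=
  match t with
  | TVar v => e v
  | TZero => 0
  | TAdd t1 t2 => eval e t1 + eval e t2
  | TOpp t1 => - eval e t1
  end.

Fixpoint sat (V : Type) (e : V -> U) (phi : formula V) : Prop :=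
  match phi with
  | FEq t1 t2 => eval e t1 = eval e t2
  | FLt t1 t2 => eval e t1 < eval e t2
  | FNot phi1 => ~ sat e phi1
  | FAnd phi1 phi2 => sat e phi1 /\ sat e phi2
  | FEx phi1 => exists u : U, sat (fun o => if o is Some v then e v else u) phi1
  end.

Definition automorphism (s : U -> U) : Prop :=
  [/\ bijective s, s 0 = 0, {morph s : x y / x + y}, {morph s : x / - x} &
      {mono s : x y / x < y}].

(* A formula with parameters in U and free variables in V is a formula over
   V + U, where inr u stands for the parameter u. *)
Definition psat (V : Type) (e : V -> U) (phi : formula (V + U)) : Prop :=
  sat (fun v => match v with inl x => e x | inr u => u end) phi.

Definition over (V : Type) (A : set U) : set (formula (V + U)) :=
  [set phi | inr @^-1` free_vars phi `<=` A].

(* Consistency and entailment are modulo the elementary diagram of U. *)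
Definition consistent (V : Type) (S : set (formula (V + U))) : Prop :=
  forall s : set (formula (V + U)), finite_set s -> s `<=` S ->
    exists e : V -> U, forall phi, s phi -> psat e phi.

Definition entails (V : Type) (S : set (formula (V + U)))
    (phi : formula (V + U)) : Prop :=
  exists s : set (formula (V + U)), [/\ finite_set s, s `<=` S &
    forall e : V -> U, (forall psi, s psi -> psat e psi) -> psat e phi].

Definition complete_type (V : Type) (A : set U) (p : set (formula (V + U))) :
    Prop :=
  [/\ p `<=` over A, consistent p &
      forall phi, over A phi -> p phi \/ p (FNot phi)].

Definition inst (V W : Type) (a : W -> U) (phi : formula (V + W)) :
    formula (V + U) := rename (sum_map id a) phi.

Definition equiv_over (k : nat) (A : set U) (a b : 'I_k -> U) : Prop :=
  forall chi : formula ('I_k + U), over A chi -> (psat a chi <-> psat b chi).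

Definition invariant_over (n : nat) (A : set U)
    (p : set (formula ('I_n + U))) : Prop :=
  forall (k : nat) (phi : formula ('I_n + 'I_k)) (a b : 'I_k -> U),
    equiv_over A a b -> entails p (FIff (inst a phi) (inst b phi)).

(* p(x) and q(y), viewed as sets of formulas in the variables (x, y) *)
Definition in_x (n m : nat) (p : set (formula ('I_n + U))) :
    set (formula (('I_n + 'I_m) + U)) := rename (sum_map inl id) @` p.
Definition in_y (n m : nat) (q : set (formula ('I_m + U))) :
    set (formula (('I_n + 'I_m) + U)) := rename (sum_map inr id) @` q.

Arguments in_x {n m} p.
Arguments in_y {n m} q.

(* A realisation b of a global type q(y) lies outside U in general.  Elements
   of Ub are named by 'I_m + U, with inl j naming b_j: chi(b) holds iff chi(y)
   is in q, and a complete type in x over Ub is a complete type r(x, y) over U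
   that contains q(y), with phi(x, b) in the former iff phi(x, y) is in r. *)
Definition ext_equiv_over (m k : nat) (A : set U)
    (q : set (formula ('I_m + U))) (c d : 'I_k -> 'I_m + U) : Prop :=
  let at_ (c : 'I_k -> 'I_m + U) (chi : formula ('I_k + U)) :=
    rename (fun v => match v with inl i => c i | inr u => inr u end) chi in
  forall chi : formula ('I_k + U), over A chi ->
    (q (at_ c chi) <-> q (at_ d chi)).

Definition ext_inst (n m k : nat) (c : 'I_k -> 'I_m + U)
    (phi : formula ('I_n + 'I_k)) : formula (('I_n + 'I_m) + U) :=
  rename (fun v => match v with
                   | inl i => inl (inl i)
                   | inr j => sum_map inr id (c j)
                   end) phi.

(* r is the A-invariant extension p | Ub of p to Ub, where b realises q. *)
Definition invariant_extension (n m : nat) (A : set U)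
    (p : set (formula ('I_n + U))) (q : set (formula ('I_m + U)))
    (r : set (formula (('I_n + 'I_m) + U))) : Prop :=
  [/\ complete_type setT r, in_x p `<=` r, in_y q `<=` r &
      forall (k : nat) (phi : formula ('I_n + 'I_k)) (c d : 'I_k -> 'I_m + U),
        ext_equiv_over A q c d ->
        entails r (FIff (ext_inst c phi) (ext_inst d phi))].

Record global_set := GlobalSet {
  arity : nat;
  formulas :> set (formula ('I_arity + U)) }.

Definition weakly_orthogonal (p q : global_set) : Prop :=
  exists t : set (formula (('I_(arity p) + 'I_(arity q)) + U)),
    complete_type setT t /\
    forall phi, t phi -> entails (in_x p `|` in_y q) phi.

Definition convex_subgroup (H : set U) : Prop :=
  [/\ H 0, forall x y, H x -> H y -> H (x + y), forall x, H x -> H (- x) &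
      forall x y z, H x -> H z -> x <= y -> y <= z -> H y].

Section Monster.
Context (K : Type).

Definition small (A : set U) : Prop := card_lt A [set: K].

Definition saturated : Prop :=
  forall (A : set U) (n : nat) (p : set (formula ('I_n + U))),
    small A -> complete_type A p ->
    exists e : 'I_n -> U, forall phi, p phi -> psat e phi.

Definition strongly_homogeneous : Prop :=
  forall (A : set U) (f : U -> U), small A ->
    (forall (k : nat) (phi : formula 'I_k) (a : 'I_k -> U),
       (forall i, A (a i)) -> (sat a phi <-> sat (f \o a) phi)) ->
    exists2 s : U -> U, automorphism s & forall a, A a -> s a = f a.

Definition monster_DOAG : Prop :=
  [/\ uncountable_strong_limit K, DOAG, saturated & strongly_homogeneous].

Definition Sinv : set global_set :=
  [set p : global_set | complete_type setT p /\
    exists2 A, small A & invariant_over A p].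

Definition tensor (p q : global_set) : global_set :=
  @GlobalSet (arity p + arity q)
    [set phi | exists A r,
      [/\ small A, invariant_over A p, invariant_extension A p q r &
          r (rename (sum_map (@fintype.split (arity p) (arity q)) id) phi)]].

(* r is a complete type over A extending the restrictions of p(x) and q(y). *)
Definition small_type (p q : global_set) (A : set U)
    (r : set (formula (('I_(arity p) + 'I_(arity q)) + U))) : Prop :=
  [/\ small A, complete_type A r, in_x (p `&` over A) `<=` r &
      in_y (q `&` over A) `<=` r].

Definition dominates (p q : global_set) : Prop :=
  exists A r, @small_type p q A r /\
    forall phi, in_y q phi -> entails (in_x p `|` r) phi.

Definition dom_equiv (p q : global_set) : Prop :=
  dominates p q /\ dominates q p.

Definition equidominant (p q : global_set) : Prop :=
  exists A r, [/\ @small_type p q A r,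
    forall phi, in_y q phi -> entails (in_x p `|` r) phi &
    forall phi, in_x p phi -> entails (in_y q `|` r) phi].

Definition dom_class (p : global_set) : set global_set :=
  [set q | Sinv q /\ dom_equiv p q].

Definition Inv_tilde : set (set global_set) := dom_class @` Sinv.

Definition tensor_respects_dominates : Prop :=
  forall p0 p1 q, Sinv p0 -> Sinv p1 -> Sinv q -> dominates p0 p1 ->
    dominates (tensor p0 q) (tensor p1 q) /\
    dominates (tensor q p0) (tensor q p1).

Definition invariant_convex_subgroup : set (set U) :=
  [set H | convex_subgroup H /\
    exists2 A, small A &
      forall s, automorphism s -> (forall a, A a -> s a = a) -> s @` H = H].

Definition finite_subsets (T : Type) (X : set T) : set (set T) :=
  [set Y | finite_set Y /\ Y `<=` X].

(* The operation and relations on Inv_tilde are induced by representatives. *)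
Definition Inv_tilde_iso (F : set global_set -> set (set U)) : Prop :=
  [/\ set_bij Inv_tilde (finite_subsets invariant_convex_subgroup) F,
      forall p q, Sinv p -> Sinv q ->
        F (dom_class (tensor p q)) = F (dom_class p) `|` F (dom_class q),
      forall p q, Sinv p -> Sinv q ->
        (dominates p q <-> F (dom_class q) `<=` F (dom_class p)) &
      forall p q, Sinv p -> Sinv q ->
        (weakly_orthogonal p q <-> F (dom_class p) `&` F (dom_class q) = set0)].

End Monster.
End Structure.

(* Main.v *)
(* A realisation of an invariant type p over U generates an extension of U of
   finite rank. For an element c of it outside U let H be the stabiliser of the
   cut of c in U; using an element of U with the same type as c over the small
   set A supporting p, one finds u in U such that |c - u| lies exactly above the
   convex subgroup H, which is therefore invariant. The finite set X(p) of the
   groups H that arise in this way is the invariant of p: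
   - elements lying above distinct subgroups are independent over U, because
     the sign of a combination is that of its dominant term; this gives the
     orthogonality statement and X(p * q) = X(p) U X(q);
   - H has a small cofinal subset or its upper complement has a small coinitial
     one. Hence, to force q when X(q) is contained in X(p), it suffices to
     identify, for each H in X(q), one element of p above H with one of q that
     is extremal on the side of H which is not controlled by A. When X(p) = X(q)
     the identification is symmetric, which yields equidominance;
   - if p dominates q and H is in X(q), then quantifier elimination bounds the
     corresponding element of q by one of p on the other side, and invariance
     of p puts H in X(p). *)

From Pilot Require Import Defs.
From mathcomp Require Import all_boot all_order all_algebra.
From mathcomp Require Import boolp classical_sets functions cardinality.
From mathcomp Require Import lra.

Set Implicit Arguments.
Unset Strict Implicit.
Unset Printing Implicit Defensive.

Import Order.TTheory GRing.Theory Num.Theory.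
Local Open Scope ring_scope.
Local Open Scope classical_set_scope.
Local Open Scope card_scope.
(* ssreflect shadows [over]. *)
Import Pilot.Defs.

(** * Syntax *)

(** No extension of U is ever built. An element of the extension generated by a realisation of p is
    represented by an affine function with integer coefficients, and what holds of it by [forced],
    entailment from finitely many formulas of p. By quantifier elimination the signs of these
    functions determine a complete type, and by strong homogeneity they decide conjugacy inside U.
    Arguments about realisations thus become choices of tuples in U that realise p or q over a small
    set, moved by automorphisms. Invariance mostly enters as follows: if [y, z] misses [dcl A], then
    y and z are conjugate over A, and an A-invariant type cannot place a form with constant in
    [dcl A] between them. The obstacle is that one cut can hold elements of p in several Archimedean
    classes, so that identifying arbitrary elements of p and q above H need not force all of q.
    Integer relations bound the number of classes by the number of variables, hence extremal classes
    exist; which extreme is wanted depends only on H and A, so it is the same one for p and for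
    q. *)

Lemma term_rename_comp (V W Z : Type) (f : V -> W) (g : W -> Z) (t : term V) :
  term_rename g (term_rename f t) = term_rename (g \o f) t.
Proof. by elim: t => //= [t1 -> t2 ->|t ->]. Qed.

Lemma rename_comp (V W Z : Type) (f : V -> W) (g : W -> Z) (phi : formula V) :
  rename g (rename f phi) = rename (g \o f) phi.
Proof.
elim: phi W Z f g => //= {V} V.
- by move=> t1 t2 W Z f g; rewrite !term_rename_comp.
- by move=> t1 t2 W Z f g; rewrite !term_rename_comp.
- by move=> phi IH W Z f g; rewrite IH.
- by move=> phi IH psi IH' W Z f g; rewrite IH IH'.
- move=> phi IH W Z f g; rewrite IH; congr (FEx (rename _ phi)).
  by apply: funext => -[].
Qed.

Lemma term_rename_ext (V W : Type) (f g : V -> W) (t : term V) :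
  (forall v, term_vars t v -> f v = g v) -> term_rename f t = term_rename g t.
Proof.
elim: t => //= [v H|t1 IH1 t2 IH2 H|t IH H].
- by rewrite H.
- by rewrite IH1 ?IH2 // => v Hv; apply: H; [right|left].
- by rewrite IH.
Qed.

Lemma rename_ext (V W : Type) (f g : V -> W) (phi : formula V) :
  (forall v, free_vars phi v -> f v = g v) -> rename f phi = rename g phi.
Proof.
elim: phi W f g => //= {V} V.
- move=> t1 t2 W f g H.
  by congr FEq; apply: term_rename_ext => v Hv; apply: H; [left|right].
- move=> t1 t2 W f g H.
  by congr FLt; apply: term_rename_ext => v Hv; apply: H; [left|right].
- by move=> phi IH W f g H; rewrite (IH _ f g).
- move=> phi IH psi IH' W f g H.
  by congr FAnd; [apply: IH|apply: IH'] => v Hv; apply: H; [left|right].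
- move=> phi IH W f g H; congr FEx; apply: IH => -[v|] //= Hv.
  by rewrite H.
Qed.

Lemma term_rename_id (V : Type) (t : term V) : term_rename id t = t.
Proof. by elim: t => //= [t1 -> t2 ->|t ->]. Qed.

Lemma rename_id (V : Type) (phi : formula V) : rename id phi = phi.
Proof.
elim: phi => //= {V} V.
- by move=> t1 t2; rewrite !term_rename_id.
- by move=> t1 t2; rewrite !term_rename_id.
- by move=> phi ->.
- by move=> phi -> psi ->.
- move=> phi IH; congr FEx; rewrite -[RHS]IH; congr rename.
  by apply: funext => -[].
Qed.

Lemma term_vars_rename (V W : Type) (f : V -> W) (t : term V) :
  term_vars (term_rename f t) = f @` term_vars t.
Proof.
elim: t => [v||t1 IH1 t2 IH2|t IH] /=; rewrite ?image_set1 ?image_set0 //.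
by rewrite IH1 IH2 image_setU.
Qed.

Lemma free_vars_rename (V W : Type) (f : V -> W) (phi : formula V) :
  free_vars (rename f phi) = f @` free_vars phi.
Proof.
elim: phi W f => //= {V} V.
- by move=> t1 t2 W f; rewrite !term_vars_rename image_setU.
- by move=> t1 t2 W f; rewrite !term_vars_rename image_setU.
- by move=> phi IH psi IH' W f; rewrite IH IH' image_setU.
- move=> phi IH W f; rewrite IH; apply/seteqP; split => w /=.
  + by case=> -[v|] //= Hv [<-]; exists v.
  + by case=> v Hv <-; exists (Some v).
Qed.

Lemma finite_term_vars (V : Type) (t : term V) : finite_set (term_vars t).
Proof. by elim: t => //= t1 H1 t2 H2; rewrite finite_setU. Qed.

Lemma finite_free_vars (V : Type) (phi : formula V) : finite_set (free_vars phi).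
Proof.
elim: phi => //= {V} V.
- by move=> t1 t2; rewrite finite_setU; split; apply: finite_term_vars.
- by move=> t1 t2; rewrite finite_setU; split; apply: finite_term_vars.
- by move=> phi H psi H'; rewrite finite_setU.
- move=> phi H; apply: finite_preimage => // x y _ _ []; exact.
Qed.

(** * Truth under renaming and under automorphisms *)

Section Semantics.
Variable U : porderZmodType.

Lemma eval_ext (V : Type) (e e' : V -> U) (t : term V) :
  (forall v, term_vars t v -> e v = e' v) -> eval e t = eval e' t.
Proof.
elim: t => //= [v H|t1 IH1 t2 IH2 H|t IH H].
- by rewrite H.
- by rewrite IH1 ?IH2 // => v Hv; apply: H; [right|left].
- by rewrite IH.
Qed.

Lemma sat_ext (V : Type) (e e' : V -> U) (phi : formula V) :
  (forall v, free_vars phi v -> e v = e' v) -> sat e phi <-> sat e' phi.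
Proof.
elim: phi e e' => //= {V} V.
- by move=> t1 t2 e e' H; rewrite !(@eval_ext _ e e') // => v Hv; apply: H; [right|left].
- by move=> t1 t2 e e' H; rewrite !(@eval_ext _ e e') // => v Hv; apply: H; [right|left].
- by move=> phi IH e e' H; rewrite (IH e e').
- by move=> phi IH psi IH' e e' H; rewrite (IH e e') ?(IH' e e') // => v Hv; apply: H; [right|left].
- move=> phi IH e e' H; split=> -[u Hu]; exists u; move: Hu; apply IH => -[v|] //= Hv.
  + by rewrite H.
  + by rewrite H.
Qed.

Lemma eval_rename (V W : Type) (f : V -> W) (e : W -> U) (t : term V) :
  eval e (term_rename f t) = eval (e \o f) t.
Proof. by elim: t => //= [t1 -> t2 ->|t ->]. Qed.

Lemma sat_rename (V W : Type) (f : V -> W) (e : W -> U) (phi : formula V) :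
  sat e (rename f phi) <-> sat (e \o f) phi.
Proof.
elim: phi W f e => //= {V} V.
- by move=> t1 t2 W f e; rewrite !eval_rename.
- by move=> t1 t2 W f e; rewrite !eval_rename.
- by move=> phi IH W f e; rewrite IH.
- by move=> phi IH psi IH' W f e; rewrite IH IH'.
- move=> phi IH W f e; split=> -[u Hu]; exists u; move: Hu; rewrite IH; apply sat_ext => -[v|] //.
Qed.

Lemma sat_FIff (V : Type) (e : V -> U) (phi psi : formula V) :
  sat e (FIff phi psi) <-> (sat e phi <-> sat e psi).
Proof.
rewrite /=; split=> [[H1 H2]|H].
- by split=> H; apply: contrapT => H'; [apply: H1|apply: H2].
- by split=> -[H1 H2]; apply: H2; apply H.
Qed.

Lemma eval_automorphism (s : U -> U) (V : Type) (e : V -> U) (t : term V) :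
  automorphism s -> eval (s \o e) t = s (eval e t).
Proof.
case=> _ s0 sD sN _.
by elim: t => //= [t1 -> t2 ->|t ->]; rewrite ?sD ?sN.
Qed.

Lemma sat_automorphism (s : U -> U) (V : Type) (e : V -> U) (phi : formula V) :
  automorphism s -> sat (s \o e) phi <-> sat e phi.
Proof.
move=> Hs; have [sbij s0 sD sN slt] := Hs; have sinj := bij_inj sbij.
elim: phi e => //= {V} V.
- by move=> t1 t2 e; rewrite !eval_automorphism //; split=> [/sinj|->].
- by move=> t1 t2 e; rewrite !eval_automorphism // slt.
- by move=> phi IH e; rewrite IH.
- by move=> phi IH psi IH' e; rewrite IH IH'.
- move=> phi IH e; have [g gK Kg] := sbij; split=> -[u Hu].
  + exists (g u); apply IH; move: Hu; apply sat_ext => -[v|] _ /=; rewrite ?Kg //.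
  + exists (s u); move/(IH (fun o => if o is Some v then e v else u)): Hu.
    by apply sat_ext => -[].
Qed.

End Semantics.

(** * Divisible ordered abelian groups *)

Section OrderedGroup.
Variables (U : porderZmodType) (hU : DOAG U).
Implicit Types x y z : U.

Lemma doag_ltD2l x y z : (x + y < x + z) = (y < z).
Proof.
case: hU => _ H _ _; apply/idP/idP; last exact: H.
by move/(H (- x)); rewrite !addKr.
Qed.

Lemma doag_subr_gt0 x y : (0 < y - x) = (x < y).
Proof. by rewrite -(doag_ltD2l x 0) addr0 addrC subrK. Qed.

Lemma doag_oppr_gt0 x : (0 < - x) = (x < 0).
Proof. by rewrite -doag_subr_gt0 sub0r. Qed.

Lemma doag_oppr_lt0 x : (- x < 0) = (0 < x).
Proof. by rewrite -doag_subr_gt0 sub0r opprK. Qed.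

Lemma doag_leNgt x y : (x <= y) = ~~ (y < x).
Proof.
case: hU => tot _ _ _; rewrite lt_neqAle negb_and negbK.
have := tot x y; have [-> _|nxy] := eqVneq y x; first by rewrite lexx.
by rewrite orFb; case: (boolP (x <= y)) (boolP (y <= x)) => [xy [yx|]|] //=;
  [rewrite (le_anti (introT andP (conj xy yx))) eqxx in nxy|move=> _ []].
Qed.

Lemma doag_ltgt x y : [\/ x < y, x = y | y < x].
Proof.
have [xy|] := boolP (x < y); first exact: Or31.
rewrite -doag_leNgt le_eqVlt => /orP[/eqP->|yx]; first exact: Or32.
exact: Or33.
Qed.

Lemma doag_addr_gt0 x y : 0 < x -> 0 < y -> 0 < x + y.
Proof. by move=> x0 y0; rewrite (lt_trans x0) // -{1}[x]addr0 doag_ltD2l. Qed.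

Lemma doag_mulrn_gt0 x n : 0 < x -> (0 < n)%N -> 0 < x *+ n.
Proof.
move=> x0; case: n => // n _; elim: n => // n IH.
by rewrite mulrS doag_addr_gt0.
Qed.

Lemma doag_div x (n : nat) : (0 < n)%N -> exists y, y *+ n = x.
Proof. by case: hU => _ _ H _; apply: H. Qed.

(** Integer-valued, so that it multiplies with the sign of an integer coefficient, as in [sgnMz]. *)
Definition sgn x : int := if 0 < x then 1 else if x < 0 then -1 else 0.

Variant sgn_spec x : int -> Set :=
| SgnPos of 0 < x : sgn_spec x 1
| SgnNeg of x < 0 : sgn_spec x (-1)
| SgnZero of x = 0 : sgn_spec x 0.

Lemma sgnP x : sgn_spec x (sgn x).
Proof.
rewrite /sgn; case: ifP => [|n1]; first exact: SgnPos.
case: ifP => [|n2]; first exact: SgnNeg.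
by apply: SgnZero; case: (doag_ltgt x 0); rewrite ?n1 ?n2.
Qed.

Lemma sgn_gt0 x : 0 < x -> sgn x = 1. Proof. by rewrite /sgn => ->. Qed.
Lemma sgn_lt0 x : x < 0 -> sgn x = -1.
Proof. by move=> x0; rewrite /sgn x0 (lt_gtF x0). Qed.
Lemma sgn_0 : sgn 0 = 0. Proof. by rewrite /sgn ltxx. Qed.

Lemma sgn_eq0 x : sgn x = 0 <-> x = 0.
Proof. by split=> [|->]; [case: (sgnP x)|rewrite sgn_0]. Qed.

Lemma sgn_eq1 x : sgn x = 1 <-> 0 < x.
Proof. by split=> [|/sgn_gt0//]; case: (sgnP x). Qed.

Lemma sgn_eqN1 x : sgn x = -1 <-> x < 0.
Proof. by split=> [|/sgn_lt0//]; case: (sgnP x). Qed.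

Lemma sgnN x : sgn (- x) = - sgn x.
Proof.
case: (sgnP x) => [x0|x0|->]; last by rewrite oppr0 sgn_0.
- by rewrite sgn_lt0 // doag_oppr_lt0.
- by rewrite sgn_gt0 // doag_oppr_gt0.
Qed.

Lemma sgnMn x n : (0 < n)%N -> sgn (x *+ n) = sgn x.
Proof.
move=> n0; case: (sgnP x) => [x0|x0|->]; last by rewrite mul0rn sgn_0.
- by rewrite sgn_gt0 // doag_mulrn_gt0.
- by rewrite sgn_lt0 // -doag_oppr_gt0 -mulNrn doag_mulrn_gt0 // doag_oppr_gt0.
Qed.

Lemma sgnMz x (m : int) : sgn (x *~ m) = sgn x * sgz m.
Proof.
case: m => [[|n]|n].
- by rewrite mulr0z sgn_0 sgz0 mulr0.
- by rewrite -pmulrn sgnMn // gtr0_sgz ?mulr1.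
- by rewrite NegzE mulrNz sgnN sgnMn // sgzN gtr0_sgz // mulrN mulr1.
Qed.

Lemma doag_divz x (m : int) : m != 0 -> exists y, y *~ m = x.
Proof.
case: m => [[|n]|n] // _.
- by have [y <-] := @doag_div x n.+1 isT; exists y.
- by have [y <-] := @doag_div x n.+1 isT; exists (- y); rewrite NegzE mulrNz mulNrz opprK.
Qed.

Lemma doag_gt_ex x : exists y, x < y.
Proof.
case: hU => _ _ _ [z z0].
have [z_gt0|ez|z_lt0] := doag_ltgt 0 z.
- by exists (x + z); rewrite -{1}[x]addr0 doag_ltD2l.
- by rewrite -ez eqxx in z0.
- by exists (x - z); rewrite -{1}[x]addr0 doag_ltD2l doag_oppr_gt0.
Qed.

Lemma doag_lt_ex x : exists y, y < x.
Proof.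
have [y Hy] := doag_gt_ex (- x); exists (- y).
by rewrite -doag_subr_gt0 opprK -[x]opprK addrC doag_subr_gt0.
Qed.

Lemma doag_dense x y : x < y -> exists2 z, x < z & z < y.
Proof.
move=> xy; have [z Ez] := @doag_div (y - x) 2 isT.
have z0 : 0 < z.
  case: (doag_ltgt 0 z) => // [e0|z0].
    by move: xy; rewrite -doag_subr_gt0 -Ez -e0 mul0rn ltxx.
  move: xy; rewrite -doag_subr_gt0 -Ez -[z]opprK mulNrn doag_oppr_gt0.
  by rewrite lt_gtF // doag_mulrn_gt0 // doag_oppr_gt0.
exists (x + z); first by rewrite -{1}[x]addr0 doag_ltD2l.
by rewrite -(subrK x y) -Ez mulr2n [_ + x]addrC doag_ltD2l -{1}[z]addr0 doag_ltD2l.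
Qed.

Lemma doag_max (s : seq U) : s <> [::] ->
  exists2 x, x \in s & forall y, y \in s -> y <= x.
Proof.
elim: s => // a s IH _; have [->|/IH[x xs Hx]] := pselect (s = [::]).
  by exists a; rewrite ?mem_head // => y; rewrite inE => /eqP->.
have [ax|xa] : a <= x \/ x <= a by apply/orP; case: hU.
- exists x; rewrite ?inE ?xs ?orbT // => y; rewrite inE => /orP[/eqP->|/Hx] //.
- exists a; rewrite ?mem_head // => y; rewrite inE => /orP[/eqP->|/Hx yx] //.
  exact: le_trans yx xa.
Qed.

Lemma doag_min (s : seq U) : s <> [::] ->
  exists2 x, x \in s & forall y, y \in s -> x <= y.
Proof.
elim: s => // a s IH _; have [->|/IH[x xs Hx]] := pselect (s = [::]).
  by exists a; rewrite ?mem_head // => y; rewrite inE => /eqP->.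
have [ax|xa] : x <= a \/ a <= x by apply/orP; case: hU.
- exists x; rewrite ?inE ?xs ?orbT // => y; rewrite inE => /orP[/eqP->|/Hx] //.
- exists a; rewrite ?mem_head // => y; rewrite inE => /orP[/eqP->|/Hx yx] //.
  exact: le_trans xa yx.
Qed.

Lemma doag_between (L R : seq U) : (forall x y, x \in L -> y \in R -> x < y) ->
  exists z, (forall x, x \in L -> x < z) /\ (forall y, y \in R -> z < y).
Proof.
move=> H; have [L0|/doag_max[x xL Hx]] := pselect (L = [::]);
  have [R0|/doag_min[y yR Hy]] := pselect (R = [::]).
- by exists 0; rewrite L0 R0.
- have [z zy] := doag_lt_ex y; exists z; rewrite L0; split => // y' /Hy.
  exact: lt_le_trans.
- have [z xz] := doag_gt_ex x; exists z; rewrite R0; split => // x' /Hx xx.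
  exact: le_lt_trans xx xz.
- have [z xz zy] := doag_dense (H _ _ xL yR); exists z; split.
  + by move=> x' /Hx xx; apply: le_lt_trans xx xz.
  + by move=> y' /Hy; apply: lt_le_trans.
Qed.

End OrderedGroup.

(** * Quantifier elimination through signs of terms *)

Section QuantifierElimination.

Fixpoint coef (V : Type) (t : term (option V)) : int :=
  match t with
  | TVar None => 1
  | TVar (Some _) => 0
  | TZero => 0
  | TAdd t1 t2 => coef t1 + coef t2
  | TOpp t => - coef t
  end.

Fixpoint rest (V : Type) (t : term (option V)) : term V :=
  match t with
  | TVar None => TZero
  | TVar (Some v) => TVar v
  | TZero => TZero
  | TAdd t1 t2 => TAdd (rest t1) (rest t2)
  | TOpp t => TOpp (rest t)
  end.

Definition bind (T V : Type) (e : V -> T) (u : T) (o : option V) : T :=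
  if o is Some v then e v else u.

Lemma eval_bind (U : porderZmodType) (V : Type) (e : V -> U) u t :
  eval (bind e u) t = u *~ coef t + eval e (rest t).
Proof.
elim: t => /= [[v|]||t1 -> t2 ->|t ->] /=.
- by rewrite mulr0z add0r.
- by rewrite mulr1z addr0.
- by rewrite mulr0z add0r.
- by rewrite mulrzDr addrACA.
- by rewrite mulrNz opprD.
Qed.

Lemma term_vars_rest (V : Type) (t : term (option V)) v :
  term_vars (rest t) v -> term_vars t (Some v).
Proof.
elim: t => [[w|]||t1 IH1 t2 IH2|t IH] //=; first by move=> ->.
by case=> [/IH1|/IH2]; [left|right].
Qed.

Definition tmuln (V : Type) (t : term V) (n : nat) : term V :=
  iter n (TAdd t) TZero.
Definition tmulz (V : Type) (t : term V) (m : int) : term V :=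
  match m with Posz n => tmuln t n | Negz n => TOpp (tmuln t n.+1) end.

Lemma eval_tmulz (U : porderZmodType) (V : Type) (e : V -> U) t m :
  eval e (tmulz t m) = eval e t *~ m.
Proof.
have H n : eval e (tmuln t n) = eval e t *+ n.
  by elim: n => //= n ->; rewrite mulrS.
by case: m => n /=; rewrite H // NegzE mulrNz -mulrS.
Qed.

Lemma term_vars_tmulz (V : Type) (t : term V) m v :
  term_vars (tmulz t m) v -> term_vars t v.
Proof.
have H n : term_vars (tmuln t n) v -> term_vars t v by elim: n => //= n IH [|/IH].
by case: m => n; [exact: H|exact: (H n.+1)].
Qed.

(** Write a term as k x + r, with root -r/k. Then k1 r2 - k2 r1 is k1 k2 times the difference of the
    two roots, so its sign orders them without any division. *)
Definition cross (V : Type) (t1 t2 : term (option V)) : term V :=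
  TAdd (tmulz (rest t2) (coef t1)) (TOpp (tmulz (rest t1) (coef t2))).

(** The rests decide the terms in which the eliminated variable has coefficient 0; the cross terms
    order the roots of the others. *)
Definition elim_terms (V : Type) (T : seq (term (option V))) : seq (term V) :=
  map (@rest V) T ++ [seq cross t1 t2 | t1 <- T, t2 <- T].

(** [List.In] asks for no decidable equality, which terms over an arbitrary type of variables need
    not have. *)
Definition lmem (T : Type) (s : seq T) (x : T) : Prop := List.In x s.

Lemma lmem_cat (T : Type) (s1 s2 : seq T) x :
  lmem (s1 ++ s2) x <-> lmem s1 x \/ lmem s2 x.
Proof. exact: List.in_app_iff. Qed.

Lemma lmem_map (T T' : Type) (f : T -> T') (s : seq T) y :
  lmem (map f s) y <-> exists2 x, lmem s x & f x = y.
Proof.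
by rewrite /lmem List.in_map_iff; split=> [[x []]|[x]]; exists x.
Qed.

Lemma lmem_allpairs (T1 T2 T' : Type) (f : T1 -> T2 -> T') s1 s2 x1 x2 :
  lmem s1 x1 -> lmem s2 x2 -> lmem [seq f x y | x <- s1, y <- s2] (f x1 x2).
Proof.
move=> H1 H2; elim: s1 H1 => //= a s1 IH [->|/IH H]; apply/lmem_cat; [left|by right].
by apply/lmem_map; exists x2.
Qed.

Lemma lmem_allpairsP (T1 T2 T' : Type) (f : T1 -> T2 -> T') s1 s2 y :
  lmem [seq f x y | x <- s1, y <- s2] y ->
  exists x1 x2, [/\ lmem s1 x1, lmem s2 x2 & y = f x1 x2].
Proof.
elim: s1 => //= a s1 IH /lmem_cat[/lmem_map[x2 H2 <-]|/IH[x1 [x2 [H1 H2 ->]]]].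
- by exists a, x2; split=> //; left.
- by exists x1, x2; split=> //; right.
Qed.

Definition agree (U1 U2 : porderZmodType) (V : Type) (e1 : V -> U1)
    (e2 : V -> U2) (T : seq (term V)) : Prop :=
  forall t, lmem T t -> sgn (eval e1 t) = sgn (eval e2 t).

Section TwoModels.
Variables (U1 U2 : porderZmodType) (h1 : DOAG U1) (h2 : DOAG U2).

Lemma order_extension (L : seq (U1 * U2)) (u1 : U1) :
  (forall a b, a \in L -> b \in L -> sgn (a.1 - b.1) = sgn (a.2 - b.2)) ->
  exists u2, forall a, a \in L -> sgn (u1 - a.1) = sgn (u2 - a.2).
Proof.
move=> H; have [/hasP[a aL /eqP Ea]|/hasPn Nu1] := boolP (has (fun a => a.1 == u1) L).
  by exists a.2 => b bL; rewrite -Ea H.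
pose Lo := [seq a.2 | a <- L & a.1 < u1]; pose Up := [seq a.2 | a <- L & u1 < a.1].
have [x y|z [Hlo Hup]] := @doag_between _ h2 Lo Up.
  move=> /mapP[a]; rewrite mem_filter => /andP[a1 aL] ->.
  move=> /mapP[b]; rewrite mem_filter => /andP[b1 bL] ->.
  have ab : 0 < b.1 - a.1 by rewrite (doag_subr_gt0 h1) (lt_trans a1 b1).
  have := H _ _ bL aL; rewrite sgn_gt0 // -(doag_subr_gt0 h2).
  by case: (sgnP h2).
exists z => a aL; case: (doag_ltgt h1 a.1 u1) => [lt|eq|gt].
- have lt2 : a.2 < z by apply: Hlo; apply: map_f; rewrite mem_filter lt.
  by rewrite !sgn_gt0 ?doag_subr_gt0.
- by have := Nu1 _ aL; rewrite eq eqxx.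
- have gt2 : z < a.2 by apply: Hup; apply: map_f; rewrite mem_filter gt.
  by rewrite -[u1 - _]opprB -[z - _]opprB !sgnN // !sgn_gt0 ?doag_subr_gt0.
Qed.

(** One step of a back-and-forth. The sign of a term at u1 depends on the position of u1 among the
    roots; the cross terms put the roots in the same order in both groups, and [order_extension]
    places u2 accordingly. *)
Lemma agree_extension (V : Type) (e1 : V -> U1) (e2 : V -> U2) T u1 :
  agree e1 e2 (elim_terms T) ->
  exists u2, agree (bind e1 u1) (bind e2 u2) T.
Proof.
move=> H.
have Hr t : lmem T t -> sgn (eval e1 (rest t)) = sgn (eval e2 (rest t)).
  by move=> tT; apply: H; apply/lmem_cat; left; apply/lmem_map; exists t.
have Hc t t' : lmem T t -> lmem T t' -> sgn (eval e1 (cross t t')) = sgn (eval e2 (cross t t')).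
  by move=> tT t'T; apply: H; apply/lmem_cat; right; apply: lmem_allpairs.
have root (U : porderZmodType) (hU : DOAG U) (e : V -> U) :
    {f : term (option V) -> U & forall t, coef t != 0 -> f t *~ coef t = - eval e (rest t)}.
  apply: (@choice _ _ (fun t y => coef t != 0 -> y *~ coef t = - eval e (rest t))) => t.
  have [->|n0] := eqVneq (coef t) 0; first by exists 0.
  by have [y Ey] := doag_divz hU (- eval e (rest t)) n0; exists y.
have [f1 Hf1] := root _ h1 e1; have [f2 Hf2] := root _ h2 e2.
pose T' := [seq t <- T | coef t != 0].
have memT' a : a \in [seq (f1 t, f2 t) | t <- T'] ->
    exists2 t, lmem T t & coef t != 0 /\ a = (f1 t, f2 t).
  rewrite /T'; elim: (T) => //= t T0 IH; case: ifP => [n0|_]; last first.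
    by move=> /IH[t' H1 H2]; exists t' => //; right.
  rewrite inE => /orP[/eqP->|/IH[t' H1 H2]]; first by exists t => //; left.
  by exists t' => //; right.
have [|u2 Hu2] := @order_extension [seq (f1 t, f2 t) | t <- T'] u1.
  move=> a b /memT'[t tT [tn0 ->]] /memT'[t' t'T [t'n0 ->]] /=.
  have E (U : porderZmodType) (hU : DOAG U) (e : V -> U) f :
      (forall t, coef t != 0 -> f t *~ coef t = - eval e (rest t)) ->
      sgn (f t - f t') * sgz (coef t * coef t') = sgn (eval e (cross t t')).
    move=> Hf; rewrite -sgnMz // mulrzBl mulrzA Hf // [coef t * _]mulrC mulrzA Hf //.
    by rewrite /= !eval_tmulz !mulNrz opprK addrC.
  have := Hc _ _ tT t'T; rewrite -!(E _ _ _ _ Hf1) // -(E _ _ _ _ Hf2) //.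
  by apply: mulIf; rewrite sgz_eq0 mulf_neq0.
exists u2 => t tT; rewrite !eval_bind.
have [->|n0] := eqVneq (coef t) 0; first by rewrite !mulr0z !add0r Hr.
have E (U : porderZmodType) (hU : DOAG U) (e : V -> U) f u :
    f t *~ coef t = - eval e (rest t) ->
    sgn (u *~ coef t + eval e (rest t)) = sgn (u - f t) * sgz (coef t).
  by move=> Hf; rewrite -sgnMz // mulrzBl Hf opprK.
rewrite (E _ h1 e1 f1) ?Hf1 // (E _ h2 e2 f2) ?Hf2 // (Hu2 (f1 t, f2 t)) //.
have : lmem T' t by apply/List.filter_In.
elim: (T') => //= t' T0 IH [->|/IH]; first by rewrite inE eqxx.
by rewrite inE orbC => ->.
Qed.

End TwoModels.

Lemma agree_sub (U1 U2 : porderZmodType) (V : Type) (e1 : V -> U1)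
    (e2 : V -> U2) (T T' : seq (term V)) :
  (forall t, lmem T t -> lmem T' t) -> agree e1 e2 T' -> agree e1 e2 T.
Proof. by move=> TT H t Ht; apply/H/TT. Qed.

Lemma agree_sym (U1 U2 : porderZmodType) (V : Type) (e1 : V -> U1)
    (e2 : V -> U2) (T : seq (term V)) : agree e1 e2 T -> agree e2 e1 T.
Proof. by move=> H t /H. Qed.

Lemma elim_terms_vars (V : Type) (T : seq (term (option V))) t v :
  lmem (elim_terms T) t -> term_vars t v ->
  exists2 t', lmem T t' & term_vars t' (Some v).
Proof.
rewrite /elim_terms => /lmem_cat[/lmem_map[t' Ht' <-]|H].
  by move=> H; exists t' => //; apply: term_vars_rest.
have [t1 [t2 [H1 H2 ->]]] := lmem_allpairsP H.
by case=> Hv; [exists t2|exists t1] => //; apply: term_vars_rest; apply: term_vars_tmulz Hv.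
Qed.

Fixpoint terms (V : Type) (phi : formula V) : seq (term V) :=
  match phi with
  | FEq t1 t2 => [:: TAdd t1 (TOpp t2)]
  | FLt t1 t2 => [:: TAdd t2 (TOpp t1)]
  | FNot phi => terms phi
  | FAnd phi psi => terms phi ++ terms psi
  | FEx phi => elim_terms (terms phi)
  end.

Lemma terms_vars (V : Type) (phi : formula V) t v :
  lmem (terms phi) t -> term_vars t v -> free_vars phi v.
Proof.
elim: phi t v => //= {V} V.
- by move=> t1 t2 t v [<-|].
- by move=> t1 t2 t v [<-|//] /= [H|H]; [right|left].
- by move=> phi IH psi IH' t v /lmem_cat[H|H] Hv; [left; apply: IH Hv|right; apply: IH' Hv].
- by move=> phi IH t v H Hv; have [t' H1 H2] := elim_terms_vars H Hv; apply: IH H2.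
Qed.

(* Quantifier elimination, in semantic form: the truth value of a formula is a
   function of the signs of finitely many terms, uniformly in all models. *)
Lemma sat_agree (U1 U2 : porderZmodType) (V : Type) (phi : formula V)
    (e1 : V -> U1) (e2 : V -> U2) : DOAG U1 -> DOAG U2 ->
  agree e1 e2 (terms phi) -> sat e1 phi <-> sat e2 phi.
Proof.
move=> h1 h2; elim: phi e1 e2 => //= {V} V.
- move=> t1 t2 e1 e2 H; have /= := H _ (or_introl erefl).
  have E (U : porderZmodType) (a b : U) : a = b <-> a - b = 0.
    by split=> [->|/eqP]; rewrite ?subrr // subr_eq0 => /eqP.
  by rewrite (E U1) (E U2) -(sgn_eq0 h1) -(sgn_eq0 h2) => ->.
- move=> t1 t2 e1 e2 H; have /= := H _ (or_introl erefl).
  by rewrite -(doag_subr_gt0 h1) -(doag_subr_gt0 h2) -(sgn_eq1 h1) -(sgn_eq1 h2) => ->.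
- by move=> phi IH e1 e2 H; rewrite (IH e1 e2).
- move=> phi IH psi IH' e1 e2 H.
  by rewrite (IH e1 e2) ?(IH' e1 e2) //; apply: agree_sub H => t Ht; apply/lmem_cat; [right|left].
- move=> phi IH e1 e2 H; split=> -[u].
  + by have [u2 H2] := agree_extension h1 h2 u H => /(IH _ _ H2); exists u2.
  + have [u2 H2] := agree_extension h2 h1 u (agree_sym H).
    by move/(IH _ _ (agree_sym H2)); exists u2.
Qed.

(** Completeness of the theory: a finite sign pattern occurring in one group occurs in any other.
    The induction is on a bound for the variables; without variables every term evaluates to 0 in
    both groups. *)
Lemma agree_realize (U1 U2 : porderZmodType) (e1 : nat -> U1)
    (T : seq (term nat)) : DOAG U1 -> DOAG U2 ->
  exists e2 : nat -> U2, agree e1 e2 T.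
Proof.
move=> h1 h2.
have [n] : exists n, forall t v, lmem T t -> term_vars t v -> (v < n)%N.
  elim: T => [|t T [n IH]]; first by exists 0%N.
  have [m Hm] : exists m, forall v, term_vars t v -> (v < m)%N.
    elim: t {IH} => [v||t1 [m1 H1] t2 [m2 H2]|t [m H]] /=.
    + by exists v.+1 => w ->.
    + by exists 0%N.
    + by exists (maxn m1 m2) => v [/H1|/H2]; rewrite leq_max => ->; rewrite ?orbT.
    + by exists m.
  exists (maxn m n) => s v /= [<- /Hm|/IH H /H]; rewrite leq_max => ->; by rewrite ?orbT.
elim: n T => [|n IH] T H.
  exists (fun=> 0) => t tT; rewrite (@eval_ext _ _ _ (fun=> 0)).
    have E (U : porderZmodType) : eval (fun=> 0 : U) t = 0.
      by elim: t {tT} => //= [t1 -> t2 ->|t ->]; rewrite ?addr0 ?oppr0.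
    by rewrite !E !sgn_0.
  by move=> v /(H _ _ tT).
(* The last variable n becomes the bound one, so that [elim_terms] removes it. *)
pose f i := if i == n then None else Some i.
have [|e2 He2] := IH (elim_terms (map (term_rename f) T)).
  move=> t v Ht Hv; have [t' /lmem_map[t0 t0T <-]] := elim_terms_vars Ht Hv.
  rewrite term_vars_rename => -[w /(H _ _ t0T)]; rewrite ltnS leq_eqVlt /f.
  by case: eqP => //= _ + [<-].
have [u Hu] := agree_extension h1 h2 (e1 n) He2.
exists (fun i => bind e2 u (f i)) => t tT.
have -> : eval e1 t = eval (bind e1 (e1 n)) (term_rename f t).
  by rewrite eval_rename; apply: eval_ext => v _; rewrite /= /f; case: eqP => [->|].
rewrite Hu ?eval_rename //; apply/lmem_map; by exists t.
Qed.

End QuantifierElimination.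

(** * Linear implications, transferred to the rationals *)

Section Transfer.

Definition implies_all (U : porderZmodType) (hs : seq (formula nat))
    (g : formula nat) (e : nat -> U) : Prop :=
  foldr (fun h P => sat e h -> P) (sat e g) hs.

Lemma doag_rat : DOAG rat.
Proof.
split=> [x y|x y z|n x n0|].
- exact: le_total.
- by rewrite ltrD2l.
- by exists (x / n%:R); rewrite -[LHS]mulr_natr divfK // pnatr_eq0 -lt0n n0.
- by exists (1 : rat).
Qed.

(* Any two divisible ordered abelian groups satisfy the same linear
   implications, so these can be proved in the ordered field of rationals. *)
Lemma doag_transfer (U : porderZmodType) (hU : DOAG U) hs g :
  (forall e : nat -> rat, implies_all hs g e) ->
  forall e : nat -> U, implies_all hs g e.
Proof.
move=> H e.
have [e2 He2] := agree_realize e (flatten (map (@terms nat) (g :: hs))) hU doag_rat.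
have {H} := H e2; rewrite /implies_all.
have Hg : sat e g <-> sat e2 g.
  by apply: sat_agree hU doag_rat _ => t Ht; apply: He2; apply/lmem_cat; left.
have : forall h, lmem hs h -> sat e h <-> sat e2 h.
  move=> h Hh; apply: sat_agree hU doag_rat _ => t Ht; apply: He2.
  apply/lmem_cat; right; elim: hs Hh => //= h' hs IH [->|/IH {}IH]; apply/lmem_cat; [by left|by right].
elim: hs {He2} => [_|h hs IH Hs] /=; first by apply Hg.
move=> H1 H2; apply: IH.
  by move=> h' Hh'; apply: Hs; right.
by apply: H1; apply/Hs => //; left.
Qed.

Lemma doag_leW (U : porderZmodType) (x y : U) : x <= y -> ~ (y < x).
Proof. by move=> xy /lt_geF; rewrite xy. Qed.

Lemma doag_leI (U : porderZmodType) (x y : U) : DOAG U -> ~ (y < x) -> x <= y.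
Proof. by move=> hU /negP; rewrite (doag_leNgt hU). Qed.

Lemma doag_negltI (x y : rat) : y <= x -> ~ (x < y).
Proof. by rewrite leNgt => /negP. Qed.
Lemma doag_negltE (x y : rat) : ~ (x < y) -> y <= x.
Proof. by move/negP; rewrite -leNgt. Qed.

End Transfer.

(* Atoms are compared up to conversion: the same operation may be reached
   through different paths in the hierarchy of algebraic structures. *)
Ltac doag_index x l :=
  lazymatch l with
  | cons ?y ?l' =>
      match goal with
      | _ => let _ := constr:(erefl x : x = y) in constr:(O)
      | _ => let n := doag_index x l' in constr:(S n)
      end
  end.

Ltac doag_insert x l :=
  match goal with
  | _ => let _ := doag_index x l in l
  | _ => constr:(cons x l)
  end.

Ltac doag_atoms t l :=
  lazymatch t with
  | @GRing.add _ ?a ?b => let l1 := doag_atoms a l in doag_atoms b l1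
  | @GRing.opp _ ?a => doag_atoms a l
  | @GRing.zero _ => l
  | _ => doag_insert t l
  end.

Ltac doag_term t l :=
  lazymatch t with
  | @GRing.add _ ?a ?b =>
      let a' := doag_term a l in let b' := doag_term b l in constr:(TAdd a' b')
  | @GRing.opp _ ?a => let a' := doag_term a l in constr:(TOpp a')
  | @GRing.zero _ => constr:(@TZero nat)
  | _ => let n := doag_index t l in constr:(TVar n)
  end.

Ltac doag_atoms_goal g l :=
  lazymatch g with
  | ?h -> ?g' => let l1 := doag_atoms_goal h l in doag_atoms_goal g' l1
  | is_true (@Order.lt _ _ ?a ?b) => let l1 := doag_atoms a l in doag_atoms b l1
  | @eq _ ?a ?b => let l1 := doag_atoms a l in doag_atoms b l1
  | ~ ?h => doag_atoms_goal h l
  | False => l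
  end.

Ltac doag_atom g l :=
  lazymatch g with
  | is_true (@Order.lt _ _ ?a ?b) =>
      let a' := doag_term a l in let b' := doag_term b l in constr:(FLt a' b')
  | @eq _ ?a ?b =>
      let a' := doag_term a l in let b' := doag_term b l in constr:(FEq a' b')
  | ~ ?h => let h' := doag_atom h l in constr:(FNot h')
  | False => constr:(FLt (@TZero nat) (@TZero nat))
  end.

Ltac doag_hyps g l :=
  lazymatch g with
  | ?h -> ?g' =>
      let h' := doag_atom h l in
      lazymatch doag_hyps g' l with
      | pair ?hs ?c => constr:(pair (cons h' hs) c)
      end
  | _ => let c := doag_atom g l in constr:(pair (@nil (formula nat)) c)
  end.

Lemma doag_absurd (U : porderZmodType) : (0 : U) < 0 -> False.
Proof. by rewrite ltxx. Qed.

(** The hypotheses and the goal about U are reified over their atoms, [doag_transfer] moves the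
    implication to [rat], and [lra] proves it there. Formulas only have strict inequality, so x <= y
    travels as the negation of y < x. *)
Ltac doag hU :=
  let U := lazymatch type of hU with DOAG ?U => U end in
  lazymatch goal with
  | |- is_true (@Order.le _ _ _ _) => apply: (doag_leI hU)
  | |- False => apply: (@doag_absurd U)
  | |- _ => idtac
  end;
  repeat match goal with
  | H : is_true (@Order.le _ _ ?x _) |- _ =>
      let T := type of x in unify T (U : Type); move/doag_leW: H => H
  end;
  repeat match goal with
  | H : is_true (@Order.lt _ _ ?x _) |- _ =>
      let T := type of x in unify T (U : Type); revert H
  | H : ~ is_true (@Order.lt _ _ ?x _) |- _ =>
      let T := type of x in unify T (U : Type); revert H
  | H : @eq ?T _ _ |- _ => unify T (U : Type); revert H
  end;
  lazymatch goal with
  | |- ?g =>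
      let l := doag_atoms_goal g (@nil U) in
      lazymatch doag_hyps g l with
      | pair ?hs ?c =>
          change (@implies_all U hs c (nth (0 : U) l));
          apply: (doag_transfer hU);
          let e := fresh "e" in
          intro e; cbv [implies_all foldr sat eval];
          repeat match goal with
          | |- ~ _ => fail 1
          | |- _ -> _ => let H := fresh "H" in intro H; try move/doag_negltE: H => H
          end;
          try apply: doag_negltI;
          lra
      end
  end.


(** * Small sets *)

Section Cardinals.

Lemma card_le_rel (T T' : Type) (A : set T) (B : set T') (R : T -> T' -> Prop) :
  (forall a, A a -> exists2 b, B b & R a b) ->
  (forall a a' b, A a -> A a' -> R a b -> R a' b -> a = a') -> A #<= B.
Proof.
move=> H1 H2.
have [|f Hf] := @choice (set_type A) (set_type B) (fun a b => R (set_val a) (set_val b)).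
  move=> [a Aa]; have [b Bb Rab] := H1 _ (set_mem Aa).
  by exists (SigSub (mem_set Bb)).
apply/card_leP/injfunPex; exists f => // -[a Aa] [a' Aa'] _ _ faa.
have := Hf (SigSub Aa'); rewrite -[SigSub Aa']/(exist _ a' Aa') -faa => Ha'.
have /= E := H2 _ _ _ (set_mem Aa) (set_mem Aa') (Hf (SigSub Aa)) Ha'.
by subst a'; congr SigSub; apply: Prop_irrelevance.
Qed.

Lemma card_le_relP (T T' : Type) (A : set T) (B : set T') : A #<= B ->
  exists R : T -> T' -> Prop,
    [/\ forall a, A a -> exists b, R a b, forall a b, R a b -> A a /\ B b,
        forall a b b', R a b -> R a b' -> b = b' &
        forall a a' b, R a b -> R a' b -> a = a'].
Proof.
move=> /card_leP/injfunPex[f _ finj].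
exists (fun a b => exists2 x : set_type A, set_val x = a & set_val (f x) = b); split.
- by move=> a Aa; exists (set_val (f (SigSub (mem_set Aa)))), (SigSub (mem_set Aa)).
- by move=> _ _ [[a Aa] <- <-]; split; [exact: set_mem Aa|case: (f _) => b Bb; exact: set_mem Bb].
- by move=> a b b' [x xa <-] [x' x'a <-]; congr (set_val (f _)); apply: val_inj; exact: etrans xa (esym x'a).
- move=> a a' b [x <- xb] [x' <- x'b]; congr set_val; apply: finj; rewrite ?inE //.
  by apply: val_inj; exact: etrans xb (esym x'b).
Qed.

(** Zorn's lemma for graphs of partial injections: a maximal one has full domain or full range,
    since otherwise one more pair could be added. *)
Lemma card_le_total (T T' : Type) (A : set T) (B : set T') :
  A #<= B \/ B #<= A.
Proof.
pose P (G : set (T * T')) := [/\ forall x, G x -> A x.1 /\ B x.2,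
  forall x y, G x -> G y -> x.1 = y.1 -> x = y &
  forall x y, G x -> G y -> x.2 = y.2 -> x = y].
have [F FP Ftot|G [[GAB Gfun Ginj] Gmax]] := @Zorn_bigcup _ P.
  have two x y : (\bigcup_(X in F) X) x -> (\bigcup_(X in F) X) y ->
      exists2 X, F X & X x /\ X y.
    move=> [X FX Xx] [Y FY Yy]; have [XY|YX] := Ftot _ _ FX FY.
    - by exists Y => //; split => //; apply: XY.
    - by exists X => //; split => //; apply: YX.
  split.
  - by move=> x [X /FP[H _ _] /H].
  - by move=> x y Hx Hy; have [X /FP[_ H _] [Xx Xy]] := two _ _ Hx Hy; apply: H.
  - by move=> x y Hx Hy; have [X /FP[_ _ H] [Xx Xy]] := two _ _ Hx Hy; apply: H.
have [domA|] := pselect (forall a, A a -> exists b, G (a, b)).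
  left; apply: (@card_le_rel _ _ _ _ (fun a b => G (a, b))) => [a /domA[b Gab]|].
    by exists b => //; case: (GAB _ Gab).
  by move=> a a' b _ _ Gab Ga'b; case: (Ginj _ _ Gab Ga'b erefl).
have [ranB _|] := pselect (forall b, B b -> exists a, G (a, b)).
  right; apply: (@card_le_rel _ _ _ _ (fun b a => G (a, b))) => [b /ranB[a Gab]|].
    by exists a => //; case: (GAB _ Gab).
  by move=> b b' a _ _ Gab Gab'; case: (Gfun _ _ Gab Gab' erefl).
move=> /existsNP[b /not_implyP[Bb nb]] /existsNP[a /not_implyP[Aa na]].
exfalso; apply: (Gmax (G `|` [set (a, b)])).
  split; first by move=> x; left.
  by move=> /(_ (a, b) (or_intror erefl)) Gab; apply: nb; exists a.
split.
- by move=> x [/GAB//|->].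
- move=> [a1 b1] [a2 b2] [G1|[-> ->]] [G2|[-> ->]] //=; first exact: (Gfun _ _ G1 G2).
  + by move=> Ea; case: na; exists b1; rewrite -Ea.
  + by move=> Ea; case: na; exists b2; rewrite Ea.
- move=> [a1 b1] [a2 b2] [G1|[-> ->]] [G2|[-> ->]] //=; first exact: (Ginj _ _ G1 G2).
  + by move=> Eb; case: nb; exists a1; rewrite -Eb.
  + by move=> Eb; case: nb; exists a2; rewrite Eb.
Qed.

Lemma card_le_power (T T' : Type) (A : set T) (B : set T') : A #<= B ->
  [set Z | Z `<=` A] #<= [set Z | Z `<=` B].
Proof.
move=> /card_le_relP[R [Rtot RAB Rfun Rinj]].
apply: (@card_le_rel _ _ _ _ (fun Z W => W = [set b | exists2 a, Z a & R a b])).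
  by move=> Z ZA; exists [set b | exists2 a, Z a & R a b] => //= b [a _ /RAB[]].
suff H Z Z' : Z `<=` A -> [set b | exists2 a, Z a & R a b] = [set b | exists2 a, Z' a & R a b] ->
    Z `<=` Z'.
  by move=> Z Z' W ZA Z'A -> E; apply/seteqP; split; apply: H.
move=> ZA E a Za; have [b Rab] := Rtot _ (ZA _ Za).
have : [set b | exists2 a, Z a & R a b] b by exists a.
by rewrite E => -[a' Za' Ra'b]; rewrite (Rinj _ _ _ Rab Ra'b).
Qed.

Variables (K : Type) (hK : uncountable_strong_limit K).

Lemma small_le (T T' : Type) (A : set T) (B : set T') :
  A #<= B -> card_lt B [set: K] -> card_lt A [set: K].
Proof.
move=> AB [BK nKB]; split; first exact: card_le_trans AB BK.
by move=> KA; apply: nKB; apply: card_le_trans KA AB.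
Qed.

Lemma small_power (T : Type) (A : set T) :
  card_lt A [set: K] -> card_lt [set Z | Z `<=` A] [set: K].
Proof.
move=> HA; have [/card_subP[Y YA _] _] := HA.
have /card_eqPle[YA1 AY1] := YA.
apply: (small_le (card_le_power AY1)).
by case: hK => _; apply; apply: small_le HA.
Qed.

(** No cardinal arithmetic: if A embeds in B, the union embeds in the double power set of B, which
    is small because kappa is a strong limit. A point u of B is coded by {{u}}, and a point of A
    outside B with image b by {0, {b}}, 0 being the empty set. *)
Lemma small_setU (T : Type) (A B : set T) :
  card_lt A [set: K] -> card_lt B [set: K] -> card_lt (A `|` B) [set: K].
Proof.
wlog AB : A B / A #<= B.
  move=> H HA HB; have [AB|BA] := card_le_total A B; first exact: H.
  by rewrite setUC; apply: H.
move=> _ HB; have := small_power (small_power HB); apply: small_le.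
have [R [Rtot RAB Rfun Rinj]] := card_le_relP AB.
apply: (@card_le_rel _ _ _ _ (fun u W => (B u /\ W = [set [set u]]) \/
  (~ B u /\ exists2 b, R u b & W = [set set0; [set b]]))).
  move=> u Hu; have [Bu|nBu] := pselect (B u).
    exists [set [set u]]; last by left.
    by move=> _ -> _ ->.
  have {}Hu : A u by case: Hu.
  have [b Rub] := Rtot _ Hu; exists [set set0; [set b]]; last by right; split => //; exists b.
  by move=> _ [-> //|-> _ ->]; case: (RAB _ _ Rub).
move=> u u' W _ _.
have n1 (b v : T) : [set set0; [set b]] <> [set [set v]].
  move=> E; have : [set [set v]] set0 by rewrite -E; left.
  by move=> /= E'; have : [set v] v by []; rewrite -E'.
case=> [[Bu ->]|[nBu [b Rub ->]]] [[Bu']|[nBu' [b' Rub']]].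
- move=> E; have : [set [set u']] [set u] by rewrite -E.
  by move=> /= E'; have : [set u] u by []; rewrite E'.
- by move/esym/n1.
- by move/n1.
- move=> E; have : [set set0; [set b']] [set b] by rewrite -E; right.
  case=> /= E'; have Hb : [set b] b by []; rewrite E' in Hb => //.
  by move: Rub; rewrite Hb => /Rinj; apply.
Qed.

Lemma small_countable (T : Type) (A : set T) :
  countable A -> card_lt A [set: K].
Proof. by move=> HA; apply: (small_le HA); case: hK. Qed.

Lemma small_finite (T : Type) (A : set T) :
  finite_set A -> card_lt A [set: K].
Proof. by move=> HA; apply: small_countable; apply: finite_set_countable. Qed.

End Cardinals.

(** * Types, affine functions and automorphisms *)

Lemma finite_lmem (T : Type) (A : set T) : finite_set A ->
  exists l, forall t, A t <-> lmem l t.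
Proof.
move=> /(@finite_seqP {classic T})[l El]; exists l => t; rewrite El.
elim: (l) => //= a l' IH; rewrite /= inE; split.
  by case/orP => [/eqP->|/IH]; [left|right].
by case=> [->|/IH]; [rewrite eqxx|move=> ->; rewrite orbT].
Qed.

(** * Finite entailment and complete types *)

Section Forcing.
Variable U : porderZmodType.
Implicit Types V : Type.

Definition penv V (e : V -> U) (v : V + U) : U :=
  match v with inl x => e x | inr u => u end.

Lemma psatE V (e : V -> U) phi : psat e phi = sat (penv e) phi.
Proof. by []. Qed.

Lemma psat_rename V W (f : V + U -> W + U) (e : W -> U) (e' : V -> U) phi :
  (forall v, free_vars phi v -> penv e (f v) = penv e' v) ->
  psat e (rename f phi) <-> psat e' phi.
Proof. by move=> H; rewrite !psatE sat_rename; apply: sat_ext. Qed.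

(* For [Q = psat^~ phi] this is [entails S phi]. *)
Definition forced V (S : set (formula (V + U))) (Q : (V -> U) -> Prop) :=
  exists s : set (formula (V + U)), [/\ finite_set s, s `<=` S &
    forall e : V -> U, (forall psi, s psi -> psat e psi) -> Q e].

Section FixV.
Variables (V : Type) (S : set (formula (V + U))).

Lemma forcedW (Q Q' : (V -> U) -> Prop) :
  forced S Q -> (forall e, Q e -> Q' e) -> forced S Q'.
Proof. by move=> [s [H1 H2 H3]] H; exists s; split => // e /H3/H. Qed.

Lemma forcedI (Q Q' : (V -> U) -> Prop) :
  forced S Q -> forced S Q' -> forced S (fun e => Q e /\ Q' e).
Proof.
move=> [s [H1 H2 H3]] [s' [H1' H2' H3']]; exists (s `|` s'); split.
- by rewrite finite_setU.
- by move=> phi [/H2|/H2'].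
- by move=> e H; split; [apply: H3|apply: H3'] => psi Hpsi; apply: H; [left|right].
Qed.

Lemma forced2 (Q1 Q2 Q : (V -> U) -> Prop) : forced S Q1 -> forced S Q2 ->
  (forall e, Q1 e -> Q2 e -> Q e) -> forced S Q.
Proof. by move=> H1 H2 H; apply: forcedW (forcedI H1 H2) _ => e []; apply: H. Qed.

Lemma forced3 (Q1 Q2 Q3 Q : (V -> U) -> Prop) :
  forced S Q1 -> forced S Q2 -> forced S Q3 ->
  (forall e, Q1 e -> Q2 e -> Q3 e -> Q e) -> forced S Q.
Proof.
move=> H1 H2 H3 H; apply: forced2 H1 (forcedI H2 H3) _ => e q1 [q2 q3].
exact: H.
Qed.

Lemma forcedT (Q : (V -> U) -> Prop) : (forall e, Q e) -> forced S Q.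
Proof. by move=> H; exists set0; split => //; apply: finite_set0. Qed.

Lemma forced_in phi : S phi -> forced S (fun e => psat e phi).
Proof.
move=> H; exists [set phi]; split; first exact: finite_set1.
- by move=> _ ->.
- by move=> e; apply.
Qed.

Lemma forced_ex (Q : (V -> U) -> Prop) :
  consistent S -> forced S Q -> exists e, Q e.
Proof. by move=> H [s [H1 H2 H3]]; have [e /H3] := H _ H1 H2; exists e. Qed.

Lemma forced_lmem (T : Type) (s : seq T) (Q : T -> (V -> U) -> Prop) :
  (forall t, lmem s t -> forced S (Q t)) ->
  forced S (fun e => forall t, lmem s t -> Q t e).
Proof.
elim: s => [|t s IH] H; first exact: forcedT.
apply: forced2 (H t _) (IH _) _ => [|t' Ht'|e H1 H2 t' []]; first by left.
- by apply: H; right.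
- by move=> <-.
- exact: H2.
Qed.

Lemma forced_finite (T : Type) (A : set T) (Q : T -> (V -> U) -> Prop) :
  finite_set A -> (forall t, A t -> forced S (Q t)) ->
  forced S (fun e => forall t, A t -> Q t e).
Proof.
move=> /finite_lmem[l El] H; apply: forcedW (@forced_lmem _ l Q _) _ => [t /El/H//|e He t].
by move/El; apply: He.
Qed.

End FixV.

Lemma forced_sub V (S S' : set (formula (V + U))) (Q : (V -> U) -> Prop) :
  S `<=` S' -> forced S Q -> forced S' Q.
Proof. by move=> SS [s [H1 H2 H3]]; exists s; split => // phi /H2/SS. Qed.

Lemma forced_rename V W (f : V -> W) (S : set (formula (V + U))) Q :
  forced S Q ->
  forced (rename (sum_map f id) @` S) (fun e => Q (e \o f)).
Proof.
move=> [s [H1 H2 H3]]; exists (rename (sum_map f id) @` s); split.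
- exact: finite_image.
- by apply: image_subset.
- move=> e H; apply: H3 => psi Hpsi.
  have := H _ (imageP _ Hpsi); apply psat_rename => -[v|u] //.
Qed.

Section Complete.
Variables (V : Type) (A : set U) (p : set (formula (V + U))).
Hypothesis hp : complete_type A p.

Lemma complete_forced phi : over A phi -> p phi <-> forced p (fun e => psat e phi).
Proof.
case: hp => pA pc pd oA; split=> [/forced_in//|H].
case: (pd _ oA) => // /forced_in H'.
by have [e []] := forced_ex pc (forcedI H H').
Qed.

Lemma complete_not phi : over A phi -> p (FNot phi) <-> ~ p phi.
Proof.
case: hp => pA pc pd oA; split=> [/forced_in H /forced_in H'|].
- by have [e []] := forced_ex pc (forcedI H H').
- by case: (pd _ oA).
Qed.

Lemma forced_absurd : ~ forced p (fun=> False).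
Proof. by case: hp => _ pc _ /(forced_ex pc)[]. Qed.

Lemma forced_decide (Q : (V -> U) -> Prop) phi :
  over A phi -> (forall e, psat e phi <-> Q e) ->
  forced p Q \/ forced p (fun e => ~ Q e).
Proof.
case: hp => pA pc pd oA H; case: (pd _ oA) => /forced_in H'; [left|right].
- by apply: forcedW H' _ => e /H.
- by apply: forcedW H' _ => e He /H.
Qed.

End Complete.

Lemma overT V (phi : formula (V + U)) : over setT phi.
Proof. by []. Qed.

Definition type_at V (A : set U) (e : V -> U) : set (formula (V + U)) :=
  [set phi | over A phi /\ psat e phi].

Lemma complete_type_at V (A : set U) (e : V -> U) :
  complete_type A (type_at A e).
Proof.
split=> [phi []//|s _ sS|phi oA]; first by exists e => phi /sS[].
by have [H|H] := pselect (psat e phi); [left|right].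
Qed.

Definition realizes V (p : set (formula (V + U))) (A : set U) (x : V -> U) :=
  forall phi, p phi -> over A phi -> psat x phi.

Lemma realizes_sub V (p : set (formula (V + U))) (A B : set U) x :
  A `<=` B -> realizes p B x -> realizes p A x.
Proof. by move=> AB H phi pphi oA; apply: H => // u /oA/AB. Qed.

Lemma realizes_iff V (p : set (formula (V + U))) (A : set U) x phi :
  complete_type setT p -> realizes p A x -> over A phi -> p phi <-> psat x phi.
Proof.
move=> hp H oA; split=> [Hp|Hs]; first exact: H.
by apply: contrapT => /(complete_not hp (@overT _ _)) => /H /(_ oA).
Qed.

End Forcing.

(** * Affine functions and their signs *)

Section Affine.
Variables (U : porderZmodType) (hU : DOAG U).
Implicit Types (A B : set U) (V : finType).

(* The divisible hull of the subgroup generated by [A]; it need not be replaced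
   by a small set, being only ever used to name parameters. *)
Definition dcl A (a : U) : Prop :=
  exists n (t : term U), [/\ (0 < n)%N, term_vars t `<=` A & eval id t = a *+ n].

Lemma doag_mulrnI n (x y : U) : (0 < n)%N -> x *+ n = y *+ n -> x = y.
Proof.
move=> n0 /eqP; rewrite -subr_eq0 -mulrnBl => /eqP.
move=> /(sgn_eq0 hU); rewrite sgnMn // => /(sgn_eq0 hU)/eqP.
by rewrite subr_eq0 => /eqP.
Qed.

Lemma dcl_mem A a : A a -> dcl A a.
Proof. by move=> Aa; exists 1%N, (TVar a); split => // _ ->. Qed.

Lemma dcl_sub A B a : A `<=` B -> dcl A a -> dcl B a.
Proof. by move=> AB [n [t [n0 tA E]]]; exists n, t; split => // v /tA/AB. Qed.

Lemma dcl0 A : dcl A 0.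
Proof. by exists 1%N, TZero; split. Qed.

Lemma dclN A a : dcl A a -> dcl A (- a).
Proof. by move=> [n [t [n0 tA E]]]; exists n, (TOpp t); split; rewrite //= E mulNrn. Qed.

Lemma dclD A a b : dcl A a -> dcl A b -> dcl A (a + b).
Proof.
move=> [n [t [n0 tA E]]] [n' [t' [n0' tA' E']]].
exists (n * n')%N, (TAdd (tmulz t n') (tmulz t' n)); split.
- by rewrite muln_gt0 n0.
- by move=> v [] Hv; [apply: tA|apply: tA']; apply: term_vars_tmulz Hv.
- rewrite -[LHS]/(eval id (tmulz t n') + eval id (tmulz t' n)).
  by rewrite !eval_tmulz E E' -!pmulrn -!mulrnA [(n' * n)%N]mulnC mulrnDl.
Qed.

Lemma dclB A a b : dcl A a -> dcl A b -> dcl A (a - b).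
Proof. by move=> Ha Hb; apply: dclD => //; apply: dclN. Qed.

Lemma dclMn A a n : dcl A a -> dcl A (a *+ n).
Proof.
by move=> Ha; elim: n => [|n IH]; [exact: dcl0|rewrite mulrS; apply: dclD].
Qed.

Lemma dcl_divn A a n : (0 < n)%N -> dcl A (a *+ n) -> dcl A a.
Proof.
move=> n0 [m [t [m0 tA E]]]; exists (n * m)%N, t; split => //.
- by rewrite muln_gt0 n0.
- by rewrite E mulrnA.
Qed.

Lemma dcl_divz A a m : m != 0 -> dcl A (a *~ m) -> dcl A a.
Proof.
case: m => [[|n]|n] // _; first exact: (@dcl_divn _ _ n.+1).
by rewrite NegzE mulrNz => /dclN; rewrite opprK; apply: (@dcl_divn _ _ n.+1).
Qed.

Lemma dcl_fixed (s : U -> U) A a :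
  automorphism s -> (forall a, A a -> s a = a) -> dcl A a -> s a = a.
Proof.
move=> Hs sA [n [t [n0 tA E]]]; apply: (doag_mulrnI n0); rewrite -E.
have [_ s0 sD _ _] := Hs.
have sMn m : s a *+ m = s (a *+ m).
  by elim: m => [|m IH]; rewrite ?mulr0n ?s0 // !mulrS IH sD.
rewrite sMn -E -eval_automorphism //; apply: eval_ext => v /tA; exact: sA.
Qed.

Definition lin V (k : V -> int) (e : V -> U) : U := \sum_v e v *~ k v.

Lemma linD V (k k' : V -> int) e : lin (fun v => k v + k' v) e = lin k e + lin k' e.
Proof. by rewrite /lin -big_split; apply: eq_bigr => v _; rewrite mulrzDr. Qed.

Lemma linN V (k : V -> int) e : lin (fun v => - k v) e = - lin k e.
Proof. by rewrite /lin -sumrN; apply: eq_bigr => v _; rewrite mulrNz. Qed.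

Lemma lin0 V e : lin (fun _ : V => 0) e = 0.
Proof. by rewrite /lin big1 // => v _; rewrite mulr0z. Qed.

Lemma lin_delta V (v : V) e : lin (fun w => (v == w)%:Z) e = e v.
Proof.
rewrite /lin (bigD1 v) //= eqxx mulr1z big1 ?addr0 // => w.
by rewrite eq_sym => /negbTE->; rewrite mulr0z.
Qed.

(** Integer coefficients suffice: a rational form has the sign of a positive multiple of itself.
    Only the constant, taken in the divisible hull, needs division. *)
Definition affine V A (f : (V -> U) -> U) : Prop :=
  exists k a, dcl A a /\ forall e, f e = lin k e + a.

Section AffineTheory.
Variables (V : finType) (A : set U).
Implicit Types f g : (V -> U) -> U.

Lemma affine_ext f g : (forall e, f e = g e) -> affine A f -> affine A g.
Proof. by move=> E [k [a [Ha H]]]; exists k, a; split => // e; rewrite -E. Qed.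

Lemma affine_sub B f : A `<=` B -> affine A f -> affine B f.
Proof. by move=> AB [k [a [Ha H]]]; exists k, a; split => //; apply: dcl_sub Ha. Qed.

Lemma affineD f g : affine A f -> affine A g -> affine A (fun e => f e + g e).
Proof.
move=> [k [a [Ha H]]] [k' [a' [Ha' H']]].
exists (fun v => k v + k' v), (a + a'); split; first exact: dclD.
by move=> e; rewrite H H' linD addrACA.
Qed.

Lemma affineN f : affine A f -> affine A (fun e => - f e).
Proof.
move=> [k [a [Ha H]]]; exists (fun v => - k v), (- a); split; first exact: dclN.
by move=> e; rewrite H linN opprD.
Qed.

Lemma affineB f g : affine A f -> affine A g -> affine A (fun e => f e - g e).
Proof. by move=> Hf Hg; apply: affineD => //; apply: affineN. Qed.

Lemma affine_const a : dcl A a -> affine A (fun _ : V -> U => a).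
Proof. by move=> Ha; exists (fun=> 0), a; split => // e; rewrite lin0 add0r. Qed.

Lemma affine_lin k : affine A (@lin V k).
Proof. by exists k, 0; split; [exact: dcl0|move=> e; rewrite addr0]. Qed.

Lemma affine_var v : affine A (fun e : V -> U => e v).
Proof. by apply: affine_ext (affine_lin (fun w => (v == w)%:Z)) => e; exact: lin_delta. Qed.

Lemma affineMn f n : affine A f -> affine A (fun e => f e *+ n).
Proof.
move=> Hf; elim: n => [|n IH].
  by apply: affine_ext (affine_const (dcl0 A)) => e; rewrite mulr0n.
by apply: affine_ext (affineD Hf IH) => e; rewrite mulrS.
Qed.

Lemma affineMz f m : affine A f -> affine A (fun e => f e *~ m).
Proof.
case: m => n Hf; first by apply: affine_ext (affineMn n Hf) => e; rewrite -pmulrn.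
by apply: affine_ext (affineN (affineMn n.+1 Hf)) => e; rewrite NegzE mulrNz.
Qed.

Lemma affine_sum (I : Type) (r : seq I) (F : I -> (V -> U) -> U) :
  (forall i, affine A (F i)) -> affine A (fun e => \sum_(i <- r) F i e).
Proof.
move=> HF; elim: r => [|i r IH].
  by apply: affine_ext (affine_const (dcl0 A)) => e; rewrite big_nil.
by apply: affine_ext (affineD (HF i) IH) => e; rewrite big_cons.
Qed.

Lemma affine_term (t : term (V + U)) : inr @^-1` term_vars t `<=` A ->
  affine A (fun e => eval (penv e) t).
Proof.
elim: t => [[v|u]||t1 IH1 t2 IH2|t IH] /= H.
- exact: affine_var.
- by apply: affine_const; apply: dcl_mem; apply: H.
- by apply: affine_const; apply: dcl0.
- by apply: affineD; [apply: IH1|apply: IH2] => u Hu; apply: H; [left|right].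
- by apply: affineN; apply: IH.
Qed.

Lemma affine_sgn_formula f (c : int) : affine A f ->
  exists phi : formula (V + U), over A phi /\ forall e, psat e phi <-> sgn (f e) = c.
Proof.
move=> [k [a [[n [t [n0 tA E]]] Hf]]].
(* The constant a is only in [dcl A]; n a is the value of a term over A. Multiplying everything by n
   > 0 keeps the sign and makes the function a genuine term. *)
pose t' : term (V + U) := foldr (fun v s => TAdd (tmulz (TVar (inl v)) (k v *+ n)) s)
  (term_rename inr t) (index_enum V).
have Et' e : eval (penv e) t' = f e *+ n.
  rewrite Hf mulrnDl -E /lin /t'; elim: (index_enum V) => [|v s IH] /=.
    by rewrite big_nil mul0rn add0r eval_rename; apply: eval_ext.
  by rewrite big_cons IH eval_tmulz /= mulrnDl addrA -[k v *+ n]mulr_natr natz mulrzA -pmulrn -mulrnDl.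
have Vt' : inr @^-1` term_vars t' `<=` A.
  rewrite /t'; elim: (index_enum V) => [|v s IH] u /=.
    by rewrite term_vars_rename => -[w /tA + [<-]].
  by case=> [Hu|/IH //]; have := term_vars_tmulz Hu.
have Hs e : sgn (f e) = sgn (eval (penv e) t') by rewrite Et' sgnMn.
have false_case : c <> 1 -> c <> 0 -> c <> -1 ->
    exists phi : formula (V + U), over A phi /\ forall e, psat e phi <-> sgn (f e) = c.
  move=> c1 c2 c3; exists (FLt TZero TZero); split; first by move=> u [].
  move=> e; rewrite /psat /= ltxx; split => // E'; move: c1 c2 c3; rewrite -E'.
  by case: (sgnP hU) => _ h1 h2 h3; [case: h1|case: h3|case: h2].
have [->|c1] := eqVneq c 1.
  exists (FLt TZero t'); split; first by move=> u [|/Vt'].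
  by move=> e; rewrite Hs (sgn_eq1 hU).
have [->|c2] := eqVneq c 0.
  exists (FEq t' TZero); split; first by move=> u [/Vt'|].
  by move=> e; rewrite Hs (sgn_eq0 hU).
have [->|c3] := eqVneq c (-1).
  exists (FLt t' TZero); split; first by move=> u [/Vt'|].
  by move=> e; rewrite Hs (sgn_eqN1 hU).
by apply: false_case; apply/eqP.
Qed.

Lemma affine_decided (p : set (formula (V + U))) f :
  complete_type A p -> affine A f -> exists c, forced p (fun e => sgn (f e) = c).
Proof.
move=> hp Hf.
have [phi1 [o1 H1]] := affine_sgn_formula 1 Hf.
have [phi0 [o0 H0]] := affine_sgn_formula 0 Hf.
case: (forced_decide hp o1 H1) => [|N1]; first by exists 1.
case: (forced_decide hp o0 H0) => [|N0]; first by exists 0.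
exists (-1); apply: forced2 N1 N0 _ => e.
by case: (sgnP hU).
Qed.

(* By quantifier elimination, [S] forces of the [V]-tuple [g e] what [p] forces
   of its own variables as soon as both give the same signs to affine functions. *)
Lemma forced_transfer W (p : set (formula (V + U))) (S : set (formula (W + U)))
    (g : (W -> U) -> V -> U) phi :
  over A phi -> consistent p -> p phi ->
  (forall f, affine A f -> exists c, forced p (fun e => sgn (f e) = c) /\
     forced S (fun e => sgn (f (g e)) = c)) ->
  forced S (fun e => psat (g e) phi).
Proof.
move=> oA pc pphi H.
have Ht t : lmem (terms phi) t -> affine A (fun e : V -> U => eval (penv e) t).
  by move=> Ht; apply: affine_term => u Hu; apply: oA; apply: terms_vars Hu.
have Hc t : exists c, lmem (terms phi) t ->
    forced p (fun e => sgn (eval (penv e) t) = c) /\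
    forced S (fun e => sgn (eval (penv (g e)) t) = c).
  have [/Ht/H[c Hc]|] := pselect (lmem (terms phi) t); first by exists c.
  by exists 0.
have [c {}Hc] := choice Hc.
have H1 := forced_lmem (fun t Ht => (Hc t Ht).1).
have H2 := forced_lmem (fun t Ht => (Hc t Ht).2).
have [e0 [He0 Hphi]] := forced_ex pc (forcedI H1 (forced_in pphi)).
apply: forcedW H2 _ => e He; rewrite psatE (sat_agree (e2 := penv e0) hU hU) //.
by move=> t Htt; rewrite He // He0.
Qed.

Lemma realizes_sgn (p : set (formula (V + U))) x f c :
  complete_type setT p -> realizes p A x -> affine A f ->
  forced p (fun e => sgn (f e) = c) -> sgn (f x) = c.
Proof.
move=> hp Hx Hf Hc; have [phi [oA H]] := affine_sgn_formula c Hf.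
apply/H; apply: Hx => //; apply/(complete_forced hp) => //.
by apply: forcedW Hc _ => e /H.
Qed.

Lemma type_at_sgn (x : V -> U) f : affine A f ->
  forced (type_at A x) (fun e => sgn (f e) = sgn (f x)).
Proof.
move=> Hf; have [phi [oA H]] := affine_sgn_formula (sgn (f x)) Hf.
have : type_at A x phi by split => //; apply/H.
by move/forced_in => H'; apply: forcedW H' _ => e /H.
Qed.

End AffineTheory.

Lemma forced_complete_ext V (p : set (formula (V + U))) f :
  complete_type setT p -> affine setT f ->
  [\/ forced p (fun e => 0 < f e), forced p (fun e => f e = 0) |
      forced p (fun e => f e < 0)].
Proof.
move=> hp Hf; have [c Hc] := affine_decided hp Hf.
have [e E] : exists e, sgn (f e) = c by apply: forced_ex Hc; case: hp.
move: Hc; rewrite -E; case: (sgnP hU) => _ Hc.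
- by apply: Or31; apply: forcedW Hc _ => e' /(sgn_eq1 hU).
- by apply: Or33; apply: forcedW Hc _ => e' /(sgn_eqN1 hU).
- by apply: Or32; apply: forcedW Hc _ => e' /(sgn_eq0 hU).
Qed.

End Affine.

Definition shift (V : Type) (U : Type) (s : U -> U) : V + U -> V + U :=
  sum_map id s.

(** Invariance in the form in which it is used; [invariant_overP] gives the equivalence with the
    official one for small A. *)
Definition aut_invariant (U : porderZmodType) (V : Type) (A : set U)
    (p : set (formula (V + U))) : Prop :=
  forall s, automorphism s -> (forall a, A a -> s a = a) ->
  forall phi, p phi -> p (rename (shift s) phi).

Definition params (U V : Type) (phi : formula (V + U)) : set U :=
  inr @^-1` free_vars phi.

Lemma finite_params (U V : Type) (phi : formula (V + U)) :
  finite_set (params phi).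
Proof.
apply: finite_preimage; last exact: finite_free_vars.
by move=> x y _ _ [].
Qed.

(* The default [w0] also covers formulas without parameters in [W]. *)
Lemma abstract_params (V W : Type) (w0 : W) (phi : formula (V + W)) :
  exists k (psi : formula (V + 'I_k)) (c : 'I_k -> W),
    phi = rename (sum_map id c) psi /\ forall i, c i = w0 \/ params phi (c i).
Proof.
have [s Es] := (@finite_seqP {classic W} _).1 (finite_params phi).
pose f (v : V + W) : V + 'I_(size s).+1 :=
  match v with inl x => inl x | inr w => inr (inord (index (w : {classic W}) s)) end.
exists (size s).+1, (rename f phi), (fun i => nth (w0 : {classic W}) s i); split.
  rewrite rename_comp -[LHS]rename_id; apply: rename_ext => -[v|w] //= Hw.
  have ws : (w : {classic W}) \in s.
    have : params phi w by [].
    by rewrite Es.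
  by rewrite inordK ?nth_index // ltnS ltnW // index_mem.
move=> i; have [si|si] := ltnP i (size s); last by left; rewrite nth_default.
by right; rewrite Es; apply: mem_nth.
Qed.

(** * Conjugation, saturation and invariance in the monster model *)

Section Monster.
Variables (K : Type) (U : porderZmodType) (hM : monster_DOAG U K).

Let hK : uncountable_strong_limit K. Proof. by case: hM. Qed.
Let hU : DOAG U. Proof. by case: hM. Qed.

(** By quantifier elimination, equal signs of the affine functions over A make the map that fixes A
    and sends x to y elementary; strong homogeneity extends it to an automorphism. *)
Lemma monster_conjugate (V : finType) (A : set U) (x y : V -> U) :
  small K A -> (forall f, affine A f -> sgn (f x) = sgn (f y)) ->
  exists s, [/\ automorphism s, forall a, A a -> s a = a & forall v, s (x v) = y v].
Proof.
move=> sA Hxy.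
have eq0 f : affine A f -> f x = 0 -> f y = 0.
  by move=> /Hxy E fx0; apply/(sgn_eq0 hU); rewrite -E fx0 sgn_0.
have eq2 f g : affine A f -> affine A g -> f x = g x -> f y = g y.
  move=> Hf Hg /eqP; rewrite -subr_eq0 => /eqP/(eq0 _ (affineB Hf Hg))/eqP.
  by rewrite subr_eq0 => /eqP.
(* The map must be well defined where x meets A or repeats a value; each such coincidence is the
   vanishing of an affine function, so it also holds for y. *)
have [|f Hf] := @choice U U (fun u w => (A u -> w = u) /\ forall v, x v = u -> w = y v).
  move=> u; have [Au|nAu] := pselect (A u).
    exists u; split => // v xv; apply/esym.
    exact: eq2 (affine_var _ v) (affine_const V (dcl_mem Au)) xv.
  have [[v xv]|nxu] := pselect (exists v, x v = u).
    exists (y v); split => // v' xv'.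
    by apply: eq2 (affine_var _ v) (affine_var _ v') _; rewrite xv xv'.
  by exists u; split => // v xv; case: nxu; exists v.
have fA u : A u -> f u = u by move=> Au; apply: (Hf u).1.
have fx v : f (x v) = y v by apply: (Hf _).2.
have [_ _ _ hom] := hM.
have [|k phi a Ha|s Hs HsA] := hom (A `|` range x) f.
- apply: (small_setU hK) => //; apply: (small_finite hK).
  exact/finite_image/finite_finset.
- apply: sat_agree => // t _.
  suff [g [gA -> ->]] : exists g, [/\ affine A g, eval a t = g x & eval (f \o a) t = g y].
    exact: Hxy.
  elim: t => [i||t1 [g1 [H1 E1 E1']] t2 [g2 [H2 E2 E2']]|t [g [H E E']]] /=.
  + case: (Ha i) => [Aai|[v _ <-]].
      by exists (fun=> a i); split; [apply: affine_const; apply: dcl_mem| |rewrite fA].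
    by exists (fun e => e v); split; [exact: affine_var| |rewrite fx].
  + by exists (fun=> 0); split => //; apply: affine_const; apply: dcl0.
  + by exists (fun e => g1 e + g2 e); split; [exact: affineD|rewrite E1 E2|rewrite E1' E2'].
  + by exists (fun e => - g e); split; [exact: affineN|rewrite E|rewrite E'].
exists s; split => // [a Aa|v]; first by rewrite HsA ?fA //; left.
by rewrite HsA ?fx //; right; exists v.
Qed.

Lemma monster_conjugate1 (A : set U) (x y : U) :
  small K A -> (forall a, dcl A a -> sgn (x - a) = sgn (y - a)) ->
  exists s, [/\ automorphism s, forall a, A a -> s a = a & s x = y].
Proof.
move=> sA H.
have [f [k [a [Ha Hf]]]|s [H1 H2 H3]] := @monster_conjugate unit A (fun=> x) (fun=> y) sA.
  rewrite !Hf /lin !(big_pred1 tt) //; try by case.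
  have [->|k0] := eqVneq (k tt) 0; first by rewrite !mulr0z.
  (* In one variable every nonconstant form is an integer multiple of x - b, with its root b again
     in the divisible hull of A. *)
  have [b Eb] := doag_divz hU (- a) k0.
  have E z : z *~ k tt + a = (z - b) *~ k tt by rewrite mulrzBl Eb opprK.
  rewrite !E !sgnMz // H //; apply: dcl_divz k0 _; rewrite Eb.
  exact: dclN.
by exists s; split => //; apply: (H3 tt).
Qed.

Lemma realizes_conjugate (V : finType) (A : set U) (p : set (formula (V + U))) x y :
  small K A -> complete_type setT p -> realizes p A x -> realizes p A y ->
  exists s, [/\ automorphism s, forall a, A a -> s a = a & forall v, s (x v) = y v].
Proof.
move=> sA hp Hx Hy; apply: monster_conjugate => // f Hf.
have [c Hc] := affine_decided hU hp (affine_sub (@subsetT _ _) Hf).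
by rewrite (realizes_sgn hU hp Hx Hf Hc) (realizes_sgn hU hp Hy Hf Hc).
Qed.

(** Saturation is given for variables in an ['I_n]; transport along [enum_rank] gives it for any
    finite type of variables, such as a sum. *)
Lemma monster_saturated (V : finType) (A : set U) (r : set (formula (V + U))) :
  small K A -> complete_type A r -> exists x : V -> U, forall phi, r phi -> psat x phi.
Proof.
move=> sA [rA rc rd]; have [_ _ sat _] := hM.
have [|x Hx] := sat A #|V| (rename (sum_map enum_rank id) @` r) sA.
  split.
  - move=> _ [phi /rA phiA <-] u /=; rewrite free_vars_rename => -[[v|w] //= Hw [<-]].
    exact: phiA.
  - move=> s fs sr; pose s' := r `&` (rename (sum_map (@enum_val V V) id) @` s).
    have [|phi []//|e He] := rc s'.
      apply: sub_finite_set (finite_image (rename (sum_map (@enum_val V V) id)) fs).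
      exact: subIsetr.
    exists (e \o @enum_val V V) => phi Hphi; have [psi Hpsi E] := sr _ Hphi.
    have : s' psi.
      split => //; exists phi => //; rewrite -E rename_comp -[RHS]rename_id.
      by apply: rename_ext => -[v|u] //= _; rewrite enum_rankK.
    move/He; rewrite -E psatE => Hs; apply/psat_rename; last exact: Hs.
    by move=> [v|u] //= _; rewrite enum_rankK.
  - move=> phi oA; pose psi := rename (sum_map (@enum_val V V) id) phi.
    have Epsi : rename (sum_map enum_rank id) psi = phi.
      rewrite rename_comp -[RHS]rename_id.
      by apply: rename_ext => -[v|u] //= _; rewrite enum_valK.
    have [|H|H] := rd psi.
    + by move=> u /=; rewrite free_vars_rename => -[[v|w] //= Hw [<-]]; apply: oA.
    + by left; exists psi.
    + by right; exists (FNot psi) => //=; rewrite Epsi.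
exists (x \o enum_rank) => phi Hphi; have := Hx _ (imageP _ Hphi).
by apply psat_rename => -[v|u].
Qed.

Lemma monster_realizes (V : finType) (A : set U) (p : set (formula (V + U))) :
  small K A -> complete_type setT p -> exists x, realizes p A x.
Proof.
move=> sA [_ pc pd].
have [||x Hx] := @monster_saturated V A (p `&` over A) => //.
  split; first by move=> phi [].
  - by move=> s fs sp; apply: pc => // phi /sp[].
  - by move=> phi oA; case: (pd phi (@overT _ _ _)) => H; [left|right]; split.
by exists x => phi p_phi oA; apply: Hx.
Qed.

Lemma automorphism_inv (s : U -> U) : automorphism s ->
  exists2 s', automorphism s' & cancel s s' /\ cancel s' s.
Proof.
case=> -[s' sK s'K] s0 sD sN slt; exists s'; last by split.
split; first by exists s.
- by rewrite -s0 sK.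
- by move=> x y; rewrite -{1}[x]s'K -{1}[y]s'K -sD sK.
- by move=> x; rewrite -{1}[x]s'K -sN sK.
- by move=> x y; rewrite -slt !s'K.
Qed.

Lemma lin_automorphism (V : finType) (s : U -> U) (k : V -> int) e :
  automorphism s -> s (lin k e) = lin k (s \o e).
Proof.
case=> _ s0 sD sN _; rewrite /lin (big_morph s sD s0); apply: eq_bigr => v _ /=.
have sM n x : s (x *+ n) = s x *+ n.
  by elim: n => [|n IH]; rewrite ?mulr0n ?s0 // !mulrS sD IH.
by case: (k v) => n; rewrite ?NegzE ?mulrNz ?sN -!pmulrn sM.
Qed.

Lemma sgn_automorphism (s : U -> U) x : automorphism s -> sgn (s x) = sgn x.
Proof. by case=> _ s0 _ _ slt; rewrite /sgn -{1 2}s0 !slt. Qed.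

Section AutInvariant.
Variables (V : finType) (A : set U) (p : set (formula (V + U))).

Lemma aut_invariant_forced s (Q : (V -> U) -> Prop) : aut_invariant A p ->
  automorphism s -> (forall a, A a -> s a = a) -> forced p Q ->
  forced p (fun e => exists2 e', Q e' & e = s \o e').
Proof.
move=> Hp Hs sA [S [fS Sp HS]]; exists (rename (shift s) @` S); split.
- exact: finite_image.
- by move=> _ [phi /Sp Hphi <-]; apply: Hp.
move=> e He; have [s' Hs' [sK s'K]] := automorphism_inv Hs.
exists (s' \o e); last by apply: funext => v /=; rewrite s'K.
apply: HS => psi /(imageP (rename (shift s)))/He.
rewrite !psatE sat_rename -(sat_automorphism (penv (s' \o e)) psi Hs).
by apply sat_ext => -[v|u] _; rewrite /= ?s'K.
Qed.

Lemma aut_invariant_sgn s k a c : aut_invariant A p ->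
  automorphism s -> (forall a, A a -> s a = a) ->
  forced p (fun e => sgn (lin k e + a) = c) ->
  forced p (fun e => sgn (lin k e + s a) = c).
Proof.
move=> Hp Hs sA H; apply: forcedW (aut_invariant_forced Hp Hs sA H) _.
move=> _ [e <- ->]; rewrite -lin_automorphism //.
by case: (Hs) => _ _ <- _ _; rewrite sgn_automorphism.
Qed.

End AutInvariant.

Lemma complete_FIff (V : Type) (p : set (formula (V + U))) phi psi :
  complete_type setT p -> (p phi <-> p psi) -> entails p (FIff phi psi).
Proof.
move=> hp H; have [p1|/(complete_not hp (@overT _ _ _)) p1] := pselect (p phi).
- have p2 : p psi by apply/H.
  by apply: forced2 (forced_in p1) (forced_in p2) _ => e H1 H2; apply/sat_FIff; split.
- have p2 : p (FNot psi) by apply/(complete_not hp (@overT _ _ _)) => /H; apply/(complete_not hp (@overT _ _ _)).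
  by apply: forced2 (forced_in p1) (forced_in p2) _ => e H1 H2; apply/sat_FIff; split.
Qed.

Lemma complete_FIffE (V : Type) (p : set (formula (V + U))) phi psi :
  complete_type setT p -> entails p (FIff phi psi) -> (p phi <-> p psi).
Proof.
move=> hp H; split=> Hp; apply/(complete_forced hp (@overT _ _ _));
  by apply: forced2 H (forced_in Hp) _ => e /sat_FIff E; rewrite !psatE => /E.
Qed.

(** Automorphisms fixing A preserve types over A; conversely, by homogeneity, tuples of the same
    type over a small A are moved to each other by such automorphisms. *)
Lemma invariant_overP n (A : set U) (p : set (formula ('I_n + U))) :
  small K A -> complete_type setT p -> invariant_over A p <-> aut_invariant A p.
Proof.
move=> sA hp; split=> Hp.
  move=> s Hs sfix phi; have [k [psi [c [-> _]]]] := abstract_params 0 phi.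
  rewrite rename_comp.
  have -> : rename (shift s \o sum_map id c) psi = inst (s \o c) psi.
    by apply: rename_ext => -[].
  apply complete_FIffE => //; apply: Hp => chi oA.
  rewrite !psatE -(sat_automorphism (penv c) chi Hs); apply: sat_ext => -[i|u] //= Hu.
  by rewrite sfix //; apply: oA.
suff H k (phi : formula ('I_n + 'I_k)) a b : equiv_over A a b -> p (inst a phi) -> p (inst b phi).
  move=> k phi a b ab; apply: complete_FIff => //; split; apply: H => //.
  by move=> chi /ab ->.
move=> ab; have [f Hf|s [Hs sfix sab]] := @monster_conjugate 'I_k A a b sA.
  by have [chi [oA Hchi]] := affine_sgn_formula hU (sgn (f a)) Hf; apply/esym/Hchi/ab/Hchi.
move=> /(Hp _ Hs sfix); rewrite rename_comp.
rewrite (@rename_ext _ _ _ (sum_map id b)) // => -[v|i] //= _.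
by rewrite sab.
Qed.

Definition join (V W : Type) (x : V -> U) (y : W -> U) (v : V + W) : U :=
  match v with inl i => x i | inr j => y j end.

Definition subst (V W : Type) (b : W -> U) (phi : formula ((V + W) + U)) :
    formula (V + U) :=
  rename (fun v => match v with
                   | inl (inl i) => inl i
                   | inl (inr j) => inr (b j)
                   | inr u => inr u
                   end) phi.

Lemma psat_subst (V W : Type) (x : V -> U) (b : W -> U) phi :
  psat x (subst b phi) <-> psat (join x b) phi.
Proof. by apply: psat_rename => -[[v|w]|u]. Qed.

(** * The tensor product of invariant types *)

Section Tensor.
Variables (n m : nat) (A : set U).
Variables (p : set (formula ('I_n + U))) (q : set (formula ('I_m + U))).
Hypotheses (sA : small K A) (hp : complete_type setT p) (hq : complete_type setT q).

Let small_params V (phi : formula (V + U)) : small K (A `|` params phi).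
Proof. by apply: (small_setU hK) => //; apply: (small_finite hK); apply: finite_params. Qed.

(* [p | Ub] is computed with [b] replaced by a tuple of U of the same type over
   [A] and the parameters of the formula. *)
Definition tens : set (formula (('I_n + 'I_m) + U)) :=
  [set phi | exists b, realizes q (A `|` params phi) b /\ p (subst b phi)].

Lemma subst_indep (phi : formula (('I_n + 'I_m) + U)) b b' :
  aut_invariant A p ->
  realizes q (A `|` params phi) b -> realizes q (A `|` params phi) b' ->
  p (subst b phi) -> p (subst b' phi).
Proof.
move=> ip Hb Hb' H; have [s [Hs sfix sb]] := realizes_conjugate (small_params phi) hq Hb Hb'.
have := ip s Hs (fun a Aa => sfix a (or_introl Aa)) _ H.
rewrite rename_comp (@rename_ext _ _ _ (fun v => match v with
   | inl (inl i) => inl i | inl (inr j) => inr (b' j) | inr u => inr u end)) //.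
by move=> [[i|j]|u] //= Hu; rewrite ?sb // sfix //; right.
Qed.

(** Invariance of p makes the choice of b immaterial, so one b over a larger set can serve several
    formulas at once. *)
Lemma tensP (ip : aut_invariant A p) (phi : formula (('I_n + 'I_m) + U)) (B : set U) b :
  A `<=` B -> params phi `<=` B -> realizes q B b -> tens phi <-> p (subst b phi).
Proof.
move=> AB phiB /(@realizes_sub _ _ _ (A `|` params phi)) Hb.
have {}Hb : realizes q (A `|` params phi) b by apply: Hb => u [/AB|/phiB].
by split=> [[b' [Hb' H]]|H]; [apply: subst_indep H|exists b].
Qed.

Lemma tens_complete : aut_invariant A p -> complete_type setT tens.
Proof.
move=> ip; split=> //.
- move=> s fs st.
  have fB : finite_set (\bigcup_(phi in s) params phi).
    by apply: bigcup_finite => // phi _; apply: finite_params.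
  have sB : small K (A `|` \bigcup_(phi in s) params phi).
    by apply: (small_setU hK) => //; apply: (small_finite hK).
  have [b Hb] := monster_realizes sB hq.
  have [_ pc _] := hp.
  have [|_ [phi Hphi <-]|e He] := pc (subst b @` s); first exact: finite_image.
    apply/(tensP ip _ _ Hb); [by left|by move=> u Hu; right; exists phi|exact: st].
  by exists (join e b) => phi Hphi; apply/psat_subst/He; exists phi.
- move=> phi _; have [b Hb] := monster_realizes (small_params phi) hq.
  have [_ _ /(_ (subst b phi) (@overT _ _ _))[H|H]] := hp; [left|right]; exists b; split=> //.
Qed.

Lemma tens_extension : aut_invariant A p -> invariant_extension A p q tens.
Proof.
move=> ip; split; first exact: tens_complete.
- move=> _ [phi Hphi <-].
  have [b Hb] := monster_realizes (small_params (rename (sum_map (@inl 'I_n 'I_m) id) phi)) hq.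
  exists b; split=> //; rewrite /subst rename_comp.
  by rewrite (@rename_ext _ _ _ id) ?rename_id // => -[].
- move=> _ [phi Hphi <-].
  set phi' := rename _ phi; have [b Hb] := monster_realizes (small_params phi') hq.
  exists b; split=> //; apply/(complete_forced hp (@overT _ _ _)).
  apply: forcedT => e; apply/psat_subst/(@psat_rename _ _ _ _ _ b); first by case.
  apply: Hb => // u Hu; right; rewrite /params /= free_vars_rename.
  by exists (inr u).
- move=> k phi c d Hcd; apply: complete_FIff; first exact: tens_complete.
  (* Besides A and the parameters of both formulas, B contains the values of c and d in U, so that b
     turns c and d into tuples of U with the same type over A. *)
  pose B := A `|` (params (ext_inst c phi) `|` params (ext_inst d phi)
             `|` [set u | exists i, c i = inr u \/ d i = inr u]).
  have sB : small K B.
    apply: (small_setU hK) => //; apply: (small_finite hK); rewrite !finite_setU.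
    split; first by split; apply: finite_params.
    apply: sub_finite_set (_ : finite_set (\bigcup_(i in [set: 'I_k])
       ([set u | c i = inr u] `|` [set u | d i = inr u]))).
      by move=> u [i [H|H]]; exists i => //; [left|right].
    apply: bigcup_finite => [|i _]; first exact: finite_finset.
    rewrite finite_setU; split.
      case: (c i) => [j|u]; first by apply: sub_finite_set (finite_set0 _).
      by apply: sub_finite_set (finite_set1 u) => v /= -[].
    case: (d i) => [j|u]; first by apply: sub_finite_set (finite_set0 _).
    by apply: sub_finite_set (finite_set1 u) => v /= -[].
  have [b Hb] := monster_realizes sB hq.
  rewrite (tensP ip (B := B) (b := b)) => // [||u Hu]; try by move=> u Hu; left.
    rewrite (tensP ip (B := B) (b := b)) => // [||u Hu]; try by move=> u Hu; left.
      have Ec c' : subst b (ext_inst c' phi) = inst (penv b \o c') phi.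
        rewrite /subst /ext_inst rename_comp; apply: rename_ext => -[i|j] //= _.
        by case: (c' j).
      rewrite !Ec; apply: complete_FIffE => //; apply: ((invariant_overP sA hp).2 ip) => chi oA.
      have E c' : (forall i u, c' i = inr u -> B u) ->
          q (rename (fun v => match v with inl i => c' i | inr u => inr u end) chi) <->
          psat (penv b \o c') chi.
        move=> c'B; rewrite (realizes_iff hq Hb).
          by apply: psat_rename => -[i|u] //.
        move=> u /=; rewrite free_vars_rename => -[[i|v] /= Hv]; first exact: c'B.
        by case=> <-; left; apply: oA.
      rewrite -!E; first exact: Hcd.
      + by move=> i u H; right; right; exists i; right.
      + by move=> i u H; right; right; exists i; left.
    by right; left; right.
  by right; left; left.
Qed.

(** Name the elements of Ub occurring in phi by a tuple c, and replace each b_j in it by the value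
    of b in U to get d. As b realises q over B, c and d have the same type over A, so invariance of
    r turns phi into a formula in x alone, where r agrees with p. *)
Lemma extension_unique r phi (B : set U) b : invariant_extension A p q r ->
  A `<=` B -> params phi `<=` B -> B 0 -> realizes q B b ->
  r phi <-> p (subst b phi).
Proof.
move=> [rc rp rq ri] AB phiB B0 Hb.
pose assoc (v : ('I_n + 'I_m) + U) : 'I_n + ('I_m + U) :=
  match v with inl (inl i) => inl i | inl (inr j) => inr (inl j) | inr u => inr (inr u) end.
(* The default value 0 may occur among the c i, which is the reason for the hypothesis [B 0]. *)
have [k [psi [c [E Hc]]]] := abstract_params (inr 0) (rename assoc phi).
pose d i : 'I_m + U := inr (penv b (c i)).
have E1 : ext_inst c psi = phi.
  rewrite -[RHS]rename_id.
  have -> : rename id phi = rename (fun v => match v with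
      inl i => inl (inl i) | inr w => sum_map inr id w end) (rename assoc phi).
    by rewrite rename_comp; apply: rename_ext => -[[i|j]|u].
  by rewrite E rename_comp; apply: rename_ext => -[i|j].
have E2 : ext_inst d psi = rename (sum_map inl id) (subst b phi).
  have -> : subst b phi = rename (fun v => match v with
      inl i => inl i | inr w => inr (penv b w) end) (rename assoc phi).
    by rewrite rename_comp; apply: rename_ext => -[[i|j]|u].
  by rewrite E !rename_comp; apply: rename_ext => -[i|j].
have cB i u : c i = inr u -> B u.
  case: (Hc i) => [->[<-] //|+ E']; rewrite E' /params /= free_vars_rename.
  by case=> -[[j|j]|v] Hv //= -[<-]; apply: phiB.
have Hcd : ext_equiv_over A q c d.
  move=> chi oA; rewrite (realizes_iff hq Hb).
    split=> H.
      apply/(complete_forced hq (@overT _ _ _)); apply: forcedT => e.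
      move: H; rewrite !psatE !sat_rename; apply sat_ext => -[i|u] //=.
    apply: contrapT => nH; apply: (forced_absurd hq).
    apply: forcedW (forced_in H) _ => e He; apply: nH; move: He.
    by rewrite !psatE !sat_rename; apply sat_ext => -[i|u].
  move=> u /=; rewrite free_vars_rename => -[[i|v] Hv /=]; first exact: cB.
  by case=> <-; apply/AB/oA.
have /(complete_FIffE rc) := ri _ psi _ _ Hcd; rewrite E1 E2 => ->.
split=> [H|H]; last by apply: rp; exists (subst b phi).
apply: contrapT => /(complete_not hp (@overT _ _ _)) H'.
have : r (FNot (rename (sum_map inl id) (subst b phi))).
  by apply: rp; exists (FNot (subst b phi)).
by move/(complete_not rc (@overT _ _ _)).
Qed.

End Tensor.
End Monster.

Lemma complete_type_rename (U : porderZmodType) (V W : Type) (f : V -> W)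
    (A : set U) (t : set (formula (W + U))) :
  complete_type A t ->
  complete_type A [set phi | t (rename (sum_map f id) phi)].
Proof.
move=> [tA tc td]; have E phi : over A (rename (sum_map f id) phi) <-> over A phi.
  split=> oA u Hu; first by apply: oA; rewrite /= free_vars_rename; exists (inr u).
  move: Hu; rewrite /= free_vars_rename => -[[v|w] //= Hw [<-]]; exact: oA.
split => [phi /tA/E//|s fs st|phi /E oA].
- have [|_ [phi /st Hphi <-]//|e He] := tc (rename (sum_map f id) @` s).
    exact: finite_image.
  exists (e \o f) => phi Hphi; have := He _ (imageP _ Hphi).
  by apply psat_rename => -[v|u].
- exact: (td _ oA).
Qed.

Section MonsterTensor.
Variables (K : Type) (U : porderZmodType) (hM : monster_DOAG U K).

Let hK : uncountable_strong_limit K. Proof. by case: hM. Qed.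
Let hU : DOAG U. Proof. by case: hM. Qed.

Lemma Sinv_complete (p : global_set U) : Sinv K p -> complete_type setT p.
Proof. by case. Qed.

Lemma Sinv_aut (p : global_set U) : Sinv K p ->
  exists2 A, small K A & aut_invariant A p.
Proof. by case=> hp [A sA /(invariant_overP hM sA hp)]; exists A. Qed.

Lemma SinvI (p : global_set U) A : complete_type setT p -> small K A ->
  aut_invariant A p -> Sinv K p.
Proof. by move=> hp sA /(invariant_overP hM sA hp) H; split => //; exists A. Qed.

Lemma aut_invariant_sub (V : Type) (A B : set U) (p : set (formula (V + U))) :
  A `<=` B -> aut_invariant A p -> aut_invariant B p.
Proof. by move=> AB H s Hs sB; apply: H => // a /AB/sB. Qed.

Section Tensor2.
Variables (p q : global_set U) (A : set U).
Hypotheses (sA : small K A) (ip : aut_invariant A p) (hp : complete_type setT p)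
  (hq : complete_type setT q).

Let split_vars : formula ('I_(arity p + arity q) + U) ->
  formula (('I_(arity p) + 'I_(arity q)) + U) :=
  rename (sum_map (@fintype.split (arity p) (arity q)) id).

Lemma tensorE phi : @formulas U (tensor K p q) phi <-> tens A p q (split_vars phi).
Proof.
split=> [[A0 [r [sA0 iA0 re rphi]]]|H].
- pose B := A `|` A0 `|` (params (split_vars phi) `|` [set 0]).
  have sB : small K B.
    apply: (small_setU hK); first exact: (small_setU hK).
    apply: (small_finite hK); rewrite finite_setU; split; first exact: finite_params.
    exact: finite_set1.
  have [b Hb] := monster_realizes hM sB hq.
  have AB : A `<=` B by move=> u Au; left; left.
  have A0B : A0 `<=` B by move=> u Au; left; right.
  have PB : params (split_vars phi) `<=` B by move=> u Hu; right; left.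
  apply/(tensP hM sA hq ip AB PB Hb).
  by apply/(extension_unique hp hq re A0B PB _ Hb) => //; right; right.
- exists A, (tens A p q); split => //; last exact: (tens_extension hM sA hp hq ip).
  exact: ((invariant_overP hM sA hp).2 ip).
Qed.

Lemma tensor_complete : complete_type setT (tensor K p q).
Proof.
have -> : @formulas U (tensor K p q) = [set phi | tens A p q (split_vars phi)].
  by apply/seteqP; split=> phi /tensorE.
exact: (complete_type_rename _ (tens_complete hM sA hp hq ip)).
Qed.

Lemma tensor_sub_x :
  rename (sum_map (@lshift (arity p) (arity q)) id) @` p `<=` tensor K p q.
Proof.
move=> _ [phi Hphi <-]; apply/tensorE; rewrite /split_vars rename_comp.
have [_ H _ _] := tens_extension hM sA hp hq ip.
apply: H; exists phi => //; apply: rename_ext => -[i|u] //= _.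
by congr inl; rewrite -[lshift _ _]/(unsplit (inl i)) unsplitK.
Qed.

Lemma tensor_sub_y :
  rename (sum_map (@rshift (arity p) (arity q)) id) @` q `<=` tensor K p q.
Proof.
move=> _ [phi Hphi <-]; apply/tensorE; rewrite /split_vars rename_comp.
have [_ _ H _] := tens_extension hM sA hp hq ip.
apply: H; exists phi => //; apply: rename_ext => -[i|u] //= _.
by congr inl; rewrite -[rshift _ _]/(unsplit (inr i)) unsplitK.
Qed.

(** All computations in the product go through this: y is replaced by a tuple b of U, after which
    only p is involved. *)
Lemma tensor_sgn (B : set U) (f : ('I_(arity p) + 'I_(arity q) -> U) -> U) b c :
  A `<=` B -> affine B f -> realizes q B b ->
  forced (tensor K p q) (fun e => sgn (f (e \o @unsplit _ _)) = c) <->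
  forced p (fun x => sgn (f (join x b)) = c).
Proof.
move=> AB Hf Hb; have [phi [oB Hphi]] := affine_sgn_formula hU c Hf.
have Hx : @formulas U p (subst b phi) <-> forced p (fun x => sgn (f (join x b)) = c).
  rewrite (complete_forced hp (@overT _ _ _)); split=> H; apply: forcedW H _ => x.
    by move=> /psat_subst/Hphi.
  by move=> /Hphi/psat_subst.
rewrite -Hx -(tensP hM sA hq ip AB oB Hb).
have -> : tens A p q phi <-> @formulas U (tensor K p q) (rename (sum_map (@unsplit _ _) id) phi).
  rewrite tensorE /split_vars rename_comp (@rename_ext _ _ _ id) ?rename_id //.
  by move=> [i|u] //= _; rewrite unsplitK.
rewrite (complete_forced tensor_complete (@overT _ _ _)).
have E e : psat e (rename (sum_map (@unsplit _ _) id) phi) <->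
    sgn (f (e \o @unsplit (arity p) (arity q))) = c.
  by rewrite -Hphi; apply: psat_rename => -[].
by split=> H; apply: forcedW H _ => e /E.
Qed.

Lemma tensor_Sinv : Sinv K q -> Sinv K (tensor K p q).
Proof.
move=> /Sinv_aut[B sB iq].
apply: (@SinvI _ (A `|` B)); [exact: tensor_complete|exact: (small_setU hK)|].
move=> s Hs sAB phi /tensorE[b [Hb pb]]; apply/tensorE.
have Es : split_vars (rename (shift s) phi) = rename (shift s) (split_vars phi).
  by rewrite /split_vars !rename_comp; apply: rename_ext => -[].
have [s' Hs' [sK s'K]] := automorphism_inv Hs.
(* By invariance of q the image of b realises q over the moved parameters; by invariance of p the
   formula in x follows. *)
exists (s \o b); split.
- rewrite Es => psi qpsi opsi; have s'B a : B a -> s' a = a.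
    by move=> Ba; rewrite -[in LHS](sAB a) ?sK //; right.
  have := Hb _ (iq _ Hs' s'B _ qpsi).
  rewrite !psatE sat_rename => H.
  apply/(sat_automorphism _ _ Hs'); have {}H := H _; apply: (sat_ext _).1 (H _).
    by move=> [j|u] _ //=; rewrite sK.
  move=> u /=; rewrite free_vars_rename => -[[j|v] //= /opsi Hv [<-]].
  case: Hv => [Av|]; first by left; rewrite -(sAB v) ?sK //; left.
  by rewrite /params /= free_vars_rename => -[[j|w] // Hw [<-]]; right; rewrite sK.
- rewrite Es; have := ip Hs (fun a Aa => sAB a (or_introl Aa)) pb.
  rewrite /subst !rename_comp; set X := rename _ _; set Y := rename _ _.
  suff -> : X = Y by [].
  by apply: rename_ext => -[i|u] //= _; case: (fintype.split i).
Qed.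

End Tensor2.
End MonsterTensor.

(** * Cuts determined by convex subgroups *)

Section Cuts.
Variables (U : porderZmodType) (hU : DOAG U).
Implicit Types (H G : set U) (u w : U).

Lemma doag_ltMn (x y : U) n : x < y -> x *+ n.+1 < y *+ n.+1.
Proof.
move=> xy; rewrite -(doag_subr_gt0 hU) -mulrnBl doag_mulrn_gt0 //.
by rewrite doag_subr_gt0.
Qed.

Lemma doag_ltMnE (x y : U) n : (0 < n)%N -> x *+ n < y *+ n -> x < y.
Proof.
move=> n0; rewrite -(doag_subr_gt0 hU x) -(doag_subr_gt0 hU (x *+ n)) -mulrnBl.
by rewrite -!(sgn_eq1 hU) sgnMn.
Qed.

Lemma convexN H u : convex_subgroup H -> H (- u) <-> H u.
Proof. by case=> _ _ HN _; split=> /HN //; rewrite opprK. Qed.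

Lemma convexMn H u n : convex_subgroup H -> H u -> H (u *+ n).
Proof.
by case=> H0 HD _ _ Hu; elim: n => [|n IH]; rewrite ?mulr0n // mulrS; apply: HD.
Qed.

Lemma convex_lt H h u : convex_subgroup H -> H h -> 0 < u -> ~ H u -> h < u.
Proof.
move=> [H0 _ _ Hc] Hh u0 nHu.
have [//|Eh|lt] := doag_ltgt hU h u; first by rewrite -Eh in nHu.
by case: nHu; apply: (Hc 0 u h) => //; apply: ltW.
Qed.

Lemma convex_divn H w n : convex_subgroup H -> ~ H (w *+ n) -> ~ H w.
Proof. by move=> cH nH /(convexMn n cH). Qed.

Lemma doag_div_gt0 u n : 0 < u -> exists2 w, 0 < w & w *+ n.+1 = u.
Proof.
move=> u0; have [w Ew] := @doag_div _ hU u n.+1 isT; exists w => //.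
by apply: (@doag_ltMnE _ _ n.+1) => //; rewrite mul0rn Ew.
Qed.

Lemma convex_total H G : convex_subgroup H -> convex_subgroup G ->
  H `<=` G \/ G `<=` H.
Proof.
move=> cH cG; have [|nHG] := pselect (H `<=` G); first by left.
right=> g Gg; move: nHG => /existsNP[h /not_implyP[Hh nGh]].
have [_ _ _ Hc] := cH.
wlog h0 : h Hh nGh / 0 < h.
  move=> W; have [h0|h0|h0] := doag_ltgt hU 0 h; first exact: (W h).
    by case: nGh; rewrite -h0; case: cG.
  apply: (W (- h)); rewrite ?convexN ?doag_oppr_gt0 //.
have g1 := convex_lt cG Gg h0 nGh.
have /convex_lt g2 : G (- g) by apply/convexN.
have {}g2 := g2 _ cG h0 nGh.
have HNh : H (- h) by apply/convexN.
by apply: (Hc (- h) g h) => //; doag hU.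
Qed.

(* [c] lies above [H] and below all elements of U above [H]. *)
Definition in_cut (V : Type) (S : set (formula (V + U))) (c : (V -> U) -> U) H :=
  (forall h, H h -> forced S (fun e => h < c e)) /\
  (forall u, 0 < u -> ~ H u -> forced S (fun e => c e < u)).

(* [f] is infinitesimal with respect to [c]. *)
Definition below (V : Type) (S : set (formula (V + U))) (f c : (V -> U) -> U) :=
  forall n : nat, forced S (fun e => f e *+ n < c e /\ - (f e *+ n) < c e).

Section FixType.
Variables (V : Type) (S : set (formula (V + U))).
Implicit Types f g c : (V -> U) -> U.

Lemma in_cut_gt0 c H : convex_subgroup H -> in_cut S c H ->
  forced S (fun e => 0 < c e).
Proof. by case=> H0 _ _ _ [+ _]; apply. Qed.

Lemma in_cut_ext f g H : (forall e, f e = g e) -> in_cut S f H -> in_cut S g H.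
Proof. by move/funext => ->. Qed.

Lemma belowD f g c : below S f c -> below S g c -> below S (fun e => f e + g e) c.
Proof.
move=> Hf Hg n; apply: forced2 (Hf (n + n)%N) (Hg (n + n)%N) _ => e.
by rewrite !mulrnDl !mulrnDr => -[H1 H2] [H3 H4]; split; doag hU.
Qed.

Lemma belowN f c : below S f c -> below S (fun e => - f e) c.
Proof.
move=> Hf n; apply: forcedW (Hf n) _ => e [H1 H2].
by rewrite mulNrn; split; doag hU.
Qed.

Lemma below0 c : forced S (fun e => 0 < c e) -> below S (fun=> 0) c.
Proof.
by move=> Hc n; apply: forcedW Hc _ => e ce; rewrite mul0rn oppr0.
Qed.

Lemma belowMn f c n : below S f c -> below S (fun e => f e *+ n) c.
Proof. by move=> Hf m; apply: forcedW (Hf (n * m)%N) _ => e; rewrite mulrnA. Qed.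

Lemma belowMz f c m : below S f c -> below S (fun e => f e *~ m) c.
Proof.
case: m => n Hf; first exact: (belowMn n Hf).
by have := belowN (belowMn n.+1 Hf).
Qed.

Lemma below_sum (I : Type) (r : seq I) (P : pred I) (F : I -> (V -> U) -> U) c :
  forced S (fun e => 0 < c e) -> (forall i, P i -> below S (F i) c) ->
  below S (fun e => \sum_(i <- r | P i) F i e) c.
Proof.
move=> Hc HF; elim: r => [|i r IH].
  by move=> n; apply: forcedW (below0 Hc n) _ => e; rewrite big_nil.
have [Pi|nPi] := boolP (P i).
  by move=> n; apply: forcedW (belowD (HF i Pi) IH n) _ => e; rewrite big_cons Pi.
by move=> n; apply: forcedW (IH n) _ => e; rewrite big_cons (negbTE nPi).
Qed.

Lemma below_const c H w : convex_subgroup H -> in_cut S c H -> H w ->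
  below S (fun=> w) c.
Proof.
move=> cH [Hc _] Hw n; have Hn := convexMn n cH Hw.
by apply: forced2 (Hc _ Hn) (Hc _ ((convexN _ cH).2 Hn)) _.
Qed.

Lemma const_below c H w : convex_subgroup H -> in_cut S c H -> ~ H w -> 0 < w ->
  below S c (fun=> w).
Proof.
move=> cH Hc nHw w0 n; have [v v0 Ev] := doag_div_gt0 n w0.
have nHv : ~ H v by apply: (@convex_divn _ _ n.+1) => //; rewrite Ev.
apply: forced2 (in_cut_gt0 cH Hc) (Hc.2 _ v0 nHv) _ => e c0 cv.
have := doag_ltMn n cv; rewrite Ev mulrS => H1.
case: n {Ev} H1 => [|n] H1; first by rewrite !mulr0n; split; doag hU.
by have := doag_mulrn_gt0 hU c0 (ltn0Sn n) => H2; split; doag hU.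
Qed.

Lemma in_cut_below c c' H H' : convex_subgroup H -> convex_subgroup H' ->
  in_cut S c H -> in_cut S c' H' -> ~ H' `<=` H -> below S c c'.
Proof.
move=> cH cH' Hc Hc' /existsNP[u /not_implyP[H'u nHu]].
wlog u0 : u H'u nHu / 0 < u.
  move=> W; have [u0|u0|u0] := doag_ltgt hU 0 u; first exact: (W u).
    by case: nHu; rewrite -u0; case: cH.
  apply: (W (- u)); rewrite ?convexN ?doag_oppr_gt0 //.
move=> n; apply: forced2 (const_below cH Hc nHu u0 n) (Hc'.1 _ H'u) _ => e [H1 H2] H3.
by split; doag hU.
Qed.

Lemma in_cut_sub f g H G n : consistent S -> convex_subgroup H -> convex_subgroup G ->
  in_cut S f H -> in_cut S g G -> forced S (fun e => f e < g e *+ n) -> H `<=` G.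
Proof.
move=> cS cH cG Hf Hg Hfg; apply: contrapT => nHG.
have B := in_cut_below cG cH Hg Hf nHG.
by have [e [H1 [H2 _]]] := forced_ex cS (forcedI Hfg (B n)); doag hU.
Qed.

End FixType.

Lemma doag_leMz (c : U) (l : int) : 0 < c -> 0 < l -> c <= c *~ l.
Proof.
move=> c0; case: l => // -[|n] // _; rewrite -pmulrn mulrS.
case: n => [|n]; first by rewrite mulr0n addr0.
have := doag_mulrn_gt0 hU c0 (ltn0Sn n) => H; doag hU.
Qed.

(** Such an f would stay within a factor two of w, which lies in U. But 2 w < f if w is in G, and 2
    f < w otherwise. *)
Lemma below_const_notin_cut V (S : set (formula (V + U))) f R w G :
  consistent S -> convex_subgroup G -> in_cut S f G -> w != 0 ->
  below S R (fun=> if 0 < w then w else - w) ->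
  ~ forced S (fun e => f e = R e + w).
Proof.
move=> cS cG fG w0 B Hf; have f0 := in_cut_gt0 cG fG.
have w1 : 0 < w.
  have [e [[H1 H2] [H3 H4]]] := forced_ex cS (forcedI (forcedI f0 Hf) (B 1%N)).
  case: (doag_ltgt hU 0 w) => [//|E|nw]; first by rewrite -E eqxx in w0.
  move: H2 H3 H4; rewrite (lt_gtF nw) mulr1n => H2 H3 H4.
  by exfalso; doag hU.
move: B; rewrite w1 => B.
have [Gw|nGw] := pselect (G w).
  have [e [H1 [H2 [H3 H4]]]] := forced_ex cS (forcedI (fG.1 _ (convexMn 2 cG Gw)) (forcedI Hf (B 1%N))).
  by move: H1 H2 H3 H4; rewrite mulr1n mulr2n => *; doag hU.
have [e [H1 [H2 [H3 H4]]]] := forced_ex cS (forcedI (const_below cG fG nGw w1 2%N) (forcedI Hf (B 2%N))).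
by move: H1 H2 H3 H4; rewrite !mulr2n => -[*]; doag hU.
Qed.

(** * Combinations of elements in the cuts of distinct subgroups *)

Section Combinations.
Variables (m : nat) (H : 'I_m -> set U).
Hypotheses (cH : forall i, convex_subgroup (H i)) (injH : injective H).
Implicit Types l : 'I_m -> int.

(** Convex subgroups form a chain, so the nonzero coefficients have a largest group. Either it
    contains w, and its term dominates, or w dominates all the terms; the second case includes l =
    0. *)
Lemma dominant_cases l w :
  (exists i, [/\ l i != 0, H i w & forall j, l j != 0 -> H j `<=` H i]) \/
  (forall i, l i != 0 -> ~ H i w).
Proof.
have E (s : seq 'I_m) : s <> [::] ->
    exists2 i, i \in s & forall j, j \in s -> H j `<=` H i.
  elim: s => // a s IH _; have [->|/IH[i si Hi]] := pselect (s = [::]).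
    by exists a; rewrite ?mem_head // => j; rewrite inE => /eqP->.
  have [ai|ia] := convex_total (cH a) (cH i).
  - by exists i; rewrite ?inE ?si ?orbT // => j; rewrite inE => /orP[/eqP->|/Hi].
  - exists a; rewrite ?mem_head // => j; rewrite inE => /orP[/eqP->|/Hi ji] //.
    exact: subset_trans ji ia.
have [|/E[i]] := pselect ([seq i <- enum 'I_m | l i != 0] = [::]).
  move=> E0; right=> i li; have : i \in [seq i <- enum 'I_m | l i != 0].
    by rewrite mem_filter li mem_enum.
  by rewrite E0.
rewrite mem_filter => /andP[li _] Hi.
have {}Hi j : l j != 0 -> H j `<=` H i by move=> lj; apply: Hi; rewrite mem_filter lj mem_enum.
by have [Hiw|nHiw] := pselect (H i w); [left; exists i|right => j /Hi ji /ji].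
Qed.

Definition comb V (c : 'I_m -> (V -> U) -> U) l w (e : V -> U) : U :=
  \sum_i c i e *~ l i + w.

Lemma comb_dominant V (S : set (formula (V + U))) c l w i :
  (forall i, in_cut S (c i) (H i)) -> H i w ->
  (forall j, l j != 0 -> H j `<=` H i) ->
  exists2 R, below S R (c i) & forall e, comb c l w e = c i e *~ l i + R e.
Proof.
move=> Hc Hw Hl; exists (fun e => \sum_(j | j != i) c j e *~ l j + w).
  apply: belowD; last exact: below_const (Hw).
  apply: below_sum => [|j ji]; first exact: in_cut_gt0 (Hc i).
  have [->|lj] := eqVneq (l j) 0.
    by move=> n; apply: forcedW (below0 (in_cut_gt0 (cH i) (Hc i)) n) _ => e; rewrite mulr0z.
  apply: belowMz; apply: in_cut_below (Hc _) (Hc _) _ => // ij.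
  by move/eqP: ji; apply; apply: injH; apply/seteqP; split => //; apply: Hl.
by move=> e; rewrite /comb (bigD1 i) //= addrA.
Qed.

Lemma comb_const V (S : set (formula (V + U))) c l w :
  (forall i, in_cut S (c i) (H i)) ->
  (forall i, l i != 0 -> ~ H i w) -> w != 0 ->
  below S (fun e => \sum_i c i e *~ l i) (fun=> if 0 < w then w else - w).
Proof.
move=> Hc Hl w0; have w'0 : 0 < (if 0 < w then w else - w).
  case: ifP => // nw; case: (doag_ltgt hU 0 w) => [|E|]; rewrite ?nw ?doag_oppr_gt0 //.
  by rewrite -E eqxx in w0.
apply: below_sum => [|i _]; first by apply: forcedT.
have [->|li] := eqVneq (l i) 0.
  move=> n; apply: forcedT => e; rewrite mulr0z mul0rn oppr0; split; exact: w'0.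
apply: belowMz; apply: const_below (Hc i) _ _ => //.
by case: ifP => _; rewrite ?convexN //; apply: Hl.
Qed.

(** As 0 lies in every H i, the hypothesis says that all coefficients vanish. *)
Lemma comb_trivial V (c : 'I_m -> (V -> U) -> U) l e :
  (forall i, l i != 0 -> ~ H i 0) -> comb c l 0 e = 0.
Proof.
move=> Hl; rewrite /comb addr0 big1 // => i _; have [->|/Hl[]] := eqVneq (l i) 0.
  by rewrite mulr0z.
by case: (cH i).
Qed.

(* The sign of a combination of elements in the cuts of distinct convex
   subgroups is that of its dominant term, so it does not depend on the type. *)
Lemma comb_decided l w : exists s : int, forall V (S : set (formula (V + U))) c,
  (forall i, in_cut S (c i) (H i)) -> forced S (fun e => sgn (comb c l w e) = s).
Proof.
have [[i [li Hiw Hi]]|Hl] := dominant_cases l w.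
  exists (sgz (l i)) => V S c Hc.
  have [R HR E] := comb_dominant Hc Hiw Hi.
  apply: forced2 (in_cut_gt0 (cH i) (Hc i)) (HR 1%N) _ => e c0; rewrite E mulr1n => -[R1 R2].
  have [l0|l0|l0] := ltrgtP (l i) 0; last by rewrite l0 eqxx in li.
    rewrite ltr0_sgz //; apply: sgn_lt0; have := @doag_leMz (c i e) (- l i) c0.
    rewrite oppr_gt0 => /(_ l0); rewrite mulrNz => H1; doag hU.
  by rewrite gtr0_sgz //; apply: sgn_gt0; have H1 := doag_leMz c0 l0; doag hU.
exists (sgn w) => V S c Hc; have [w0|w0] := eqVneq w 0.
  by apply: forcedT => e; rewrite w0 comb_trivial ?sgn_0 // -w0.
apply: forcedW (comb_const Hc Hl w0 1%N) _ => e; rewrite mulr1n /comb.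
case: ifP => nw [H1 H2]; first by rewrite !sgn_gt0 //; doag hU.
have w1 : w < 0 by case: (doag_ltgt hU 0 w) => [|E|//]; [rewrite nw|rewrite -E eqxx in w0].
by rewrite !sgn_lt0 //; doag hU.
Qed.

(** Positivity of f makes the dominant coefficient positive; f and the dominant c i are then bounded
    by multiples of each other, so they lie in the same cut. A dominant constant is excluded by
    [below_const_notin_cut]. *)
Lemma comb_in_cut V (S : set (formula (V + U))) c l w f G :
  consistent S -> convex_subgroup G -> in_cut S f G ->
  (forall i, in_cut S (c i) (H i)) ->
  forced S (fun e => f e = comb c l w e) -> exists2 i, l i != 0 & G = H i.
Proof.
move=> cS cG fG Hc Hf; have f0 := in_cut_gt0 cG fG.
have [[i [li Hiw Hi]]|Hl] := dominant_cases l w; last exfalso.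
  exists i => //; have [R HR E] := comb_dominant Hc Hiw Hi.
  have c0 := in_cut_gt0 (cH i) (Hc i).
  have l0 : 0 < l i.
    rewrite lt0r li; apply: contraT; rewrite -ltNge => l0.
    have [e [[H1 H2] [H3 [H4 H5]]]] := forced_ex cS (forcedI (forcedI f0 Hf) (forcedI c0 (HR 1%N))).
    move: H2 H4 H5; rewrite E mulr1n => H2 H4 H5.
    have := @doag_leMz (c i e) (- l i) H3; rewrite oppr_gt0 => /(_ l0).
    by rewrite mulrNz => H6; exfalso; doag hU.
  apply/seteqP; split.
    (* The extra unit absorbs the remainder, which is less than c i. *)
    apply: (@in_cut_sub _ S f (c i) _ _ (`|l i|.+1)%N) => //.
    apply: forced2 Hf (HR 1%N) _ => e ->; rewrite E mulr1n mulrSr => -[H1 _].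
    have -> : c i e *~ l i = c i e *+ `|l i|%N by rewrite pmulrn gtz0_abs.
    doag hU.
  (* The remainder R satisfies -2 R < c i, so 2 f > 2 c i - c i. *)
  apply: (@in_cut_sub _ S (c i) f _ _ 2) => //.
  apply: forced3 Hf (HR 2%N) c0 _ => e -> ; rewrite E mulr2n mulr2n => -[H1 H2] H3.
  have H4 := doag_leMz H3 l0; doag hU.
have [w0|w0] := eqVneq w 0.
  have [e [H1 H2]] := forced_ex cS (forcedI f0 Hf).
  by move: H1; rewrite H2 w0 comb_trivial ?ltxx // -w0.
apply: (@below_const_notin_cut _ S f _ w G cS cG fG w0 (comb_const Hc Hl w0)).
by apply: forcedW Hf _ => e ->.
Qed.

End Combinations.
End Cuts.

(** * The convex subgroups attached to an invariant type *)

(** Clear the denominators of a rational vector in the kernel, which is nonzero since the rank is at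
    most n < m. *)
Lemma int_kernel m n (k : 'I_m -> 'I_n -> int) : (n < m)%N ->
  exists2 l : 'I_m -> int, (exists i, l i != 0) & forall j, \sum_i k i j * l i = 0.
Proof.
move=> nm; pose M : 'M[rat]_(m, n) := \matrix_(i, j) (k i j)%:~R.
have /matrix0Pn[i0 [j0 v0]] : kermx M != 0.
  rewrite kermx_eq0 -row_leq_rank -ltnNge.
  by rewrite (leq_ltn_trans (rank_leq_col M) nm).
pose v i := kermx M i0 i.
have vM j : \sum_i v i * (k i j)%:~R = 0.
  have := mulmx_ker M => /matrixP/(_ i0 j); rewrite mxE [RHS]mxE => E.
  by rewrite -[RHS]E; apply: eq_bigr => i _; rewrite [M i j]mxE.
pose D := \prod_i denq (v i).
pose l i := numq (v i) * \prod_(j | j != i) denq (v j).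
have El i : (l i)%:~R = v i * D%:~R :> rat.
  rewrite /D (bigD1 i) //= /l !intrM mulrA; congr (_ * _).
  by rewrite -[X in _ = X * _]divq_num_den divfK // intr_eq0 denq_eq0.
have D0 : D != 0 by apply/prodf_neq0 => i _; exact: denq_neq0.
exists l.
  exists j0; rewrite -(intr_eq0 rat) El mulf_neq0 //.
  by rewrite intr_eq0.
move=> j; apply/eqP; rewrite -(intr_eq0 rat) rmorph_sum /=; apply/eqP.
transitivity ((\sum_i v i * (k i j)%:~R) * D%:~R); last by rewrite vM mul0r.
by rewrite mulr_suml; apply: eq_bigr => i _; rewrite intrM El mulrCA mulrA.
Qed.

Section Structure.
Variables (K : Type) (U : porderZmodType) (hM : monster_DOAG U K).

Let hK : uncountable_strong_limit K. Proof. by case: hM. Qed.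
Let hU : DOAG U. Proof. by case: hM. Qed.

Section FixedType.
Variables (V : finType) (p : set (formula (V + U))).
Hypothesis hp : complete_type setT p.
Implicit Types (f c : (V -> U) -> U) (H : set U) (A : set U).

Let pc : consistent p. Proof. by case: hp. Qed.

Lemma affineT_const (u : U) : affine setT (fun _ : V -> U => u).
Proof. by apply: affine_const; apply: dcl_mem. Qed.

Lemma forced_lt_total f g : affine setT f -> affine setT g ->
  ~ forced p (fun e => f e < g e) -> forced p (fun e => g e <= f e).
Proof.
move=> Hf Hg n; case: (forced_complete_ext hU hp (affineB Hg Hf)) => H.
- by case: n; apply: forcedW H _ => e; rewrite doag_subr_gt0.
- by apply: forcedW H _ => e H; doag hU.
- by apply: forcedW H _ => e H; doag hU.
Qed.

Lemma forced_total f g : affine setT f -> affine setT g ->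
  [\/ forced p (fun e => f e < g e), forced p (fun e => f e = g e) |
      forced p (fun e => g e < f e)].
Proof.
move=> Hf Hg; case: (forced_complete_ext hU hp (affineB Hg Hf)) => H.
- by apply: Or31; apply: forcedW H _ => e H; doag hU.
- by apply: Or32; apply: forcedW H _ => e H; doag hU.
- by apply: Or33; apply: forcedW H _ => e H; doag hU.
Qed.

Lemma aut_invariant_lt A s k (a u : U) : aut_invariant A p ->
  automorphism s -> (forall a, A a -> s a = a) -> s a = a ->
  (forced p (fun e => u < lin k e + a) -> forced p (fun e => s u < lin k e + a)) /\
  (forced p (fun e => lin k e + a < u) -> forced p (fun e => lin k e + a < s u)).
Proof.
move=> ip Hs sA sa; have [_ _ sD sN _] := Hs.
have E : s (a - u) = a - s u by rewrite sD sN sa.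
split=> H.
- have H1 : forced p (fun e => sgn (lin k e + (a - u)) = 1).
    by apply: forcedW H _ => e H; rewrite sgn_gt0 //; doag hU.
  apply: forcedW (aut_invariant_sgn ip Hs sA H1) _ => e.
  by rewrite E (sgn_eq1 hU) => H2; doag hU.
- have H1 : forced p (fun e => sgn (lin k e + (a - u)) = -1).
    by apply: forcedW H _ => e H; rewrite sgn_lt0 //; doag hU.
  apply: forcedW (aut_invariant_sgn ip Hs sA H1) _ => e.
  by rewrite E (sgn_eqN1 hU) => H2; doag hU.
Qed.

Lemma realizes_lt A x f g : realizes p A x -> affine A f -> affine A g ->
  forced p (fun e => f e < g e) -> f x < g x.
Proof.
move=> Hx Hf Hg H; rewrite -(doag_subr_gt0 hU) -(sgn_eq1 hU).
apply: (realizes_sgn hU hp Hx (affineB Hg Hf)).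
by apply: forcedW H _ => e H; rewrite sgn_gt0 // doag_subr_gt0.
Qed.

(** The usual source of contradictions: an object invariant over A cannot distinguish y from z, so a
    boundary between them forces a point of [dcl A] there. *)
Lemma dcl_between A (y z : U) : small K A -> y < z ->
  (forall a, dcl A a -> y <= a -> a <= z -> False) ->
  exists s, [/\ automorphism s, forall a, A a -> s a = a & s y = z].
Proof.
move=> sA yz H; apply: (monster_conjugate1 hM) => // a Ha.
have [ay|ay|ya] := doag_ltgt hU a y.
- by rewrite !sgn_gt0 //; doag hU.
- by exfalso; apply: (H a) => //; doag hU.
have [az|az|za] := doag_ltgt hU a z.
- by exfalso; apply: (H a) => //; doag hU.
- by exfalso; apply: (H a) => //; doag hU.
- by rewrite !sgn_lt0 //; doag hU.
Qed.

Section OneForm.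
Variables (A : set U) (k : V -> int) (x : V -> U).
Hypotheses (sA : small K A) (ip : aut_invariant A p) (Hx : realizes p A x).
Hypothesis not_const : forall u, ~ forced p (fun e => lin k e = u).
Hypothesis x_lt : forced p (fun e => lin k x < lin k e).

Let lt u := forced p (fun e => u < lin k e).
Let gt u := forced p (fun e => lin k e < u).
Let u0 := lin k x.

Let tri u : lt u \/ gt u.
Proof.
have [H|H|H] := forced_total (affineT_const u) (affine_lin setT k); [by left| |by right].
by case: (not_const (u := u)); apply: forcedW H _ => e.
Qed.

Let lt_gt l b : lt l -> gt b -> l < b.
Proof.
by move=> Hl Hb; have [e [H1 H2]] := forced_ex pc (forcedI Hl Hb); doag hU.
Qed.

Let lt_le l l' : lt l -> l' <= l -> lt l'.
Proof. by move=> Hl ll; apply: forcedW Hl _ => e H; doag hU. Qed.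

(** The element u0 of U is below the cut and has the type of c over A. With no point of [dcl A]
    between the cut and b, u0 and b would be conjugate over A, and invariance of p would put b below
    the cut as well. *)
Let gt_dcl b : gt b -> exists a, [/\ dcl A a, gt a & a <= b].
Proof.
move=> Hb; apply: contrapT => N.
have [|a Ha ua ab|s [Hs sfix su]] := @dcl_between A u0 b sA; first exact: lt_gt.
  apply: N; exists a; split => //; case: (tri a) => // Hlt; exfalso.
  have := realizes_lt Hx (affine_const V Ha) (affine_lin A k) Hlt.
  by rewrite -/u0 => H; doag hU.
have [_ s0 _ _ _] := Hs.
have [+ _] := aut_invariant_lt k u0 ip Hs sfix s0.
rewrite su => H; suff Hlb : lt b by have := lt_gt Hlb Hb; rewrite ltxx.
have E : forced p (fun e => u0 < lin k e + 0) by apply: forcedW x_lt _ => e; rewrite addr0.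
by apply: forcedW (H E) _ => e; rewrite addr0.
Qed.

(** The stabiliser of the cut of c; by [tri] the set [gt] is the complement of [lt], so translating
    [lt] is enough. *)
Let H u := forall l, lt l <-> lt (l + u).

Let convH : convex_subgroup H.
Proof.
split.
- by move=> l; rewrite addr0.
- by move=> u v Hu Hv l; rewrite (Hu l) (Hv (l + u)) addrA.
- by move=> u Hu l; have := Hu (l - u); rewrite subrK => ->.
- move=> u v w Hu Hw uv vw l; split=> [/(Hw l) Hl|Hl].
    by apply: lt_le Hl _; doag hU.
  by apply/(Hu l); apply: lt_le Hl _; doag hU.
Qed.

Let notH u : 0 < u -> ~ H u -> exists l, lt l /\ gt (l + u).
Proof.
move=> u_gt0 /existsNP[l nl]; exists l.
case: (tri l) (tri (l + u)) => [l1 [l2|l2]|l1 [l2|l2]] //.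
  by case: nl; split.
  by have := lt_gt l2 l1 => ?; exfalso; doag hU.
by case: nl; split=> H'; have := lt_gt H'; [move/(_ _ l1)|move/(_ _ l2)]; rewrite ltxx.
Qed.

(* Take for [G] the stabiliser of the cut. Either some [b] above the cut is
   within [G] of all smaller such elements, and [b - c] works, or the cut is
   approximated from above by [dcl A] at every scale, and then the element of U
   with the same type over [A] as [c] is close enough to [c]. *)
Lemma one_form_cut : exists u s G, [/\ s = 1 \/ s = -1, convex_subgroup G &
  in_cut p (fun e => (lin k e - u) *~ s) G].
Proof.
have [[b [Hb bH]]|nb] := pselect (exists b, gt b /\ forall b', gt b' -> b' < b -> H (b - b')).
  exists b, (-1), H; split => //; first by right.
  split=> [h Hh|u u_gt0 nHu].
  - case: (tri (b - h)) => [Hl|Hg].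
      have : lt b by rewrite -(subrK h b); apply/(Hh (b - h)).
      by move/lt_gt/(_ Hb); rewrite ltxx.
    by apply: forcedW Hg _ => e He; rewrite mulrNz mulr1z; doag hU.
  - case: (tri (b - u)) => [Hl|Hg].
      by apply: forcedW Hl _ => e He; rewrite mulrNz mulr1z; doag hU.
    case: nHu; have <- : b - (b - u) = u by doag hU.
    by apply: bH Hg _; doag hU.
exists u0, 1, H; split => //; first by left.
split=> [h Hh|u u_gt0 nHu].
  have := (Hh u0).1 x_lt => Hl.
  by apply: forcedW Hl _ => e He; rewrite mulr1z; doag hU.
have [l [Hl Hlu]] := notH u_gt0 nHu.
have [b0 [Ab0 gb0 b0u]] := gt_dcl Hlu.
have [b' [gb' b'b0 nHb]] : exists b', [/\ gt b', b' < b0 & ~ H (b0 - b')].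
  apply: contrapT => N; apply: nb; exists b0; split => // b' gb' lb'.
  by apply: contrapT => nHb; apply: N; exists b'.
have [b1 [Ab1 gb1 b1b']] := gt_dcl gb'.
have d0 : 0 < b0 - b1 by doag hU.
have nHd : ~ H (b0 - b1).
  move=> Hd; apply: nHb; have [H0 _ _ Hc] := convH.
  by apply: (Hc 0 _ (b0 - b1)) => //; doag hU.
(* The step d = b0 - b1 lies in [dcl A], outside H, and d < u because l < b1 and b0 <= l + u. At
   scale d the cut is trapped between b2 - d and b2, both in [dcl A]; hence u0 > b2 - d, and c
   exceeds u0 by less than u. *)
have [l' [Hl' gl']] := notH d0 nHd.
have [b2 [Ab2 gb2 b2l']] := gt_dcl gl'.
have Hb2 : lt (b2 - (b0 - b1)) by apply: lt_le Hl' _; doag hU.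
have Ab : dcl A (b2 - (b0 - b1)) by apply: dclB => //; apply: dclB.
have := realizes_lt Hx (affine_const V Ab) (affine_lin A k) Hb2; rewrite -/u0 => H1.
have lb1 := lt_gt Hl gb1.
by apply: forcedW gb2 _ => e He; rewrite mulr1z; doag hU.
Qed.

End OneForm.

Lemma lin_cut A k : small K A -> aut_invariant A p ->
  (exists u, forced p (fun e => lin k e = u)) \/
  exists u s G, [/\ s = 1 \/ s = -1, convex_subgroup G &
    in_cut p (fun e => (lin k e - u) *~ s) G].
Proof.
move=> sA ip; have [x Hx] := monster_realizes hM sA hp.
have [|nc] := pselect (exists u, forced p (fun e => lin k e = u)); first by left.
have {}nc u : ~ forced p (fun e => lin k e = u) by move=> Hu; apply: nc; exists u.
right; have [Hl|He|Hg] := forced_total (affineT_const (lin k x)) (affine_lin setT k).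
- exact: (one_form_cut sA ip Hx nc Hl).
- by case: (nc (lin k x)); apply: forcedW He _ => e.
(* When the realisation x lies above the cut, the argument is applied to the opposite form. *)
have nc' u : ~ forced p (fun e => lin (fun v => - k v) e = u).
  move=> Hu; apply: (nc (- u)); apply: forcedW Hu _ => e <-.
  by rewrite linN opprK.
have Hg' : forced p (fun e => lin (fun v => - k v) x < lin (fun v => - k v) e).
  by apply: forcedW Hg _ => e He; rewrite !linN; doag hU.
have [u [s [G [Hs cG HG]]]] := one_form_cut sA ip Hx nc' Hg'.
exists (- u), (- s), G; split => //.
  by case: Hs => ->; [right|left; rewrite opprK].
apply: in_cut_ext HG => e; rewrite linN mulrNz -mulNrz; congr (_ *~ _).
by doag hU.
Qed.

Lemma in_cut_invariant A f H s : aut_invariant A p -> affine A f ->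
  convex_subgroup H -> in_cut p f H ->
  automorphism s -> (forall a, A a -> s a = a) -> s @` H = H.
Proof.
move=> ip [k [a [Aa Hf]]] cH Hc.
have sub s' : automorphism s' -> (forall a, A a -> s' a = a) -> forall h, H h -> H (s' h).
  move=> Hs sA h; have [_ s0 _ sN slt] := Hs.
  have sa := dcl_fixed hU Hs sA Aa.
  wlog h0 : h / 0 < s' h.
    move=> W Hh; have [h0|h0|h0] := doag_ltgt hU 0 (s' h); first exact: W.
      by rewrite -h0; case: cH.
    apply/(convexN _ cH); rewrite -sN; apply: W; first by rewrite sN doag_oppr_gt0.
    exact/convexN.
  move=> Hh; apply: contrapT => nH.
  have H1 : forced p (fun e => h < lin k e + a).
    by apply: forcedW (Hc.1 _ Hh) _ => e; rewrite Hf.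
  have [H2 _] := aut_invariant_lt k h ip Hs sA sa.
  have [e [H3 H4]] := forced_ex pc (forcedI (H2 H1) (Hc.2 _ h0 nH)).
  by move: H4; rewrite Hf => H4; doag hU.
move=> Hs sA; apply/seteqP; split=> [_ [h Hh <-]|h Hh]; first exact: sub.
have [s' Hs' [sK s'K]] := automorphism_inv Hs; exists (s' h) => //.
by apply: sub => // b Ab; rewrite -{1}(sA b) // sK.
Qed.

Definition lower_side A H := forall h, H h -> exists a, [/\ dcl A a, H a & h <= a].
Definition upper_side A H := forall u, 0 < u -> ~ H u ->
  exists a, [/\ dcl A a, 0 < a, ~ H a & a <= u].

(** Let z in U have the type over A of the element in the cut. If z is in H, then [dcl A] must meet
    [z, u] for each u above H, or z and u would be conjugate although H is invariant; such a point
    is outside H since it is above z. If z is not in H, the same argument works from below. *)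
Lemma in_cut_side A f H : small K A -> aut_invariant A p -> affine A f ->
  convex_subgroup H -> in_cut p f H -> lower_side A H \/ upper_side A H.
Proof.
move=> sA ip Af cH Hc; have [x Hx] := monster_realizes hM sA hp.
pose z := f x; have z0 : 0 < z.
  exact: realizes_lt Hx (affine_const V (dcl0 A)) Af (in_cut_gt0 cH Hc).
have inv s := @in_cut_invariant A f H s ip Af cH Hc.
have [Hz|nHz] := pselect (H z).
- right=> u u0 nHu; have zu := convex_lt hU cH Hz u0 nHu.
  apply: contrapT => N.
  have [a Ha za au|s [Hs sfix sz]] := @dcl_between A z u sA zu.
    apply: N; exists a; split => //; first by doag hU.
    move=> /(Hc.1 a) H1; have := realizes_lt Hx (affine_const V Ha) Af H1.
    by rewrite -/z => H2; doag hU.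
  by apply: nHu; rewrite -sz -(inv s Hs sfix); exists z.
- left=> h Hh; have [h0|h0] := boolP (0 < h); last first.
    exists 0; split; [exact: dcl0|by case: cH|].
    by rewrite doag_leNgt.
  have hz := convex_lt hU cH Hh z0 nHz.
  apply: contrapT => N.
  have [a Ha ha az|s [Hs sfix sz]] := @dcl_between A h z sA hz.
    apply: N; exists a; split => //; apply: contrapT => nHa.
    have a0 : 0 < a by doag hU.
    have := realizes_lt Hx Af (affine_const V Ha) (Hc.2 _ a0 nHa).
    by rewrite -/z => H2; doag hU.
  by apply: nHz; rewrite -sz -(inv s Hs sfix); exists h.
Qed.

Lemma below_trans c1 c2 c3 : below p c1 c2 -> below p c2 c3 -> below p c1 c3.
Proof.
move=> H12 H23 n; apply: forced2 (H12 n) (H23 1%N) _ => e [H1 H2].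
by rewrite mulr1n => -[H3 H4]; split; doag hU.
Qed.

(* The forms satisfy a nontrivial integer relation modulo constants, which is
   contradicted by its dominant term. *)
Lemma no_long_chain m (c : 'I_m -> (V -> U) -> U) (H : 'I_m -> set U) :
  (forall i, affine setT (c i)) -> (forall i, convex_subgroup (H i)) ->
  (forall i, in_cut p (c i) (H i)) ->
  (forall i j, i != j -> below p (c i) (c j) \/ below p (c j) (c i)) ->
  (m <= #|V|)%N.
Proof.
move=> Ac cH Hc Hb; rewrite leqNgt; apply/negP => lt_m.
have [k Hk] := choice Ac; have [a Ha] := choice Hk.
have [l [i0 li0] El] := int_kernel (fun i j => k i (enum_val j)) lt_m.
pose w := \sum_i a i *~ l i.
(* The linear parts cancel by the choice of l; only the constants remain. *)
have Ew e : \sum_i c i e *~ l i = w.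
  transitivity (\sum_i (lin (k i) e *~ l i + a i *~ l i)).
    by apply: eq_bigr => i _; rewrite (Ha i).2 mulrzDl.
  rewrite big_split /=; set X := (X in X + _); suff -> : X = 0 by rewrite add0r.
  transitivity (\sum_i \sum_v e v *~ (k i v * l i)).
    by apply: eq_bigr => i _; rewrite /lin mulrz_suml; apply: eq_bigr => v _; rewrite mulrzA.
  rewrite exchange_big big1 // => v _; rewrite -mulrz_sumr.
  by have := El (enum_rank v); rewrite enum_rankK => ->; rewrite mulr0z.
have [i li Hi] : exists2 i, l i != 0 & forall j, l j != 0 -> j != i -> below p (c j) (c i).
  have E (s : seq 'I_m) : s <> [::] ->
      exists2 i, i \in s & forall j, j \in s -> j != i -> below p (c j) (c i).
    elim: s => // b s IH _; have [->|/IH[i si Hi]] := pselect (s = [::]).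
      by exists b; rewrite ?mem_head // => j; rewrite inE => ->.
    have [<-|ib] := eqVneq i b.
      exists i; rewrite ?mem_head // => j; rewrite inE => /orP[->//|]; exact: Hi.
    case: (Hb _ _ ib) => B.
    - exists b; rewrite ?mem_head // => j; rewrite inE => /orP[->//|js jb].
      have [->//|ji] := eqVneq j i; apply: below_trans B; exact: Hi.
    - exists i; rewrite ?inE ?si ?orbT // => j; rewrite inE => /orP[/eqP->//|]; exact: Hi.
  have [|i] := E [seq i <- enum 'I_m | l i != 0].
    move=> E0; have : i0 \in [seq i <- enum 'I_m | l i != 0] by rewrite mem_filter li0 mem_enum.
    by rewrite E0.
  rewrite mem_filter => /andP[li _] Hi; exists i => // j lj; apply: Hi.
  by rewrite mem_filter lj mem_enum.
have ci0 := in_cut_gt0 (cH i) (Hc i).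
have HR : below p (fun e => \sum_(j | j != i) c j e *~ l j) (c i).
  apply: below_sum => // j ji; have [->|lj] := eqVneq (l j) 0.
    by move=> n; apply: forcedW (below0 ci0 n) _ => e; rewrite mulr0z.
  by apply: belowMz => //; apply: Hi.
have E e : w = c i e *~ l i + \sum_(j | j != i) c j e *~ l j by rewrite -(Ew e) (bigD1 i).
(* If w is in H i, the term of c i dominates both w and the other terms; otherwise w exceeds every
   multiple of c i. Neither is compatible with the relation. *)
have [Hw|nHw] := pselect (H i w).
  have HR' := belowD hU HR (below_const (cH i) (Hc i) ((convexN w (cH i)).2 Hw)).
  have [e [H1 [H2 H3]]] := forced_ex pc (forcedI ci0 (HR' 1%N)).
  move: (E e) H2 H3; rewrite mulr1n => E1 H2 H3.
  have [l0|l0|l0] := ltrgtP (l i) 0; last by rewrite l0 eqxx in li.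
    have := @doag_leMz _ hU (c i e) (- l i) H1; rewrite oppr_gt0 => /(_ l0).
    by rewrite mulrNz => H4; doag hU.
  by have H4 := doag_leMz hU H1 l0; doag hU.
have w0 : w != 0 by apply/eqP => w0; apply: nHw; rewrite w0; case: (cH i).
pose w' := if 0 < w then w else - w.
have w'0 : 0 < w'.
  rewrite /w'; case: ifP => // nw; case: (doag_ltgt hU 0 w) => [|E0|]; rewrite ?nw ?doag_oppr_gt0 //.
  by rewrite -E0 eqxx in w0.
have nHw' : ~ H i w' by rewrite /w'; case: ifP => _; rewrite ?convexN.
have B := belowD hU (belowMz hU (l i) (const_below hU (cH i) (Hc i) nHw' w'0))
  (const_below hU (cH i) (Hc i) nHw' w'0).
have B' := belowD hU (belowMz hU (- l i) (const_below hU (cH i) (Hc i) nHw' w'0))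
  (const_below hU (cH i) (Hc i) nHw' w'0).
have [e [[H1 H2] [[H3 _] [H4 _]]]] := forced_ex pc (forcedI (HR 1%N) (forcedI (B 1%N) (B' 1%N))).
move: (E e) H1 H2 H3 H4; rewrite !mulr1n mulrNz /w'; case: ifP => _ *; doag hU.
Qed.

(** Without a largest class, choice gives a sequence in which each element is infinitesimal with
    respect to the next; [no_long_chain] forbids more than [#|V|] of them. *)
Lemma archimedean_top (W : ((V -> U) -> U) -> Prop) H :
  (exists c, W c) -> convex_subgroup H ->
  (forall c, W c -> affine setT c /\ in_cut p c H) ->
  exists2 c, W c & forall c', W c' -> exists n, forced p (fun e => c' e <= c e *+ n).
Proof.
move=> [c0 Wc0] cH HW; apply: contrapT => N.
have [|g Hg] := @choice _ _ (fun c c' => W c -> W c' /\ below p c c').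
  move=> c; have [Wc|] := pselect (W c); last by exists c.
  have [c' Wc' Hc'] : exists2 c', W c' & forall n, ~ forced p (fun e => c' e <= c e *+ n).
    apply: contrapT => N'; apply: N; exists c => // c' Wc'.
    by apply: contrapT => N''; apply: N'; exists c' => // n Hn; apply: N''; exists n.
  exists c' => _; split => // n.
  have Hlt : forced p (fun e => c e *+ n < c' e).
    apply: contrapT => /forced_lt_total H1; apply: (Hc' n).
    by apply: H1; [apply: affineMn|]; case: (HW _ Wc); case: (HW _ Wc').
  have [Ac Ic] := HW _ Wc; have [Ac' Ic'] := HW _ Wc'.
  apply: forced3 Hlt (in_cut_gt0 cH Ic) (in_cut_gt0 cH Ic') _ => e H1 H2 H3; split => //.
  case: n H1 => [|n] H1; first by rewrite mulr0n; doag hU.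
  by have H4 := doag_mulrn_gt0 hU H2 (ltn0Sn n); doag hU.
have Wi i : W (iter i g c0) by elim: i => //= i IH; case: (Hg _ IH).
have Bi i j : below p (iter i g c0) (iter (j + i).+1 g c0).
  elim: j => [|j IH]; first by case: (Hg _ (Wi i)).
  by apply: below_trans IH _; case: (Hg _ (Wi (j + i).+1)).
have := @no_long_chain #|V|.+1 (fun i => iter i g c0) (fun=> H).
rewrite ltnn => X; suff : false by []; apply: X => // [i|i|i j ij].
- by case: (HW _ (Wi i)).
- by case: (HW _ (Wi i)).
- have [lt|lt|E] := ltngtP i j; last by move/eqP: ij; case; apply: val_inj.
    by left; have := Bi i (j - i.+1)%N; rewrite -addnS subnK.
  by right; have := Bi j (i - j.+1)%N; rewrite -addnS subnK.
Qed.

Lemma archimedean_bottom (W : ((V -> U) -> U) -> Prop) H :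
  (exists c, W c) -> convex_subgroup H ->
  (forall c, W c -> affine setT c /\ in_cut p c H) ->
  exists2 c, W c & forall c', W c' -> exists n, forced p (fun e => c e <= c' e *+ n).
Proof.
move=> [c0 Wc0] cH HW; apply: contrapT => N.
have [|g Hg] := @choice _ _ (fun c c' => W c -> W c' /\ below p c' c).
  move=> c; have [Wc|] := pselect (W c); last by exists c.
  have [c' Wc' Hc'] : exists2 c', W c' & forall n, ~ forced p (fun e => c e <= c' e *+ n).
    apply: contrapT => N'; apply: N; exists c => // c' Wc'.
    by apply: contrapT => N''; apply: N'; exists c' => // n Hn; apply: N''; exists n.
  exists c' => _; split => // n.
  have Hlt : forced p (fun e => c' e *+ n < c e).
    apply: contrapT => /forced_lt_total H1; apply: (Hc' n).
    by apply: H1; [apply: affineMn|]; case: (HW _ Wc); case: (HW _ Wc').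
  have [Ac Ic] := HW _ Wc; have [Ac' Ic'] := HW _ Wc'.
  apply: forced3 Hlt (in_cut_gt0 cH Ic) (in_cut_gt0 cH Ic') _ => e H1 H2 H3; split => //.
  case: n H1 => [|n] H1; first by rewrite mulr0n; doag hU.
  by have H4 := doag_mulrn_gt0 hU H3 (ltn0Sn n); doag hU.
have Wi i : W (iter i g c0) by elim: i => //= i IH; case: (Hg _ IH).
have Bi i j : below p (iter (j + i).+1 g c0) (iter i g c0).
  elim: j => [|j IH]; first by case: (Hg _ (Wi i)).
  by apply: below_trans IH; case: (Hg _ (Wi (j + i).+1)).
have := @no_long_chain #|V|.+1 (fun i => iter i g c0) (fun=> H).
rewrite ltnn => X; suff : false by []; apply: X => // [i|i|i j ij].
- by case: (HW _ (Wi i)).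
- by case: (HW _ (Wi i)).
- have [lt|lt|E] := ltngtP i j; last by move/eqP: ij; case; apply: val_inj.
    by right; have := Bi i (j - i.+1)%N; rewrite -addnS subnK.
  by left; have := Bi j (i - j.+1)%N; rewrite -addnS subnK.
Qed.

Definition cuts : set (set U) := [set H | convex_subgroup H /\
  exists2 c : (V -> U) -> U, affine setT c & in_cut p c H].

(** Distinct groups are nested, so their witnesses are pairwise comparable by [below]; more than
    [#|V|] of them would contradict [no_long_chain]. *)
Lemma finite_cuts : finite_set cuts.
Proof.
apply: contrapT => /infiniteP/card_le_relP[R [Rtot RAB Rfun Rinj]].
have [|H HR] := @choice _ _ R; first by move=> i; apply: Rtot.
have cutH i : cuts (H i) by case: (RAB _ _ (HR i)).
have [|c Hc] := @choice _ _ (fun i c => affine setT c /\ in_cut p c (H i)).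
  by move=> i; case: (cutH i) => _ [c]; exists c.
have := @no_long_chain #|V|.+1 (fun i => c i) (fun i => H i).
rewrite ltnn => X; suff : false by []; apply: X => [i|i|i|i j ij].
- by case: (Hc i).
- by case: (cutH i).
- by case: (Hc i).
have [cHi _] := cutH i; have [cHj _] := cutH j.
have [_ Ii] := Hc i; have [_ Ij] := Hc j.
have [|nij] := pselect (H i `<=` H j); last by right; apply: in_cut_below Ij Ii _.
have [ji ij'|nji _] := pselect (H j `<=` H i); last by left; apply: in_cut_below Ii Ij _.
have E : H i = H j by apply/seteqP.
have := HR i; rewrite E => /Rinj/(_ (HR j)) => /val_inj Eij.
by rewrite Eij eqxx in ij.
Qed.

Lemma cuts_invariant A : small K A -> aut_invariant A p ->
  cuts `<=` invariant_convex_subgroup K.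
Proof.
move=> sA ip H [cH [c [k [a [_ Ec]]] Hc]]; split => //.
exists (A `|` [set a]).
  by apply: (small_setU hK) => //; apply: (small_finite hK); apply: finite_set1.
have ip' : aut_invariant (A `|` [set a]) p by apply: aut_invariant_sub ip; left.
have Ac : affine (A `|` [set a]) c by exists k, a; split => //; apply: dcl_mem; right.
by move=> s Hs sA'; apply: (in_cut_invariant ip' Ac cH Hc Hs sA').
Qed.

End FixedType.
End Structure.

Section SmallCombinations.
Variables (U : porderZmodType) (hU : DOAG U).
Implicit Types (H G : set U).

(** This is [comb_in_cut] for the empty combination: no index is left to carry G. *)
Lemma const_notin_cut V (S : set (formula (V + U))) f u G :
  consistent S -> convex_subgroup G -> in_cut S f G ->
  ~ forced S (fun e => f e = u).
Proof.
move=> cS cG fG Hf.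
have inj : injective (fun _ : 'I_0 => G) by case.
have [|[//]] := @comb_in_cut U hU 0 _ (fun=> cG) inj V S (fun=> f) (fun=> 0) u f G cS cG fG (fun=> fG).
by apply: forcedW Hf _ => e; rewrite /comb big_ord0 add0r.
Qed.

Lemma comb1_decided H (l : int) (w : U) : convex_subgroup H ->
  exists s : int, forall V (S : set (formula (V + U))) c,
  in_cut S c H -> forced S (fun e => sgn (c e *~ l + w) = s).
Proof.
move=> cH; have inj : injective (fun _ : 'I_1 => H) by move=> i j _; rewrite !ord1.
have [s Hs] := @comb_decided U hU 1 _ (fun=> cH) inj (fun=> l) w.
exists s => V S c Hc; apply: forcedW (Hs V S (fun=> c) (fun=> Hc)) _ => e.
by rewrite /comb big_ord1.
Qed.

Lemma comb1_in_cut V (S : set (formula (V + U))) c f l w G H :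
  consistent S -> convex_subgroup G -> convex_subgroup H -> in_cut S f G ->
  in_cut S c H -> forced S (fun e => f e = c e *~ l + w) -> G = H.
Proof.
move=> cS cG cH fG Hc Hf.
have inj : injective (fun _ : 'I_1 => H) by move=> i j _; rewrite !ord1.
have [|i _ ->//] := @comb_in_cut U hU 1 _ (fun=> cH) inj V S (fun=> c) (fun=> l) w f G cS cG fG (fun=> Hc).
by apply: forcedW Hf _ => e; rewrite /comb big_ord1.
Qed.

Section Two.
Variables (H1 H2 : set U).
Hypotheses (cH1 : convex_subgroup H1) (cH2 : convex_subgroup H2) (neqH : H1 <> H2).
Let HH (i : 'I_2) := if i == ord0 then H1 else H2.

Let cHH i : convex_subgroup (HH i). Proof. by rewrite /HH; case: ifP. Qed.

Let injHH : injective HH.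
Proof.
move=> [[|[|//]] i0] [[|[|//]] j0]; rewrite /HH /= => E; try exact: val_inj.
by case: neqH.
Qed.

Lemma comb2_decided V (S : set (formula (V + U))) c1 c2 (l1 l2 : int) w :
  in_cut S c1 H1 -> in_cut S c2 H2 ->
  exists s : int, forced S (fun e => sgn (c1 e *~ l1 + c2 e *~ l2 + w) = s).
Proof.
move=> Hc1 Hc2.
have [s Hs] := comb_decided hU cHH injHH (fun i => if i == ord0 then l1 else l2) w.
exists s; apply: forcedW (Hs V S (fun i => if i == ord0 then c1 else c2) _) _ => [i|e].
  by rewrite /HH; case: ifP.
by rewrite /comb big_ord_recl big_ord1 /=.
Qed.

Lemma comb2_in_cut V (S : set (formula (V + U))) c1 c2 f l1 l2 w G :
  consistent S -> convex_subgroup G -> in_cut S f G ->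
  in_cut S c1 H1 -> in_cut S c2 H2 ->
  forced S (fun e => f e = c1 e *~ l1 + c2 e *~ l2 + w) -> G = H1 \/ G = H2.
Proof.
move=> cS cG fG Hc1 Hc2 Hf.
have [i||i _ ->] := @comb_in_cut U hU 2 HH cHH injHH V S
  (fun i => if i == ord0 then c1 else c2) (fun i => if i == ord0 then l1 else l2) w f G cS cG fG.
- by rewrite /HH; case: ifP.
- by apply: forcedW Hf _ => e; rewrite /comb big_ord_recl big_ord1 /=.
- by rewrite /HH; case: ifP; [left|right].
Qed.

End Two.

Lemma affine_comp (V W : finType) (j : V -> W) A (f : (V -> U) -> U) :
  affine A f -> affine A (fun e : W -> U => f (e \o j)).
Proof.
move=> [k [a [Aa Hf]]].
have H : affine A (fun e : W -> U => \sum_v e (j v) *~ k v + a).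
  apply: affineD; last exact: affine_const.
  by apply: affine_sum => v; apply: affineMz; apply: affine_var.
by apply: affine_ext H => e; rewrite Hf.
Qed.

Lemma in_cut_rename (V W : Type) (j : V -> W) (S : set (formula (V + U)))
    (S' : set (formula (W + U))) c H :
  rename (sum_map j id) @` S `<=` S' ->
  in_cut S c H -> in_cut S' (fun e => c (e \o j)) H.
Proof.
move=> SS [H1 H2]; split=> [h Hh|u u0 nHu].
- exact: forced_sub SS (forced_rename j (H1 h Hh)).
- exact: forced_sub SS (forced_rename j (H2 u u0 nHu)).
Qed.

End SmallCombinations.

(** * The convex subgroups of a tensor product *)

Section TensorCuts.
Variables (K : Type) (U : porderZmodType) (hM : monster_DOAG U K).

Let hK : uncountable_strong_limit K. Proof. by case: hM. Qed.
Let hU : DOAG U. Proof. by case: hM. Qed.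

Definition pcuts (p : global_set U) : set (set U) := @cuts U 'I_(arity p) p.

Lemma sgn1_mulz (s : int) (x : U) : s = 1 \/ s = -1 -> x *~ s *~ s = x.
Proof. by case=> ->; rewrite ?mulrNz ?mulr1z ?opprK. Qed.

Variables (p q : global_set U) (A : set U).
Hypotheses (sA : small K A) (ip : aut_invariant A p) (iq : aut_invariant A q)
  (hp : complete_type setT p) (hq : complete_type setT q).

Lemma tensor_cuts_super : pcuts p `|` pcuts q `<=` pcuts (tensor K p q).
Proof.
move=> H [[cH [c Ac Hc]]|[cH [c Ac Hc]]]; split => //.
- exists (fun e => c (e \o @lshift (arity p) (arity q))); first exact: affine_comp.
  exact: in_cut_rename (tensor_sub_x hM sA ip hp hq) Hc.
- exists (fun e => c (e \o @rshift (arity p) (arity q))); first exact: affine_comp.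
  exact: in_cut_rename (tensor_sub_y hM sA ip hp hq) Hc.
Qed.

(* [y] being independent from [x], no combination of [x]- and [y]-elements in
   the cut of [H] can collapse into [H]. *)
Lemma tensor_no_collapse H c1 c2 s1 s2 w h :
  convex_subgroup H -> s1 = 1 \/ s1 = -1 -> affine setT c1 -> affine setT c2 ->
  in_cut p c1 H -> H h ->
  ~ forced (tensor K p q) (fun e => let x := e \o @lshift (arity p) (arity q) in
      let y := e \o @rshift (arity p) (arity q) in
      0 < c1 x *~ s1 + c2 y *~ s2 + w /\ c1 x *~ s1 + c2 y *~ s2 + w < h).
Proof.
move=> cH Hs1 [k1 [a1 [_ E1]]] [k2 [a2 [_ E2]]] Hc1 Hh Hf.
pose B := A `|` [set a1; a2; w; h].
have sB : small K B by apply: (small_setU hK) => //; apply: (small_finite hK); apply: finite_set4.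
have [b Hb] := monster_realizes hM sB hq.
have AB : A `<=` B by move=> u; left.
pose f (e : 'I_(arity p) + 'I_(arity q) -> U) :=
  c1 (e \o inl) *~ s1 + c2 (e \o inr) *~ s2 + w.
have dB u : [set a1; a2; w; h] u -> dcl B u by move=> Hu; apply: dcl_mem; right.
have Bc1 : affine B c1 by exists k1, a1; split => //; apply: dB; left; left; left.
have Bc2 : affine B c2 by exists k2, a2; split => //; apply: dB; left; left; right.
have Bf : affine B f.
  apply: affineD; last by apply: affine_const; apply: dB; left; right.
  by apply: affineD; apply: affineMz; apply: affine_comp.
have Bh : affine B (fun e => f e - h).
  by apply: affineB => //; apply: affine_const; apply: dB; right.
have F1 : forced (tensor K p q) (fun e => sgn (f (e \o @unsplit _ _)) = 1).
  by apply: forcedW Hf _ => e [H1 _]; apply: sgn_gt0.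
have F2 : forced (tensor K p q) (fun e => sgn (f (e \o @unsplit _ _) - h) = -1).
  by apply: forcedW Hf _ => e [_ H2]; apply: sgn_lt0; move: H2; rewrite /f => H2; doag hU.
have {}F1 := (tensor_sgn hM sA ip hp hq 1 AB Bf Hb).1 F1.
have {}F2 := (tensor_sgn hM sA ip hp hq (-1) AB Bh Hb).1 F2.
(* With y replaced by b, the y-part becomes a constant, and only c1 remains to be confined between 0
   and h. If w' is in H, then c1 is above both w' and h - w'; otherwise w' dominates c1. *)
pose w' := c2 b *~ s2 + w.
have F : forced p (fun x => 0 < c1 x *~ s1 + w' /\ c1 x *~ s1 + w' < h).
  apply: forced2 F1 F2 _ => x /(sgn_eq1 hU) + /(sgn_eqN1 hU); rewrite /f /w'.
  have -> : join x b \o inl = x by [].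
  have -> : join x b \o inr = b by [].
  by move=> G1 G2; split; doag hU.
have [_ pc _] := hp.
have HN u : H u -> H (- u) by move/(convexN u cH).
have HD u v : H u -> H v -> H (u + v) by case: cH => _ + _ _; apply.
have [Hw|nHw] := pselect (H w').
  have Hc : H (h - w') by apply: HD => //; apply: HN.
  have [e [[G1 G2] [G3 G4]]] := forced_ex pc (forcedI F (forcedI (Hc1.1 _ Hc) (Hc1.1 _ Hw))).
  by move: G1 G2; case: Hs1 => ->; rewrite ?mulrNz !mulr1z => G1 G2; doag hU.
have [w0|w0|w0] := doag_ltgt hU 0 w'.
- have B1 := const_below hU cH Hc1 nHw w0 2%N.
  have hw : h + h < w' by apply: convex_lt cH (HD _ _ Hh Hh) w0 nHw.
  have [e [[G1 G2] [G3 G4]]] := forced_ex pc (forcedI F B1).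
  by move: G1 G2 G3 G4; rewrite mulr2n; case: Hs1 => ->; rewrite ?mulrNz !mulr1z => *; doag hU.
- by apply: nHw; rewrite -w0; case: cH.
- have nHw' : ~ H (- w') by rewrite convexN.
  have w0' : 0 < - w' by doag hU.
  have B1 := const_below hU cH Hc1 nHw' w0' 1%N.
  have [e [[G1 G2] [G3 G4]]] := forced_ex pc (forcedI F B1).
  by move: G1 G2 G3 G4; rewrite mulr1n; case: Hs1 => ->; rewrite ?mulrNz !mulr1z => *; doag hU.
Qed.

(** A form on (x, y) is the sum of a form on x, a form on y and a constant. When both forms vary
    with distinct groups, [comb2_in_cut] applies; when the groups coincide, cancellation must be
    excluded. *)
Lemma tensor_cuts_sub : pcuts (tensor K p q) `<=` pcuts p `|` pcuts q.
Proof.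
move=> G [cG [f [k [a [_ Ef]]] fG]].
have ht := tensor_complete hM sA ip hp hq; have [_ tc _] := ht.
pose k1 i := k (lshift (arity q) i); pose k2 j := k (rshift (arity p) j).
pose X (e : 'I_(arity (tensor K p q)) -> U) := e \o @lshift (arity p) (arity q).
pose Y (e : 'I_(arity (tensor K p q)) -> U) := e \o @rshift (arity p) (arity q).
have {}Ef e : f e = lin k1 (X e) + lin k2 (Y e) + a by rewrite Ef /lin big_split_ord.
have subx : rename (sum_map (@lshift (arity p) (arity q)) id) @` p `<=` tensor K p q.
  exact: (tensor_sub_x hM sA ip hp hq).
have suby : rename (sum_map (@rshift (arity p) (arity q)) id) @` q `<=` tensor K p q.
  exact: (tensor_sub_y hM sA ip hp hq).
have fx Q : forced p Q -> forced (tensor K p q) (fun e => Q (X e)).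
  by move=> HQ; apply: forced_sub subx (forced_rename _ HQ).
have fy Q : forced q Q -> forced (tensor K p q) (fun e => Q (Y e)).
  by move=> HQ; apply: forced_sub suby (forced_rename _ HQ).
have aff (V : finType) (k' : V -> int) (u : U) s : affine setT (fun e => (lin k' e - u) *~ s).
  by apply: affineMz; apply: affineB; [exact: affine_lin|exact: affineT_const].
have cutp u s H : convex_subgroup H -> in_cut p (fun e => (lin k1 e - u) *~ s) H -> pcuts p H.
  by move=> cH Hc; split => //; exists (fun e => (lin k1 e - u) *~ s).
have cutq u s H : convex_subgroup H -> in_cut q (fun e => (lin k2 e - u) *~ s) H -> pcuts q H.
  by move=> cH Hc; split => //; exists (fun e => (lin k2 e - u) *~ s).
have [[u1 D1]|[u1 [s1 [H1 [Hs1 cH1 C1]]]]] := lin_cut hM hp k1 sA ip;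
have [[u2 D2]|[u2 [s2 [H2 [Hs2 cH2 C2]]]]] := lin_cut hM hq k2 sA iq.
- exfalso; apply: (const_notin_cut hU tc cG fG (u := u1 + u2 + a)).
  by apply: forced2 (fx _ D1) (fy _ D2) _ => e E1 E2; rewrite Ef E1 E2.
- right; suff -> : G = H2 by apply: cutq C2.
  apply: (comb1_in_cut hU (l := s2) (w := u1 + u2 + a) tc cG cH2 fG (in_cut_rename suby C2)).
  by apply: forcedW (fx _ D1) _ => e E1; rewrite sgn1_mulz // Ef E1; doag hU.
- left; suff -> : G = H1 by apply: cutp C1.
  apply: (comb1_in_cut hU (l := s1) (w := u1 + u2 + a) tc cG cH1 fG (in_cut_rename subx C1)).
  by apply: forcedW (fy _ D2) _ => e E1; rewrite sgn1_mulz // Ef E1; doag hU.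
pose c1 e := (lin k1 e - u1) *~ s1; pose c2 e := (lin k2 e - u2) *~ s2.
pose w := u1 + u2 + a.
have Efc e : f e = c1 (X e) *~ s1 + c2 (Y e) *~ s2 + w.
  by rewrite /c1 /c2 !sgn1_mulz // Ef /w; doag hU.
have C1' := in_cut_rename subx C1; have C2' := in_cut_rename suby C2.
have [E|nE] := pselect (H1 = H2); last first.
  have Hf : forced (tensor K p q) (fun e => f e = c1 (X e) *~ s1 + c2 (Y e) *~ s2 + w).
    by apply: forcedT => e; rewrite Efc.
  have [->|->] := comb2_in_cut hU cH1 cH2 nE tc cG fG C1' C2' Hf.
    by left; apply: cutp C1.
  by right; apply: cutq C2.
left; suff -> : G = H1 by apply: cutp C1.
rewrite -E in C2 C2'.
(* A constant outside H1 would dominate both terms and leave f too close to an element of U to be in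
   a cut. *)
have [Hw|nHw] := pselect (H1 w); last first.
  exfalso; have w0 : w != 0 by apply/eqP => w0; apply: nHw; rewrite w0; case: cH1.
  pose w' := if 0 < w then w else - w.
  have w'0 : 0 < w'.
    rewrite /w'; case: ifP => // nw; case: (doag_ltgt hU 0 w) => [|E0|]; rewrite ?nw ?doag_oppr_gt0 //.
    by rewrite -E0 eqxx in w0.
  have nHw' : ~ H1 w' by rewrite /w'; case: ifP => _; rewrite ?convexN.
  apply: (below_const_notin_cut hU tc cG fG w0 (R := fun e => c1 (X e) *~ s1 + c2 (Y e) *~ s2)).
    by apply: belowD => //; apply: belowMz => //; [apply: const_below C1' _ _|apply: const_below C2' _ _].
  by apply: forcedT => e; rewrite Efc.
have pos (P Q : set U) : convex_subgroup P -> convex_subgroup Q ->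
    (forall u, 0 < u -> P u -> Q u) -> P `<=` Q.
  move=> cP cQ PQ u Pu; have [u0|<-|u0] := doag_ltgt hU 0 u; first exact: PQ.
    by case: cQ.
  by apply/(convexN _ cQ)/PQ; [rewrite doag_oppr_gt0|apply/convexN].
apply/seteqP; split; apply: pos => // u u0.
- move=> Gu; apply: contrapT => nHu.
  have B := belowD hU (belowMz hU s1 (const_below hU cH1 C1' nHu u0))
    (belowMz hU s2 (const_below hU cH1 C2' nHu u0)).
  have Hww : H1 (w + w) by case: cH1 => _ + _ _; apply.
  have wwu := convex_lt hU cH1 Hww u0 nHu.
  have [e [E1 [E2 _]]] := forced_ex tc (forcedI (fG.1 _ Gu) (B 2%N)).
  by move: E1 E2; rewrite Efc mulr2n /c1 /c2 => E1 E2; doag hU.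
(* Here f would be squeezed between 0 and an element of H1, the collapse excluded by
   [tensor_no_collapse]. *)
- move=> Hu; apply: contrapT => nGu.
  apply: (@tensor_no_collapse H1 c1 c2 s1 s2 w u cH1 Hs1 _ _ C1 Hu); [exact: aff|exact: aff|].
  by apply: forced2 (in_cut_gt0 cG fG) (fG.2 _ u0 nGu) _ => e; rewrite Efc.
Qed.

End TensorCuts.

(** * Domination *)

Section Domination.
Variables (K : Type) (U : porderZmodType) (hM : monster_DOAG U K).

Let hK : uncountable_strong_limit K. Proof. by case: hM. Qed.
Let hU : DOAG U. Proof. by case: hM. Qed.

Lemma type_at_lt (V : finType) (A : set U) (x : V -> U) f g :
  affine A f -> affine A g -> f x < g x ->
  forced (type_at A x) (fun e => f e < g e).
Proof.
move=> Af Ag fg; apply: forcedW (type_at_sgn hU x (affineB Ag Af)) _ => e.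
have -> : sgn (g x - f x) = 1 by apply: sgn_gt0; rewrite doag_subr_gt0.
by move/(sgn_eq1 hU); rewrite doag_subr_gt0.
Qed.

Lemma type_at_le (V : finType) (A : set U) (x : V -> U) f g :
  affine A f -> affine A g -> f x <= g x ->
  forced (type_at A x) (fun e => f e <= g e).
Proof.
move=> Af Ag; rewrite le_eqVlt => /orP[/eqP E|fg].
  apply: forcedW (type_at_sgn hU x (affineB Ag Af)) _ => e.
  rewrite E subrr sgn_0 => /(sgn_eq0 hU) E'; doag hU.
by apply: forcedW (type_at_lt Af Ag fg) _ => e; apply: ltW.
Qed.

Lemma realizes_le (V : finType) (p : set (formula (V + U))) (A : set U) x f g :
  complete_type setT p -> realizes p A x -> affine A f -> affine A g ->
  forced p (fun e => f e <= g e) -> f x <= g x.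
Proof.
move=> hp Hx Af Ag Hfg; have [c Hc] := affine_decided hU hp (affine_sub (@subsetT _ _) (affineB Ag Af)).
have E := realizes_sgn hU hp Hx (affineB Ag Af) Hc.
have [_ pc _] := hp; have [e [H1 H2]] := forced_ex pc (forcedI Hfg Hc).
rewrite doag_leNgt //; apply/negP => gf.
have : sgn (g x - f x) = -1 by apply: sgn_lt0; doag hU.
by rewrite E -H2 => /(sgn_eqN1 hU) H3; doag hU.
Qed.

Lemma realizes_forced_le (V : finType) (p : set (formula (V + U))) (A : set U) x f g :
  complete_type setT p -> realizes p A x -> affine A f -> affine A g ->
  f x <= g x -> forced p (fun e => f e <= g e).
Proof.
move=> hp Hx Af Ag fg.
apply: (forced_lt_total hM hp (affine_sub (@subsetT _ A) Ag) (affine_sub (@subsetT _ A) Af)).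
by move/(realizes_lt hM hp Hx Ag Af) => gf; doag hU.
Qed.

(** [lin_cut] provides a centre u for each form without placing it in [dcl A]; over a base, every
    form is handled with parameters that a type over A can mention. *)
Definition base (V : finType) (p : set (formula (V + U))) (A : set U) : Prop :=
  forall k : V -> int, (exists2 u, dcl A u & forced p (fun e => lin k e = u)) \/
  exists u s G, [/\ dcl A u, s = 1 \/ s = -1, convex_subgroup G &
    in_cut p (fun e => (lin k e - u) *~ s) G].

Lemma base_sub (V : finType) (p : set (formula (V + U))) A B :
  A `<=` B -> base p A -> base p B.
Proof.
move=> AB H k; case: (H k) => [[u Au Hu]|[u [s [G [Au Hs cG HG]]]]].
  by left; exists u => //; apply: dcl_sub Au.
by right; exists u, s, G; split => //; apply: dcl_sub Au.
Qed.

Lemma base_ex (V : finType) (p : set (formula (V + U))) A :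
  small K A -> complete_type setT p -> aut_invariant A p ->
  exists B, small K B /\ base p B.
Proof.
move=> sA hp ip.
(* Finite functions form a countable type, so choosing one centre for each form adds only countably
   many parameters. *)
have [|u Hu] := @choice {ffun V -> int} U (fun k u => forced p (fun e => lin k e = u) \/
  exists s G, [/\ s = 1 \/ s = -1, convex_subgroup G & in_cut p (fun e => (lin k e - u) *~ s) G]).
  move=> k; case: (lin_cut hM hp k sA ip) => [[u Hu]|[u [s [G HG]]]]; exists u; first by left.
  by right; exists s, G.
exists (range u); split.
  by apply: (small_countable hK); apply: sub_countable (card_image_le _ _) _; apply: countableP.
move=> k; have -> : k = [ffun v => k v] by apply: funext => v; rewrite ffunE.
 have Au : dcl (range u) (u [ffun v => k v]).
  by apply: dcl_mem; exists [ffun v => k v].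
case: (Hu [ffun v => k v]) => [H|[s [G [Hs cG HG]]]]; [left|right].
  by exists (u [ffun v => k v]).
by exists (u [ffun v => k v]), s, G; split.
Qed.

Section Witness.
Variables (V : finType) (p : set (formula (V + U))) (A : set U).
Hypotheses (hp : complete_type setT p) (bp : base p A).

Lemma base_witness G : cuts p G -> exists c, affine A c /\ in_cut p c G.
Proof.
move=> [cG [c [k [a [_ Ec]]] Hc]]; have [_ pc _] := hp.
case: (bp k) => [[u Au Hu]|[u [s [H [Au Hs cH HH]]]]].
  exfalso; apply: (const_notin_cut hU pc cG Hc (u := u + a)).
  by apply: forcedW Hu _ => e; rewrite Ec => ->.
exists (fun e => (lin k e - u) *~ s); split.
  by apply: affineMz; apply: affineB; [exact: affine_lin|exact: affine_const].
suff -> : G = H by [].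
apply: (comb1_in_cut hU (l := s) (w := u + a) pc cG cH Hc HH).
by apply: forcedT => e; rewrite sgn1_mulz // Ec; doag hU.
Qed.

(* An element of the cut of [G] that controls all the others from the side on
   which the cut is not determined by [A]. *)
Definition extremal G (c : (V -> U) -> U) : Prop :=
  [/\ affine A c, in_cut p c G,
    lower_side A G -> forall c', affine A c' -> in_cut p c' G ->
      exists n, forced p (fun e => c' e <= c e *+ n) &
    ~ lower_side A G -> forall c', affine A c' -> in_cut p c' G ->
      exists n, forced p (fun e => c e <= c' e *+ n)].

Lemma extremal_ex G : cuts p G -> exists c, extremal G c.
Proof.
move=> HG; have [c0 Hc0] := base_witness HG; have [cG _] := HG.
have HW (c : (V -> U) -> U) : affine A c /\ in_cut p c G -> affine setT c /\ in_cut p c G.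
  by case=> Ac ?; split => //; apply: affine_sub Ac.
have [low|nlow] := pselect (lower_side A G).
- have [|c [Ac Hc] Hmax] := @archimedean_top K U hM V p hp _ G _ cG HW; first by exists c0.
  by exists c; split => // _ c' Ac' Hc'; apply: Hmax.
- have [|c [Ac Hc] Hmin] := @archimedean_bottom K U hM V p hp _ G _ cG HW; first by exists c0.
  by exists c; split => // _ c' Ac' Hc'; apply: Hmin.
Qed.

End Witness.

(** The bounds in [dcl A] confine g on the side that A controls; on the other side a comparison with
    a multiple of t does. *)
Lemma cut_propagate Z (S : set (formula (Z + U))) (g t : (Z -> U) -> U) A G n :
  convex_subgroup G -> in_cut S t G ->
  (forall a, dcl A a -> G a -> forced S (fun e => a < g e)) ->
  (forall a, dcl A a -> 0 < a -> ~ G a -> forced S (fun e => g e < a)) ->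
  (lower_side A G /\ forced S (fun e => g e <= t e *+ n)) \/
  (upper_side A G /\ forced S (fun e => t e <= g e *+ n)) ->
  in_cut S g G.
Proof.
move=> cG Ht Hl Hu; case=> -[side Hn]; split.
- move=> h Hh; have [a [Aa Ga ha]] := side h Hh.
  by apply: forcedW (Hl a Aa Ga) _ => e H; doag hU.
- move=> u u0 nGu; apply: forced2 Hn (const_below hU cG Ht nGu u0 n) _ => e H1 [H2 _].
  by doag hU.
- move=> h Hh; have Hhn := convexMn n cG Hh.
  apply: forced3 Hn (Ht.1 _ Hhn) (in_cut_gt0 cG Ht) _ => e H1 H2 H3.
  case: n {Hhn} H1 H2 => [|n] H1 H2.
    by move: H1; rewrite mulr0n => H1; exfalso; doag hU.
  by apply: (@doag_ltMnE _ hU _ _ n.+1) => //; doag hU.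
- move=> u u0 nGu; have [a [Aa a0 nGa au]] := side u u0 nGu.
  by apply: forcedW (Hu a Aa a0 nGa) _ => e H; doag hU.
Qed.

Section OneSide.
Variables (V W Z : finType) (jx : V -> Z) (jy : W -> Z) (A : set U).
Variables (p : set (formula (V + U))) (q : set (formula (W + U))).
Variables (S : set (formula (Z + U))) (z : Z -> U).
Hypotheses (sA : small K A) (hq : complete_type setT q) (iq : aut_invariant A q)
  (bq : base q A) (Hy : realizes q A (z \o jy))
  (pS : rename (sum_map jx id) @` p `<=` S) (rS : type_at A z `<=` S).
Hypothesis linked : forall G, cuts q G -> exists c d,
  [/\ affine A c, in_cut p c G, extremal q A G d & c (z \o jx) = d (z \o jy)].

Lemma linked_cut G c : affine A c -> convex_subgroup G -> in_cut q c G ->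
  in_cut S (fun e => c (e \o jy)) G.
Proof.
move=> Ac cG Hc; have cutG : cuts q G by split => //; exists c => //; apply: affine_sub Ac.
have [t [d [At Ht [Ad Hd Hlow Hup] Etd]]] := linked cutG.
have Ht' := in_cut_rename pS Ht.
have rlt f g : affine A f -> affine A g -> f z < g z -> forced S (fun e => f e < g e).
  by move=> Af Ag fg; apply: forced_sub rS (type_at_lt Af Ag fg).
have rle f g : affine A f -> affine A g -> f z <= g z -> forced S (fun e => f e <= g e).
  by move=> Af Ag fg; apply: forced_sub rS (type_at_le Af Ag fg).
have Hl a : dcl A a -> G a -> forced S (fun e => a < c (e \o jy)).
  move=> Aa Ga; apply: rlt; [exact: affine_const|exact: affine_comp|].
  exact: (realizes_lt hM hq Hy (affine_const W Aa) Ac (Hc.1 a Ga)).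
have Hu a : dcl A a -> 0 < a -> ~ G a -> forced S (fun e => c (e \o jy) < a).
  move=> Aa a0 nGa; apply: rlt; [exact: affine_comp|exact: affine_const|].
  exact: (realizes_lt hM hq Hy Ac (affine_const W Aa) (Hc.2 a a0 nGa)).
have [low|nlow] := pselect (lower_side A G).
- have [n Hn] := Hlow low c Ac Hc.
  apply: (cut_propagate (n := n) cG Ht' Hl Hu); left; split => //.
  apply: (rle (fun e => c (e \o jy)) (fun e => t (e \o jx) *+ n)).
  + exact: affine_comp.
  + by apply: affineMn; apply: affine_comp.
  rewrite Etd; exact: (realizes_le hq Hy Ac (affineMn n Ad) Hn).
- have [n Hn] := Hup nlow c Ac Hc.
  have [//|up] := in_cut_side hM hq sA iq Ac cG Hc.
  apply: (cut_propagate (n := n) cG Ht' Hl Hu); right; split => //.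
  apply: (rle (fun e => t (e \o jx)) (fun e => c (e \o jy) *+ n)).
  + exact: affine_comp.
  + by apply: affineMn; apply: affine_comp.
  rewrite Etd; exact: (realizes_le hq Hy Ad (affineMn n Ac) Hn).
Qed.

(** It suffices to force the signs of affine functions of y. As A is a base, such a function is
    either constant, with a value that the type of z over A records, or a signed element of a cut
    plus a constant; [linked_cut] carries that cut over to S and [comb1_decided] gives the sign. *)
Lemma linked_forced phi : q phi -> forced S (fun e => psat (e \o jy) phi).
Proof.
have [_ qc _] := hq.
move=> qphi; apply: (forced_transfer hU (@overT _ _ phi) qc qphi) => f [k [a [_ Ef]]].
case: (bq k) => [[u Au Hu]|[u [s [G [Au Hs cG HG]]]]].
  exists (sgn (u + a)); split; first by apply: forcedW Hu _ => e; rewrite Ef => ->.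
  have Hz : lin k (z \o jy) = u.
    have Af := affineB (affine_lin A k) (affine_const W Au).
    have /(sgn_eq0 hU)/eqP : sgn (lin k (z \o jy) - u) = 0.
      apply: (realizes_sgn hU hq Hy Af); apply: forcedW Hu _ => e ->.
      by rewrite subrr sgn_0.
    by rewrite subr_eq0 => /eqP.
  have Af : affine A (fun e : Z -> U => lin k (e \o jy) - u).
    by apply: affineB; [apply: affine_comp; exact: affine_lin|exact: affine_const].
  apply: forcedW (forced_sub rS (type_at_sgn hU z Af)) _ => e.
  by rewrite Hz subrr sgn_0 => /(sgn_eq0 hU)/eqP; rewrite subr_eq0 Ef => /eqP->.
have [c Hc] := comb1_decided hU s (u + a) cG.
have Ac : affine A (fun e => (lin k e - u) *~ s).
  by apply: affineMz; apply: affineB; [exact: affine_lin|exact: affine_const].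
have E e : f e = (lin k e - u) *~ s *~ s + (u + a).
  by rewrite sgn1_mulz // Ef; doag hU.
exists c; split.
- by apply: forcedW (Hc _ _ _ HG) _ => e; rewrite E.
- by apply: forcedW (Hc _ _ _ (linked_cut Ac cG HG)) _ => e; rewrite E.
Qed.

End OneSide.

(** By [comb_decided] the tuples c(x) and d(y) give the same signs to all affine functions over A,
    so an automorphism fixing A takes d(y) to c(x); it is applied to y. *)
Lemma amalgam (V W : finType) (p : set (formula (V + U))) (q : set (formula (W + U))) A m
    (Y : 'I_m -> set U) (c : 'I_m -> (V -> U) -> U) (d : 'I_m -> (W -> U) -> U) :
  small K A -> complete_type setT p -> complete_type setT q ->
  injective Y -> (forall i, convex_subgroup (Y i)) ->
  (forall i, affine A (c i) /\ in_cut p (c i) (Y i)) ->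
  (forall i, affine A (d i) /\ in_cut q (d i) (Y i)) ->
  exists x y, [/\ realizes p A x, realizes q A y & forall i, c i x = d i y].
Proof.
move=> sA hp hq injY cY Hc Hd.
have [x Hx] := monster_realizes hM sA hp; have [y Hy] := monster_realizes hM sA hq.
have [f [l [a [Aa Ef]]]|s [Hs sfix sdc]] :=
    @monster_conjugate _ _ hM 'I_m A (fun i => d i y) (fun i => c i x) sA.
  have [t Ht] := comb_decided hU cY injY l a.
  have Ac (V' : finType) (c' : 'I_m -> (V' -> U) -> U) : (forall i, affine A (c' i)) -> affine A (comb c' l a).
    move=> Hc'; apply: affineD; last exact: affine_const.
    by apply: affine_sum => i; apply: affineMz.
  rewrite !Ef -[lin _ _ + a]/(comb d l a y) -[X in _ = sgn X]/(comb c l a x).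
  rewrite (realizes_sgn hU hq Hy (Ac _ _ (fun i => (Hd i).1)) (Ht _ _ _ (fun i => (Hd i).2))).
  by rewrite (realizes_sgn hU hp Hx (Ac _ _ (fun i => (Hc i).1)) (Ht _ _ _ (fun i => (Hc i).2))).
exists x, (s \o y); split => //.
  move=> phi qphi oA; have := Hy phi qphi oA.
  rewrite !psatE -(sat_automorphism (penv y) phi Hs); apply: (sat_ext _).1 => -[w|u] //= Hu.
  by rewrite sfix //; apply: oA.
move=> i; rewrite -sdc; have [[k [a [Aa E]]] _] := Hd i.
have [_ _ sD _ _] := Hs.
by rewrite !E sD (dcl_fixed hU Hs sfix Aa) lin_automorphism.
Qed.

Lemma finite_enum (T : Type) (Y : set T) : finite_set Y ->
  exists m (f : 'I_m -> T), injective f /\ range f = Y.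
Proof.
move=> /(@finite_seqP {classic T})[s Es].
have us : uniq (undup s) by apply: undup_uniq.
have mem t : Y t <-> (t : {classic T}) \in undup s by rewrite mem_undup Es.
exists (size (undup s)), (fun i => tnth (in_tuple (undup s)) i); split.
  exact: (elimT (tuple_uniqP (in_tuple (undup s))) us).
apply/seteqP; split=> [_ [i _ <-]|t].
  by apply/mem; rewrite -[X in _ \in X]/(tval (in_tuple (undup s))); apply: mem_tnth.
by move/mem => Hs; have /tnthP[i ->] : (t : {classic T}) \in in_tuple (undup s) by []; exists i.
Qed.

(** Linking extremal elements over the groups common to p and q requires no inclusion between the
    two sets, so a single r serves both directions. This is why equidominance comes at no extra
    cost. *)
Lemma common_type (p q : global_set U) : Sinv K p -> Sinv K q ->
  exists A r, [/\ @small_type U K p q A r,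
    pcuts q `<=` pcuts p -> forall phi, @formulas U q phi ->
      forced (in_x p `|` r) (fun e => psat (e \o inr) phi) &
    pcuts p `<=` pcuts q -> forall phi, @formulas U p phi ->
      forced (in_y q `|` r) (fun e => psat (e \o inl) phi)].
Proof.
move=> Sp Sq; have hp := Sinv_complete Sp; have hq := Sinv_complete Sq.
have [A1 sA1 ip1] := Sinv_aut hM Sp; have [A2 sA2 iq2] := Sinv_aut hM Sq.
have [A3 [sA3 bp3]] := base_ex sA1 hp ip1; have [A4 [sA4 bq4]] := base_ex sA2 hq iq2.
pose A := (A1 `|` A2) `|` (A3 `|` A4).
have sA : small K A by do ![apply: (small_setU hK)].
have ip : aut_invariant A p by apply: aut_invariant_sub ip1 => a Ha; left; left.
have iq : aut_invariant A q by apply: aut_invariant_sub iq2 => a Ha; left; right.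
have bp : base p A by apply: base_sub bp3 => a Ha; right; left.
have bq : base q A by apply: base_sub bq4 => a Ha; right; right.
have [m [Y [injY EY]]] := finite_enum (finite_setIl (pcuts q) (finite_cuts hM hp)).
have YI i : pcuts p (Y i) /\ pcuts q (Y i).
  have : (cuts p `&` pcuts q) (Y i) by rewrite -EY; exists i.
  by [].
have [|c Hc] := @choice 'I_m _ (fun i c => extremal p A (Y i) c).
  by move=> i; apply: extremal_ex => //; case: (YI i).
have [|d Hd] := @choice 'I_m _ (fun i d => extremal q A (Y i) d).
  by move=> i; apply: extremal_ex => //; case: (YI i).
have [|||x [y [Hx Hy Hcd]]] := @amalgam _ _ p q A m Y c d sA hp hq injY.
- by move=> i; case: (YI i) => -[].
- by move=> i; case: (Hc i).
- by move=> i; case: (Hd i).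
exists A, (type_at A (join x y)); split.
- split => //; first exact: complete_type_at.
    move=> _ [phi [pphi oA] <-]; split.
      by move=> u /=; rewrite free_vars_rename => -[[v|w] //= Hw [<-]]; apply: oA.
    by apply/psat_rename; last exact: Hx pphi oA; case.
  move=> _ [phi [qphi oA] <-]; split.
    by move=> u /=; rewrite free_vars_rename => -[[v|w] //= Hw [<-]]; apply: oA.
  by apply/psat_rename; last exact: Hy qphi oA; case.
- move=> qp phi qphi; have Hy' : realizes q A (join x y \o inr) by [].
  apply: (linked_forced (jx := inl) (p := p) sA hq iq bq Hy') qphi => //.
  move=> G qG; have [i _ Ei] : range Y G by rewrite EY; split => //; apply: qp.
    by exists (c i), (d i); rewrite -Ei; case: (Hc i) => Ac Ic _ _; split.
- move=> pq phi pphi; have Hx' : realizes p A (join x y \o inl) by [].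
  apply: (linked_forced (jx := inr) (p := q) sA hp ip bp Hx') pphi => //.
  move=> G pG; have [i _ Ei] : range Y G by rewrite EY; split => //; apply: pq.
    by exists (d i), (c i); rewrite -Ei; case: (Hd i) => Ad Id _ _; split.
Qed.

Lemma cuts_equidominant (p q : global_set U) : Sinv K p -> Sinv K q ->
  pcuts p = pcuts q -> equidominant K p q.
Proof.
move=> Sp Sq E; have [A [r [sr H1 H2]]] := common_type Sp Sq.
exists A, r; split => // _ [phi Hphi <-].
- apply: forcedW (H1 _ phi Hphi) _ => [|e]; first by rewrite E.
  by apply psat_rename => -[].
- apply: forcedW (H2 _ phi Hphi) _ => [|e]; first by rewrite E.
  by apply psat_rename => -[].
Qed.

Lemma cuts_dominates (p q : global_set U) : Sinv K p -> Sinv K q ->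
  pcuts q `<=` pcuts p -> dominates K p q.
Proof.
move=> Sp Sq E; have [A [r [sr H1 _]]] := common_type Sp Sq.
exists A, r; split => // _ [phi Hphi <-].
by apply: forcedW (H1 E phi Hphi) _ => e; apply psat_rename => -[].
Qed.

End Domination.

(** * Domination implies inclusion of the sets of subgroups *)

Section Converse.
Variables (K : Type) (U : porderZmodType) (hM : monster_DOAG U K).

Let hK : uncountable_strong_limit K. Proof. by case: hM. Qed.
Let hU : DOAG U. Proof. by case: hM. Qed.

Lemma finite_union_params (V : Type) (s : set (formula (V + U))) :
  finite_set s -> finite_set (\bigcup_(phi in s) params phi).
Proof. by move=> fs; apply: bigcup_finite => // phi _; apply: finite_params. Qed.

(** The only obstruction to conjugating z0 to z1 over A and x is a point of the divisible hull of A
    and x between them; n is its denominator. It arises from an affine function that changes sign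
    between z0 and z1. *)
Lemma interpolation (V : finType) (A : set U) (x : V -> U) (z0 z1 : U) :
  small K A -> z0 < z1 ->
  (forall s, automorphism s -> (forall a, A a -> s a = a) ->
    (forall v, s (x v) = x v) -> s z0 = z1 -> False) ->
  exists n f, [/\ (0 < n)%N, affine A f, z0 *+ n <= f x & f x <= z1 *+ n].
Proof.
move=> sA z01 H; apply: contrapT => N.
have [f [k [a [Aa Ef]]]|s [Hs sfix sx]] :=
    @monster_conjugate K U hM (V + unit)%type A (join x (fun=> z0)) (join x (fun=> z1)) sA; last first.
  by apply: (H s Hs sfix) => [v|]; [apply: (sx (inl v))|apply: (sx (inr tt))].
pose g (e : V -> U) := lin (fun v => k (inl v)) e + a.
have Ag : affine A g by exists (fun v => k (inl v)), a.
have E z : f (join x (fun=> z)) = g x + z *~ k (inr tt).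
  rewrite Ef /lin big_sumType /= (big_pred1 tt); last by case.
  by rewrite addrAC.
rewrite !E.
have key (m : nat) (h : (V -> U) -> U) : affine A h -> (0 < m)%N -> sgn (h x + z0 *+ m) = sgn (h x + z1 *+ m).
  case: m => // m Ah _; have z01m : z0 *+ m.+1 < z1 *+ m.+1 by apply: doag_ltMn.
  apply: contrapT => ne; apply: N; exists m.+1, (fun e => - h e); split => //.
  - exact: affineN.
  - rewrite doag_leNgt //; apply/negP => lt; apply: ne.
    by rewrite !sgn_gt0 //; doag hU.
  - rewrite doag_leNgt //; apply/negP => lt; apply: ne.
    by rewrite !sgn_lt0 //; doag hU.
case: (k (inr tt)) => [[|m]|m]; first by rewrite !mulr0z.
- exact: key.
- have := key m.+1 _ (affineN Ag) isT; rewrite !NegzE !mulrNz -!pmulrn.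
  have D z : - g x + z *+ m.+1 = - (g x - z *+ m.+1) by doag hU.
  by rewrite !D !sgnN // => /oppr_inj.
Qed.

Section DominatesCuts.
Variables (p q : global_set U) (A : set U) (r : set (formula (('I_(arity p) + 'I_(arity q)) + U))).
Hypotheses (Sp : Sinv K p) (Sq : Sinv K q) (sr : @small_type U K p q A r).

Let hp := Sinv_complete Sp.
Let hq := Sinv_complete Sq.
Let S := in_x p `|` r.

Let sA : small K A. Proof. by case: sr. Qed.

(** The x-part of a realisation of r realises p over A, hence is conjugate over A to a realisation
    of p over the larger set C; the y-part is carried along. *)
Lemma union_realize C : small K C ->
  exists x y, realizes p C x /\ forall psi, r psi -> psat (join x y) psi.
Proof.
move=> sC; have [_ rc rp rq] := sr.
have sAC : small K (A `|` C) by apply: (small_setU hK).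
have [x Hx] := monster_realizes hM sAC hp.
have [w Hw] := monster_saturated hM sA rc.
have Hx0 : realizes p A (w \o inl).
  move=> phi pphi oA; have rphi : r (rename (sum_map inl id) phi) by apply: rp; exists phi.
  by have := Hw _ rphi; apply psat_rename => -[].
have HxA : realizes p A x by apply: realizes_sub Hx => a; left.
have [s [Hs sfix sx]] := realizes_conjugate hM sA hp Hx0 HxA.
exists x, (s \o w \o inr); split; first by apply: realizes_sub Hx => a; right.
move=> psi rpsi; have := Hw psi rpsi; have [rA _ _] := rc.
rewrite !psatE -(sat_automorphism (penv w) psi Hs); apply: (sat_ext _).1 => -[[v|v]|u] Hu //.
  exact: (sx v).
by rewrite /= sfix //; apply: (rA _ rpsi).
Qed.

Lemma union_forced Q : forced S Q -> exists2 F : set U, finite_set F &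
  forall x y, realizes p F x -> (forall psi, r psi -> psat (join x y) psi) ->
  Q (join x y).
Proof.
move=> [s [fs sS HQ]].
exists (\bigcup_(phi in s) params phi); first exact: finite_union_params.
move=> x y Hx Hr; apply: HQ => phi sphi; have [[psi ppsi Epsi]|/Hr//] := sS _ sphi.
rewrite -Epsi; apply/psat_rename; last apply: (Hx psi ppsi); first by case.
move=> u Hu; exists phi => //; rewrite -Epsi /params /= free_vars_rename.
by exists (inr u).
Qed.

Lemma union_consistent Q : forced S Q -> exists e, Q e.
Proof.
move=> /union_forced[F fF HF].
have [x [y [Hx Hr]]] := union_realize (small_finite hK fF).
by exists (join x y); apply: HF.
Qed.

Hypothesis dom : forall phi, in_y q phi -> entails S phi.

Lemma dom_forced Q : forced q Q -> forced S (fun e => Q (e \o inr)).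
Proof.
move=> [s [fs sq HQ]].
have H phi : s phi -> forced S (fun e => psat (e \o inr) phi).
  move=> /sq qphi; have H : in_y q (rename (sum_map inr id) phi) by exists phi.
  have {}H : forced S (fun e => psat e (rename (sum_map inr id) phi)) by exact: dom.
  by apply: forcedW H _ => e; apply psat_rename => -[].
apply: forcedW (forced_finite fs H) _ => e He.
by apply: HQ => phi /He.
Qed.

(** Let z in U have the type over B of the element d of q above H. Suppose that B controls H from
    below, so z is outside H. Then p and r force d < z, and interpolation gives a form f' in x and
    an n with n d <= f' <= n z. So f' lies above H; not being in the cut of H, it exceeds some w
    outside H. But no point of [dcl B] lies in [w, n z], and invariance of p forbids w < f' <= n z.
    The other side is symmetric. *)
Lemma dominates_cuts_sub : pcuts q `<=` pcuts p.
Proof.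
move=> H [cH [d [k [b0 [_ Ed]]] Hd]]; apply: contrapT => nH.
have [A1 sA1 ip1] := Sinv_aut hM Sp; have [A2 sA2 iq2] := Sinv_aut hM Sq.
pose B := (A `|` [set b0]) `|` (A1 `|` A2).
have sB : small K B.
  apply: (small_setU hK); apply: (small_setU hK) => //.
  by apply: (small_finite hK); apply: finite_set1.
have AB : A `<=` B by move=> a Ha; left; left.
have ip : aut_invariant B p by apply: aut_invariant_sub ip1 => a Ha; right; left.
have iq : aut_invariant B q by apply: aut_invariant_sub iq2 => a Ha; right; right.
have Bb0 : dcl B b0 by apply: dcl_mem; left; right.
have Bd : affine B d by exists k, b0.
have Sd : in_cut S (fun e => d (e \o inr)) H.
  split=> [h Hh|u u0 nHu]; first exact: dom_forced (Hd.1 h Hh).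
  exact: dom_forced (Hd.2 u u0 nHu).
have [y1 Hy1] := monster_realizes hM sB hq; pose z := d y1.
have z0 : 0 < z.
  exact: (realizes_lt hM hq Hy1 (affine_const _ (dcl0 B)) Bd (in_cut_gt0 cH Hd)).
have zlow a : dcl B a -> H a -> a < z.
  by move=> Ba Ha; apply: (realizes_lt hM hq Hy1 (affine_const _ Ba) Bd (Hd.1 a Ha)).
have zup a : dcl B a -> 0 < a -> ~ H a -> z < a.
  by move=> Ba a0 nHa; apply: (realizes_lt hM hq Hy1 Bd (affine_const _ Ba) (Hd.2 a a0 nHa)).
have Saff f : affine A f -> affine A (fun e : 'I_(arity p) + 'I_(arity q) -> U => f (e \o inl)).
  exact: affine_comp.
have [_ rc _ _] := sr; have [rA rcons rdec] := rc.
have rle f g x y : affine A f -> affine A g -> (forall psi, r psi -> psat (join x y) psi) ->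
    f (join x y) <= g (join x y) -> forced S (fun e => f e <= g e).
  move=> Af Ag Hr fg; have [c Hc] := affine_decided hU rc (affineB Ag Af).
  have [phi [oA Hphi]] := affine_sgn_formula hU c (affineB Ag Af).
  have rphi : r phi by apply/(complete_forced rc oA); apply: forcedW Hc _ => e /Hphi.
  have /Hphi E := Hr _ rphi.
  apply: forced_sub (_ : r `<=` S) _; first by move=> psi; right.
  apply: forcedW Hc _ => e; rewrite -E doag_leNgt // => E'; apply/negP => gf.
  have : sgn (g e - f e) = -1 by apply: sgn_lt0; doag hU.
  by rewrite E' => /(sgn_eqN1 hU) ?; doag hU.
have posn (x : U) n : 0 < x -> (0 < n)%N -> x <= x *+ n.
  case: n => // n x0 _; rewrite mulrS; case: n => [|n]; first by rewrite mulr0n addr0.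
  by have := doag_mulrn_gt0 hU x0 (ltn0Sn n) => ?; doag hU.
have notcut f : affine B f -> ~ in_cut p f H.
  by move=> Bf Hf; apply: nH; split => //; exists f => //; apply: affine_sub Bf.
have absurd u v (f : ('I_(arity p) -> U) -> U) : affine B f -> u < v ->
    (forall a, dcl B a -> u <= a -> a <= v -> False) ->
    (forced p (fun e => u < f e) -> forced p (fun e => f e <= v) -> False) /\
    (forced p (fun e => u <= f e) -> forced p (fun e => f e < v) -> False).
  move=> [k' [a' [Ba' Ef]]] uv Nuv; have [_ pc _] := hp.
  have [s [Hs sfix su]] := dcl_between hM sB uv Nuv.
  have sa' := dcl_fixed hU Hs sfix Ba'.
  have [s' Hs' [sK s'K]] := automorphism_inv Hs.
  have sfix' a : B a -> s' a = a by move=> Ba; rewrite -{1}(sfix a) // sK.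
  have sa'' := dcl_fixed hU Hs' sfix' Ba'.
  split=> H1 H2.
  - have H1' : forced p (fun e => u < lin k' e + a') by apply: forcedW H1 _ => e; rewrite Ef.
    have {}H1' := (aut_invariant_lt hM k' u ip Hs sfix sa').1 H1'.
    have [e [E1 E2]] := forced_ex pc (forcedI H1' H2).
    by move: E2; rewrite Ef su in E1 *; move=> E2; doag hU.
  - have H2' : forced p (fun e => lin k' e + a' < v) by apply: forcedW H2 _ => e; rewrite Ef.
    have {}H2' := (aut_invariant_lt hM k' v ip Hs' sfix' sa'').2 H2'.
    rewrite -su sK in H2'.
    have [e [E1 E2]] := forced_ex pc (forcedI H1 H2').
    by move: E1; rewrite Ef => E1; doag hU.
have [low|up] := in_cut_side hM hq sB iq Bd cH Hd.
- have nHz : ~ H z.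
    by move=> Hz; have [a [Ba Ha za]] := low z Hz; have := zlow a Ba Ha => ?; doag hU.
  have [F fF HF] := union_forced (Sd.2 z z0 nHz).
  have sC : small K (B `|` [set z] `|` F).
    by apply: (small_setU hK); [apply: (small_setU hK) => //; apply: (small_finite hK); apply: finite_set1|apply: small_finite].
  have [x [y [Hx Hr]]] := union_realize sC.
  have HxF : realizes p F x by apply: realizes_sub Hx => a; right.
  have Hxz : realizes p (B `|` [set z]) x by apply: realizes_sub Hx => a; left.
  have yz := HF x y HxF Hr; rewrite -[join x y \o inr]/y in yz.
  have lyz : lin k y < z - b0 by move: yz; rewrite Ed => ?; doag hU.
  (* If an automorphism over A and x moved lin k y to z - b0, the moved y would still satisfy r with
     x, yet violate d < z, which is already forced over F. *)
  have [s Hs sfix sx sy|n [f [n0 Af f1 f2]]] := interpolation (x := x) sA lyz.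
    have Hr' psi : r psi -> psat (join x (s \o y)) psi.
      move=> rpsi; have := Hr psi rpsi.
      rewrite !psatE -(sat_automorphism (penv (join x y)) psi Hs).
      apply: (sat_ext _).1 => -[[v|v]|u] Hu //=.
      by rewrite sfix //; apply: (rA _ rpsi).
    have := HF x (s \o y) HxF Hr'; rewrite -[join _ _ \o inr]/(s \o y) Ed.
    by rewrite -lin_automorphism // sy => ?; doag hU.
  (* Interpolation was applied over A to the linear part of d; adding n b0 restores d and enlarges
     the parameters from A to B. *)
  pose f' e := f e + b0 *+ n.
  have Bf' : affine B f'.
    by apply: affineD; [apply: affine_sub Af|apply: affine_const; apply: dclMn].
  have pf' : forced p (fun e => f' e <= z *+ n).
    apply: (realizes_forced_le hM hp Hxz (g := fun=> z *+ n)).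
    + by apply: affine_sub Bf' => a; left.
    + by apply: affine_const; apply: dclMn; apply: dcl_mem; right.
    + by rewrite /f'; move: f2; rewrite mulrnBl => ?; doag hU.
  have Sf' : forced S (fun e => d (e \o inr) *+ n <= f' (e \o inl)).
    have Al : affine A (fun e : 'I_(arity p) + 'I_(arity q) -> U => lin k (e \o inr) *+ n).
      by apply: affineMn; apply: affine_comp; apply: affine_lin.
    apply: forcedW (rle _ _ x y Al (Saff f Af) Hr f1) _ => e.
    by rewrite Ed /f' mulrnDl => ?; doag hU.
  have lowf h : H h -> forced p (fun e => h < f' e).
    move=> Hh; apply: contrapT => /(forced_lt_total hM hp) N.
    have {}N : forced p (fun e => f' e <= h).
      by apply: N; [exact: affineT_const|apply: affine_sub Bf'].
    have SN : forced S (fun e => f' (e \o inl) <= h).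
      by apply: forced_sub (forced_rename inl N) => psi; left.
    have [e [[E1 E2] [E3 E4]]] := union_consistent (forcedI (forcedI Sf' SN) (forcedI (Sd.1 h Hh) (in_cut_gt0 cH Sd))).
    by have := posn _ _ E4 n0 => ?; doag hU.
  have [u [u0 nHu Hu]] : exists u, [/\ 0 < u, ~ H u & forced p (fun e => u <= f' e)].
    apply: contrapT => N; apply: (notcut f') => //; split=> // u u0 nHu.
    apply: contrapT => nf; apply: N; exists u; split => //.
    by apply: (forced_lt_total hM hp) nf; [apply: affine_sub Bf'|exact: affineT_const].
  (* Here w = u / 2, since [doag_div_gt0] divides by the successor; it turns u <= f' into the strict
     w < f'. *)
  have [w w0 Ew] := doag_div_gt0 hU 1 u0.
  have nHw : ~ H w by apply: (convex_divn (n := 2)) => //; rewrite Ew.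
  have Hw : forced p (fun e => w < f' e).
    by apply: forcedW Hu _ => e; rewrite -Ew mulr2n => ?; doag hU.
  have [_ pc _] := hp; have [e0 [w1 w2]] := forced_ex pc (forcedI Hw pf').
  have wz : w < z *+ n by doag hU.
  have [|+ _] := absurd w (z *+ n) f' Bf' wz; last by apply.
  move=> a Ba wa az; have a0 : 0 < a by doag hU.
  have nHa : ~ H a.
    by move=> Ha; apply: nHw; have [H0 _ _ Hc] := cH; apply: (Hc 0 w a) => //; apply: ltW.
  (* For a point a of the interval, a / n is still in [dcl B] and outside H, so z < a / n, against a
     <= n z. *)
  have En : n = n.-1.+1 by rewrite prednK.
  have [a' a'0 Ea'] := doag_div_gt0 hU n.-1 a0.
  have Ba' : dcl B a' by apply: (@dcl_divn _ _ _ n.-1.+1) => //; rewrite Ea'.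
  have nHa' : ~ H a' by apply: (convex_divn (n := n.-1.+1)) => //; rewrite Ea'.
  by rewrite En in az; have := doag_ltMn hU n.-1 (zup a' Ba' a'0 nHa'); rewrite Ea' => ?; doag hU.
have Hz : H z.
  apply: contrapT => nHz; have [a [Ba a0 nHa az]] := up z z0 nHz.
  by have := zup a Ba a0 nHa => ?; doag hU.
have [F fF HF] := union_forced (Sd.1 z Hz).
have sC : small K (B `|` [set z] `|` F).
  by apply: (small_setU hK); [apply: (small_setU hK) => //; apply: (small_finite hK); apply: finite_set1|apply: small_finite].
have [x [y [Hx Hr]]] := union_realize sC.
have HxF : realizes p F x by apply: realizes_sub Hx => a; right.
have Hxz : realizes p (B `|` [set z]) x by apply: realizes_sub Hx => a; left.
have yz := HF x y HxF Hr; rewrite -[join x y \o inr]/y in yz.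
have lyz : z - b0 < lin k y by move: yz; rewrite Ed => ?; doag hU.
have [s0 Hs0 s0fix s0x s0y|n [f [n0 Af f1 f2]]] := interpolation (x := x) sA lyz.
  (* Interpolation moves the lower point to the upper one; here the upper point is lin k y, so the
     inverse is applied. *)
  have [s Hs [sK s'K]] := automorphism_inv Hs0.
  have sfix a : A a -> s a = a by move=> Aa; rewrite -{1}(s0fix a) // sK.
  have sx v : s (x v) = x v by rewrite -{1}(s0x v) sK.
  have sy : s (lin k y) = z - b0 by rewrite -s0y sK.
  have Hr' psi : r psi -> psat (join x (s \o y)) psi.
    move=> rpsi; have := Hr psi rpsi.
    rewrite !psatE -(sat_automorphism (penv (join x y)) psi Hs).
    apply: (sat_ext _).1 => -[[v|v]|u] Hu //=.
    by rewrite sfix //; apply: (rA _ rpsi).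
  have := HF x (s \o y) HxF Hr'; rewrite -[join _ _ \o inr]/(s \o y) Ed.
  by rewrite -lin_automorphism // sy => ?; doag hU.
pose f' e := f e + b0 *+ n.
have Bf' : affine B f'.
  by apply: affineD; [apply: affine_sub Af|apply: affine_const; apply: dclMn].
have pf' : forced p (fun e => z *+ n <= f' e).
  apply: (realizes_forced_le hM hp Hxz (f := fun=> z *+ n)).
  + by apply: affine_const; apply: dclMn; apply: dcl_mem; right.
  + by apply: affine_sub Bf' => a; left.
  + by rewrite /f'; move: f1; rewrite mulrnBl => ?; doag hU.
have Sf' : forced S (fun e => f' (e \o inl) <= d (e \o inr) *+ n).
  have Al : affine A (fun e : 'I_(arity p) + 'I_(arity q) -> U => lin k (e \o inr) *+ n).
    by apply: affineMn; apply: affine_comp; apply: affine_lin.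
  apply: forcedW (rle _ _ x y (Saff f Af) Al Hr f2) _ => e.
  by rewrite Ed /f' mulrnDl => ?; doag hU.
have upf u : 0 < u -> ~ H u -> forced p (fun e => f' e < u).
  move=> u0 nHu; apply: contrapT => /(forced_lt_total hM hp) N.
  have {}N : forced p (fun e => u <= f' e).
    by apply: N; [apply: affine_sub Bf'|exact: affineT_const].
  have SN : forced S (fun e => u <= f' (e \o inl)).
    by apply: forced_sub (forced_rename inl N) => psi; left.
  have [e [[E1 E2] [E3 E4]]] := union_consistent (forcedI (forcedI Sf' SN) (const_below hU cH Sd nHu u0 n)).
  by doag hU.
have [h [Hh Hfh]] : exists h, H h /\ forced p (fun e => f' e <= h).
  apply: contrapT => N; apply: (notcut f') => //; split=> // h Hh.
  apply: contrapT => nf; apply: N; exists h; split => //.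
  by apply: (forced_lt_total hM hp) nf; [exact: affineT_const|apply: affine_sub Bf'].
have [_ pc _] := hp; have [e0 [w1 w2]] := forced_ex pc (forcedI pf' Hfh).
have zn := posn _ _ z0 n0.
have h0 : 0 < h by doag hU.
have Hhh : H (h + h) by case: cH => _ + _ _; apply.
(* Doubling h makes the bound f' <= h strict and stays inside H. *)
have wz : z *+ n < h + h by doag hU.
have [|_ +] := absurd (z *+ n) (h + h) f' Bf' wz; last first.
  by apply => //; apply: forcedW Hfh _ => e ?; doag hU.
move=> a Ba wa az; have Ha : H a.
  by have [H0 _ _ Hc] := cH; apply: (Hc 0 a (h + h)) => //; doag hU.
by have := zlow a Ba Ha => ?; doag hU.
Qed.

End DominatesCuts.
End Converse.

(** * Weak orthogonality and disjointness *)

Section Orthogonality.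
Variables (K : Type) (U : porderZmodType) (hM : monster_DOAG U K).

Let hK : uncountable_strong_limit K. Proof. by case: hM. Qed.
Let hU : DOAG U. Proof. by case: hM. Qed.

Lemma forced_decides (V : finType) (S : set (formula (V + U))) :
  (forall Q, forced S Q -> exists e, Q e) ->
  (forall f, affine setT f -> exists c, forced S (fun e => sgn (f e) = c)) ->
  forall phi, forced S (fun e => psat e phi) \/ forced S (fun e => ~ psat e phi).
Proof.
move=> cS H phi.
have [|c Hc] := @choice (term (V + U)) int (fun t c =>
    forced S (fun e => sgn (eval (penv e) t) = c)).
  by move=> t; apply: H; apply: affine_term.
have HT := @forced_lmem _ _ S _ (terms phi) _ (fun t _ => Hc t).
have [e0 He0] := cS _ HT.
have E e : (forall t, lmem (terms phi) t -> sgn (eval (penv e) t) = c t) ->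
    psat e phi <-> psat e0 phi.
  move=> He; rewrite !psatE; apply: sat_agree => // t Ht.
  by rewrite He // He0.
have [e0phi|ne0phi] := pselect (psat e0 phi); [left|right];
  by apply: forcedW HT _ => e /E ->.
Qed.

Section Pair.
Variables (p q : global_set U).
Hypotheses (Sp : Sinv K p) (Sq : Sinv K q).
Let S : set (formula (('I_(arity p) + 'I_(arity q)) + U)) := in_x p `|` in_y q.
Let hp := Sinv_complete Sp.
Let hq := Sinv_complete Sq.

Lemma pair_forced Q : forced S Q -> exists2 F : set U, finite_set F &
  forall x y, realizes p F x -> realizes q F y -> Q (join x y).
Proof.
move=> [s [fs sS HQ]].
exists (\bigcup_(phi in s) params phi); first exact: finite_union_params.
move=> x y Hx Hy; apply: HQ => phi sphi.
have [[psi ppsi Epsi]|[psi qpsi Epsi]] := sS _ sphi; rewrite -Epsi.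
- apply/psat_rename; last apply: (Hx psi ppsi); first by case.
  move=> u Hu; exists phi => //; rewrite -Epsi /params /= free_vars_rename.
  by exists (inr u).
- apply/psat_rename; last apply: (Hy psi qpsi); first by case.
  move=> u Hu; exists phi => //; rewrite -Epsi /params /= free_vars_rename.
  by exists (inr u).
Qed.

Lemma pair_consistent Q : forced S Q -> exists e, Q e.
Proof.
move=> /pair_forced[F fF HF]; have sF := small_finite hK fF.
have [x Hx] := monster_realizes hM sF hp; have [y Hy] := monster_realizes hM sF hq.
by exists (join x y); apply: HF.
Qed.

Let Sx Q : forced p Q -> forced S (fun e => Q (e \o inl)).
Proof. by move=> H; apply: forced_sub (forced_rename inl H) => phi; left. Qed.

Let Sy Q : forced q Q -> forced S (fun e => Q (e \o inr)).
Proof. by move=> H; apply: forced_sub (forced_rename inr H) => phi; right. Qed.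

Lemma disjoint_orthogonal : pcuts p `&` pcuts q = set0 -> weakly_orthogonal p q.
Proof.
move=> disj; have [A1 sA1 ip] := Sinv_aut hM Sp; have [A2 sA2 iq] := Sinv_aut hM Sq.
have subx : rename (sum_map inl id) @` p `<=` S by move=> phi; left.
have suby : rename (sum_map inr id) @` q `<=` S by move=> phi; right.
have aff (V : finType) (k : V -> int) (u : U) s : affine setT (fun e => (lin k e - u) *~ s).
  by apply: affineMz; apply: affineB; [exact: affine_lin|exact: affineT_const].
have D phi : forced S (fun e => psat e phi) \/ forced S (fun e => ~ psat e phi).
  apply: forced_decides; first exact: pair_consistent.
  move=> f [k [a [_ Ef]]].
  pose k1 v := k (inl v); pose k2 v := k (inr v).
  have {}Ef e : f e = lin k1 (e \o inl) + lin k2 (e \o inr) + a by rewrite Ef /lin big_sumType.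
  have [[u1 D1]|[u1 [s1 [H1 [Hs1 cH1 C1]]]]] := lin_cut hM hp k1 sA1 ip;
  have [[u2 D2]|[u2 [s2 [H2 [Hs2 cH2 C2]]]]] := lin_cut hM hq k2 sA2 iq.
  - exists (sgn (u1 + u2 + a)); apply: forced2 (Sx D1) (Sy D2) _ => e E1 E2.
    by rewrite Ef E1 E2.
  - have [c Hc] := comb1_decided hU s2 (u1 + u2 + a) cH2; exists c.
    apply: forced2 (Sx D1) (Hc _ _ _ (in_cut_rename suby C2)) _ => e E1 <-.
    by rewrite sgn1_mulz // Ef E1; congr sgn; doag hU.
  - have [c Hc] := comb1_decided hU s1 (u1 + u2 + a) cH1; exists c.
    apply: forced2 (Sy D2) (Hc _ _ _ (in_cut_rename subx C1)) _ => e E1 <-.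
    by rewrite sgn1_mulz // Ef E1; congr sgn; doag hU.
  - have nE : H1 <> H2.
      move=> E; have : (pcuts p `&` pcuts q) H1.
        split; first by split => //; exists (fun e => (lin k1 e - u1) *~ s1).
        by rewrite E; split => //; exists (fun e => (lin k2 e - u2) *~ s2).
      by rewrite disj.
    have [c Hc] := comb2_decided hU cH1 cH2 nE s1 s2 (u1 + u2 + a)
      (in_cut_rename subx C1) (in_cut_rename suby C2).
    exists c; apply: forcedW Hc _ => e <-.
    by rewrite !sgn1_mulz // Ef; congr sgn; doag hU.
exists [set phi | entails S phi]; split; last by [].
split=> //.
- move=> s fs sS; have [e He] := pair_consistent (forced_finite fs sS).
  by exists e.
- by move=> phi _; apply: D.
Qed.

(** With a common group H, the sign of c(x) - d(y) would be decided over a small B. But H is closed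
    under doubling, so c(x) and 2 d(y) have the same type over B, and so do d(y) and 2 c(x). Moving
    y to get d = 2 c(x), or x to get c = 2 d(y), produces both signs. *)
Lemma orthogonal_disjoint : weakly_orthogonal p q -> pcuts p `&` pcuts q = set0.
Proof.
move=> [t [ht tS]]; apply/seteqP; split=> // H [[cH [c [k1 [a1 [_ Ec]]] Hc]] [_ [d [k2 [a2 [_ Ed]]] Hd]]].
pose f (e : 'I_(arity p) + 'I_(arity q) -> U) := c (e \o inl) - d (e \o inr).
have Ac' : affine setT c by exists k1, a1; split => //; apply: dcl_mem.
have Ad' : affine setT d by exists k2, a2; split => //; apply: dcl_mem.
have Af : affine setT f by apply: affineB; apply: affine_comp.
have [s Hs] := affine_decided hU ht Af.
have {}Hs : forced S (fun e => sgn (f e) = s).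
  have [s0 [fs0 s0t HQ]] := Hs.
  apply: forcedW (forced_finite (Q := fun phi e => psat e phi) fs0 _) HQ => phi /s0t.
  exact: tS.
have [F fF HF] := pair_forced Hs.
pose B := F `|` [set a1; a2].
have sB : small K B.
  by apply: (small_setU hK); apply: (small_finite hK) => //; apply: finite_set2.
have Bc : affine B c by exists k1, a1; split => //; apply: dcl_mem; right; left.
have Bd : affine B d by exists k2, a2; split => //; apply: dcl_mem; right; right.
have [x Hx] := monster_realizes hM sB hp; have [y Hy] := monster_realizes hM sB hq.
have FB : F `<=` B by move=> u; left.
have move_to (V : finType) (r : set (formula (V + U))) g z z' : complete_type setT r ->
    realizes r B z -> affine B g -> (forall a, dcl B a -> sgn (g z - a) = sgn (z' - a)) ->
    exists2 w, realizes r B w & g w = z'.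
  move=> hr Hz [k [a [Ba Eg]]] E; have [s' [Hs' sfix sz]] := monster_conjugate1 hM sB E.
  exists (s' \o z).
    move=> phi rphi oB; have := Hz _ rphi oB.
    rewrite !psatE -(sat_automorphism (penv z) phi Hs'); apply: (sat_ext _).1 => -[v|u] Hu //=.
    by rewrite sfix //; apply: oB.
  have [_ _ sD _ _] := Hs'.
  by rewrite -sz !Eg sD (dcl_fixed hU Hs' sfix Ba) lin_automorphism.
have same (V W : finType) (r : set (formula (V + U))) (r' : set (formula (W + U))) g g' z z' :
    complete_type setT r -> complete_type setT r' -> realizes r B z -> realizes r' B z' ->
    affine B g -> affine B g' -> in_cut r g H -> in_cut r' g' H ->
    forall a, dcl B a -> sgn (g z - a) = sgn (g' z' *+ 2 - a).
  move=> hr hr' Hz Hz' Bg Bg' Ig Ig' a Ba.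
  have g0 := realizes_lt hM hr Hz (affine_const V (dcl0 B)) Bg (in_cut_gt0 cH Ig).
  have g0' := realizes_lt hM hr' Hz' (affine_const W (dcl0 B)) Bg' (in_cut_gt0 cH Ig').
  have [Ha|nHa] := pselect (H a).
    have l1 := realizes_lt hM hr Hz (affine_const V Ba) Bg (Ig.1 a Ha).
    have l2 := realizes_lt hM hr' Hz' (affine_const W Ba) Bg' (Ig'.1 a Ha).
    by rewrite !sgn_gt0 // ?mulr2n; doag hU.
  have [a0|a0|a0] := doag_ltgt hU 0 a.
  - have l1 := realizes_lt hM hr Hz Bg (affine_const V Ba) (Ig.2 a a0 nHa).
    have l2 : g' z' *+ 2 < a.
      apply: (realizes_lt hM hr' Hz' (affineMn 2 Bg') (affine_const W Ba)).
      by apply: forcedW (const_below hU cH Ig' nHa a0 2%N) _ => e [].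
    by rewrite !sgn_lt0 //; doag hU.
  - by case: nHa; rewrite -a0; case: cH.
  - by rewrite !sgn_gt0 // ?mulr2n; doag hU.
have x0 := realizes_lt hM hp Hx (affine_const _ (dcl0 B)) Bc (in_cut_gt0 cH Hc).
have y0 := realizes_lt hM hq Hy (affine_const _ (dcl0 B)) Bd (in_cut_gt0 cH Hd).
have [y' Hy' Ey'] := move_to _ _ _ _ _ hq Hy Bd (same _ _ _ _ _ _ _ _ hq hp Hy Hx Bd Bc Hd Hc).
have [x' Hx' Ex'] := move_to _ _ _ _ _ hp Hx Bc (same _ _ _ _ _ _ _ _ hp hq Hx Hy Bc Bd Hc Hd).
have E1 := HF x y' (realizes_sub FB Hx) (realizes_sub FB Hy').
have E2 := HF x' y (realizes_sub FB Hx') (realizes_sub FB Hy).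
have : sgn (c x - d y') = sgn (c x' - d y) by rewrite [LHS]E1 [RHS]E2.
by rewrite Ey' Ex' sgn_lt0 ?sgn_gt0 // ?mulr2n; doag hU.
Qed.

End Pair.
End Orthogonality.

(** * The types of the cuts *)

Section CutType.
Variables (K : Type) (U : porderZmodType) (hM : monster_DOAG U K).

Let hK : uncountable_strong_limit K. Proof. by case: hM. Qed.
Let hU : DOAG U. Proof. by case: hM. Qed.

Section OneSubgroup.
Variable H : set U.
Hypothesis cH : convex_subgroup H.

(* [Q] holds on an interval of U around the cut; lists of endpoints allow the
   interval to be unbounded, as it must be when [H] is all of U. *)
Definition near_cut (Q : U -> Prop) : Prop := exists l1 l2 : seq U,
  [/\ forall h, h \in l1 -> H h, forall u, u \in l2 -> 0 < u /\ ~ H u &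
    forall z, (forall h, h \in l1 -> h < z) -> (forall u, u \in l2 -> z < u) -> Q z].

Lemma near_cutI (Q Q' : U -> Prop) :
  near_cut Q -> near_cut Q' -> near_cut (fun z => Q z /\ Q' z).
Proof.
move=> [l1 [l2 [H1 H2 HQ]]] [l1' [l2' [H1' H2' HQ']]].
exists (l1 ++ l1'), (l2 ++ l2'); split.
- by move=> h; rewrite mem_cat => /orP[/H1|/H1'].
- by move=> u; rewrite mem_cat => /orP[/H2|/H2'].
- by move=> z Hz1 Hz2; split; [apply: HQ|apply: HQ'] => u Hu;
    (apply: Hz1 || apply: Hz2); rewrite mem_cat Hu ?orbT.
Qed.

Lemma near_cutW (Q Q' : U -> Prop) :
  near_cut Q -> (forall z, Q z -> Q' z) -> near_cut Q'.
Proof.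
by move=> [l1 [l2 [H1 H2 HQ]]] QQ; exists l1, l2; split => // z Hz1 Hz2; apply/QQ/HQ.
Qed.

Lemma near_cutT (Q : U -> Prop) : (forall z, Q z) -> near_cut Q.
Proof. by move=> HQ; exists [::], [::]. Qed.

Lemma near_cut_ex (Q : U -> Prop) : near_cut Q -> exists z, Q z.
Proof.
move=> [l1 [l2 [H1 H2 HQ]]].
have [x y /H1 Hx /H2[y0 nHy]|z [Hz1 Hz2]] := @doag_between U hU l1 l2.
  exact: convex_lt cH Hx y0 nHy.
by exists z; apply: HQ.
Qed.

Lemma near_cut_lmem (T : Type) (s : seq T) (Q : T -> U -> Prop) :
  (forall t, lmem s t -> near_cut (Q t)) ->
  near_cut (fun z => forall t, lmem s t -> Q t z).
Proof.
elim: s => [|t s IH] Hs; first exact: near_cutT.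
apply: near_cutW (near_cutI (Hs t _) (IH _)) _ => [|t' Ht'|z [Qt Qs] t' [<-//|]].
- by left.
- by apply: Hs; right.
- exact: Qs.
Qed.

Lemma near_cut_gt h : H h -> near_cut (fun z => h < z).
Proof.
move=> Hh; exists [:: h], [::]; split => // [h'|z Hz _]; first by rewrite inE => /eqP->.
by apply: Hz; rewrite inE.
Qed.

Lemma near_cut_lt u : 0 < u -> ~ H u -> near_cut (fun z => z < u).
Proof.
move=> u0 nHu; exists [::], [:: u]; split => // [u'|z _ Hz]; first by rewrite inE => /eqP->.
by apply: Hz; rewrite inE.
Qed.

Lemma near_cut_sgn (k : int) (w : U) :
  exists c : int, near_cut (fun z => sgn (z *~ k + w) = c).
Proof.
have [->|k0] := eqVneq k 0.
  by exists (sgn w); apply: near_cutT => z; rewrite mulr0z add0r.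
have [rho Erho] := doag_divz hU (- w) k0.
have E z : sgn (z *~ k + w) = sgn (z - rho) * sgz k.
  by rewrite -sgnMz // mulrzBl Erho opprK.
have [Hrho|nHrho] := pselect (H rho).
  exists (1 * sgz k); apply: near_cutW (near_cut_gt Hrho) _ => z rz.
  by rewrite E sgn_gt0 // doag_subr_gt0.
have [r0|r0|r0] := doag_ltgt hU 0 rho.
- exists (- 1 * sgz k); apply: near_cutW (near_cut_lt r0 nHrho) _ => z zr.
  by rewrite E sgn_lt0 //; doag hU.
- by case: nHrho; rewrite -r0; case: cH.
- have H0 : H 0 by case: cH.
  exists (1 * sgz k); apply: near_cutW (near_cut_gt H0) _ => z z0.
  by rewrite E sgn_gt0 //; doag hU.
Qed.

Definition cut_type : global_set U := @GlobalSet U 1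
  [set phi | near_cut (fun z => psat (fun=> z) phi)].

Lemma near_cut_affine (f : ('I_1 -> U) -> U) : affine setT f ->
  exists c : int, near_cut (fun z => sgn (f (fun=> z)) = c).
Proof.
move=> [k [a [_ Ef]]]; have [c Hc] := near_cut_sgn (k ord0) a; exists c.
by apply: near_cutW Hc _ => z <-; rewrite Ef /lin big_ord1.
Qed.

(** The sign of each term is constant near the cut, by [near_cut_sgn], and finitely many signs
    decide a formula; consistency holds because finitely many conditions near the cut have a common
    point in U. *)
Lemma cut_type_complete : complete_type setT cut_type.
Proof.
split=> //.
- move=> s fs sp; have [l El] := finite_lmem fs.
  have := @near_cut_lmem _ l (fun phi z => psat (fun=> z) phi) => X.
  have [|z Hz] := near_cut_ex (X _); first by move=> phi /El/sp.
  by exists (fun=> z) => phi /El; apply: Hz.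
- move=> phi _.
  have [|c Hc] := @choice (term ('I_1 + U)) int (fun t c =>
      near_cut (fun z => sgn (eval (penv (fun=> z)) t) = c)).
    by move=> t; apply: (near_cut_affine (f := fun e => eval (penv e) t)); apply: affine_term.
  have HT := @near_cut_lmem _ (terms phi) _ (fun t _ => Hc t).
  have [z0 Hz0] := near_cut_ex HT.
  have E z : (forall t, lmem (terms phi) t -> sgn (eval (penv (fun=> z)) t) = c t) ->
      psat (fun=> z : U) phi <-> psat (fun=> z0) phi.
    by move=> Hz; rewrite !psatE; apply: sat_agree => // t Ht; rewrite Hz // Hz0.
  have [P0|nP0] := pselect (psat (fun=> z0) phi); [left|right].
  + by apply: near_cutW HT _ => z /E->.
  + by apply: near_cutW HT _ => z /E E' /E'.
Qed.

Lemma cut_type_forced (f : ('I_1 -> U) -> U) c : affine setT f ->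
  near_cut (fun z => sgn (f (fun=> z)) = c) ->
  forced cut_type (fun e => sgn (f e) = c).
Proof.
move=> Af Hc; have [phi [_ Hphi]] := affine_sgn_formula hU c Af.
have Hp : @formulas U cut_type phi by apply: near_cutW Hc _ => z /Hphi.
by apply: forcedW (forced_in Hp) _ => e /Hphi.
Qed.

Lemma cut_type_aut A :
  (forall s, automorphism s -> (forall a, A a -> s a = a) -> s @` H = H) ->
  aut_invariant A cut_type.
Proof.
move=> HA s Hs sA phi [l1 [l2 [H1 H2 HQ]]].
have [s' Hs' [sK s'K]] := automorphism_inv Hs.
have [_ s0 _ _ slt] := Hs; have sH := HA s Hs sA.
exists (map s l1), (map s l2); split.
- by move=> _ /mapP[h /H1 Hh ->]; rewrite -sH; exists h.
- move=> _ /mapP[u /H2[u0 nHu] ->]; split; first by rewrite -s0 slt.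
  by rewrite -{1}sH => -[h Hh /(can_inj sK) E]; apply: nHu; rewrite -E.
- move=> z Hz1 Hz2; have Hz : psat (fun=> s' z) phi.
    apply: HQ => [h Hh|u Hu]; rewrite -slt s'K.
      by apply: Hz1; apply: map_f.
    by apply: Hz2; apply: map_f.
  move: Hz; rewrite !psatE sat_rename -(sat_automorphism (penv (fun=> s' z)) phi Hs).
  by apply: (sat_ext _).1 => -[v|u] _ //=; rewrite s'K.
Qed.

Lemma cut_type_cuts : pcuts cut_type = [set H].
Proof.
have Hc : in_cut cut_type (fun e : 'I_1 -> U => e ord0) H.
  have aff (u : U) : affine setT (fun e : 'I_1 -> U => e ord0 - u).
    by apply: affineB; [exact: affine_var|exact: affineT_const].
  split=> [h Hh|u u0 nHu].
  - have := cut_type_forced (c := 1) (aff h) _ => X.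
    apply: forcedW (X _) _ => [|e /(sgn_eq1 hU)]; last by rewrite doag_subr_gt0.
    by apply: near_cutW (near_cut_gt Hh) _ => z hz; apply: sgn_gt0; rewrite doag_subr_gt0.
  - have := cut_type_forced (c := -1) (aff u) _ => X.
    apply: forcedW (X _) _ => [|e /(sgn_eqN1 hU) E]; last by doag hU.
    by apply: near_cutW (near_cut_lt u0 nHu) _ => z hz; apply: sgn_lt0; doag hU.
have [_ cc _] := cut_type_complete.
apply/seteqP; split=> [G [cG [f [k [a [_ Ef]]] fG]]|_ ->].
  apply: (comb1_in_cut hU (l := k ord0) (w := a) cc cG cH fG Hc).
  by apply: forcedT => e; rewrite Ef /lin big_ord1.
split; first exact: cH.
by exists (fun e : 'I_1 -> U => e ord0) => //; apply: affine_var.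
Qed.

End OneSubgroup.

Lemma cut_type_Sinv H : invariant_convex_subgroup K H -> Sinv K (cut_type H).
Proof.
move=> [cH [A sA HA]]; apply: (SinvI hM (cut_type_complete cH) sA).
exact: cut_type_aut.
Qed.

(** The type of the empty tuple, which represents the empty set of subgroups. *)
Definition void_type : global_set U :=
  @GlobalSet U 0 (type_at setT (fun=> 0)).

Lemma void_type_Sinv : Sinv K void_type.
Proof.
apply: (@SinvI K U hM _ set0).
- exact: complete_type_at.
- exact: (small_finite hK (finite_set0 _)).
- move=> s Hs _ phi [_ Hphi]; split => //; move: Hphi.
  rewrite !psatE sat_rename -(sat_automorphism (penv _) phi Hs).
  by apply: (sat_ext _).1 => -[[]|u].
Qed.

Lemma void_type_cuts : pcuts void_type = set0.
Proof.
apply/seteqP; split=> // G [cG [f [k [a [_ Ef]]] fG]].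
have [_ vc _] := complete_type_at setT (fun _ : 'I_0 => 0 : U).
apply: (const_notin_cut hU vc cG fG (u := a)).
by apply: forcedT => e; rewrite Ef /lin big_ord0 add0r.
Qed.

Lemma tensor_SinvM (p q : global_set U) : Sinv K p -> Sinv K q ->
  Sinv K (tensor K p q).
Proof.
move=> Sp Sq; have [A sA ip] := Sinv_aut hM Sp.
exact: (tensor_Sinv hM sA ip (Sinv_complete Sp) (Sinv_complete Sq) Sq).
Qed.

Lemma tensor_cuts (p q : global_set U) : Sinv K p -> Sinv K q ->
  pcuts (tensor K p q) = pcuts p `|` pcuts q.
Proof.
move=> Sp Sq; have [A1 sA1 ip1] := Sinv_aut hM Sp; have [A2 sA2 iq2] := Sinv_aut hM Sq.
have sA : small K (A1 `|` A2) by apply: (small_setU hK).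
have ip : aut_invariant (A1 `|` A2) p by apply: aut_invariant_sub ip1; left.
have iq : aut_invariant (A1 `|` A2) q by apply: aut_invariant_sub iq2; right.
have hp := Sinv_complete Sp; have hq := Sinv_complete Sq.
apply/seteqP; split; first exact: (tensor_cuts_sub hM sA ip iq hp hq).
exact: (tensor_cuts_super hM sA ip hp hq).
Qed.

Lemma cuts_realized (Y : set (set U)) :
  finite_subsets (invariant_convex_subgroup K) Y ->
  exists2 p : global_set U, Sinv K p & pcuts p = Y.
Proof.
move=> [fY YX]; have [l El] := finite_lmem fY.
have lX H : lmem l H -> invariant_convex_subgroup K H by move/El/YX.
have -> : Y = [set H | lmem l H] by apply/seteqP; split=> H /El.
elim: l {El} lX => [_|H l IH lX].
  by exists void_type; [exact: void_type_Sinv|rewrite void_type_cuts].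
have [H' lH'|p Sp Ep] := IH; first by apply: lX; right.
have HX : invariant_convex_subgroup K H by apply: lX; left.
exists (tensor K (cut_type H) p); first exact: tensor_SinvM (cut_type_Sinv HX) Sp.
rewrite (tensor_cuts (cut_type_Sinv HX) Sp) Ep cut_type_cuts; last by case: HX.
by apply/seteqP; split=> G /= [->|lG]; [left|right|left|right].
Qed.

(** * Translation into finite sets of subgroups *)

Lemma dominatesP (p q : global_set U) : Sinv K p -> Sinv K q ->
  dominates K p q <-> pcuts q `<=` pcuts p.
Proof.
move=> Sp Sq; split=> [[A [r [sr dom]]]|]; last exact: cuts_dominates.
exact: (dominates_cuts_sub hM Sp Sq sr dom).
Qed.

Lemma dom_equivP (p q : global_set U) : Sinv K p -> Sinv K q ->
  dom_equiv K p q <-> pcuts p = pcuts q.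
Proof.
move=> Sp Sq; rewrite /dom_equiv !dominatesP //; split=> [[qp pq]|->]; last by split.
by apply/seteqP.
Qed.

Lemma dominates_swap (p q : global_set U) A r : @small_type U K p q A r ->
  (forall phi, in_x p phi -> entails (in_y q `|` r) phi) -> dominates K q p.
Proof.
move=> [sA rc rp rq] H.
pose sw (V W : Type) (v : V + W) : W + V := match v with inl i => inr i | inr j => inl j end.
have swK (V W : Type) phi : rename (sum_map (@sw V W) id) (rename (sum_map (@sw W V) id) phi) = phi
    :> formula ((W + V) + U).
  by rewrite rename_comp -[RHS]rename_id; apply: rename_ext => -[[i|j]|u].
pose r' := [set phi | r (rename (sum_map (@sw 'I_(arity q) 'I_(arity p)) id) phi)].
exists A, r'; split.
- split=> //; first exact: complete_type_rename.
    move=> _ [phi Hphi <-]; rewrite /r' /= rename_comp; apply: rq; exists phi => //.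
    by apply: rename_ext => -[].
  move=> _ [phi Hphi <-]; rewrite /r' /= rename_comp; apply: rp; exists phi => //.
  by apply: rename_ext => -[].
move=> _ [phi Hphi <-]; have Hx : @in_x U _ (arity q) p (rename (sum_map inl id) phi) by exists phi.
have := forced_rename (@sw 'I_(arity p) 'I_(arity q)) (H _ Hx) => H1.
apply: forcedW (forced_sub _ H1) _ => [|e].
  move=> _ [psi [[chi Hchi <-]|Hpsi] <-].
    left; rewrite rename_comp; exists chi => //; apply: rename_ext; by case.
  by right; rewrite /r' /= swK.
move=> He; apply/psat_rename; last apply/(psat_rename (f := sum_map inl id)); last exact: He.
  by case.
by case.
Qed.

Lemma equidominantP (p q : global_set U) : Sinv K p -> Sinv K q ->
  equidominant K p q <-> pcuts p = pcuts q.
Proof.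
move=> Sp Sq; split; last exact: cuts_equidominant.
move=> [A [r [sr pq qp]]]; apply/dom_equivP => //; split; first by exists A, r.
exact: dominates_swap sr qp.
Qed.

(** A union over invariant representatives needs no choice of one; on a domination class all of them
    contribute the same set. *)
Definition class_cuts (C : set (global_set U)) : set (set U) :=
  [set H | exists p, [/\ C p, Sinv K p & pcuts p H]].

Lemma class_cutsE (p : global_set U) : Sinv K p ->
  class_cuts (dom_class K p) = pcuts p.
Proof.
move=> Sp; apply/seteqP; split=> [H [q [[_ /dom_equivP -> //]]]|H Hp].
by exists p; split => //; split => //; apply/dom_equivP.
Qed.

Lemma class_cuts_iso : Inv_tilde_iso K class_cuts.
Proof.
split.
- split.
  + move=> _ [p Sp <-]; rewrite class_cutsE //; have hp := Sinv_complete Sp.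
    have [A sA ip] := Sinv_aut hM Sp.
    by split; [exact: (finite_cuts hM hp)|exact: (cuts_invariant hM hp sA ip)].
  + move=> C C' /set_mem[p Sp <-] /set_mem[q Sq <-]; rewrite !class_cutsE // => E.
    apply/seteqP; split=> r [Sr /dom_equivP Er]; split => //; apply/dom_equivP => //.
      by rewrite -E Er.
    by rewrite E Er.
  + move=> Y /cuts_realized[p Sp <-]; exists (dom_class K p); last exact: class_cutsE.
    by exists p.
- move=> p q Sp Sq; rewrite (class_cutsE (tensor_SinvM Sp Sq)) !class_cutsE //.
  exact: tensor_cuts.
- by move=> p q Sp Sq; rewrite !class_cutsE //; apply: dominatesP.
- move=> p q Sp Sq; rewrite !class_cutsE //; split; first exact: (orthogonal_disjoint hM Sp Sq).
  exact: (disjoint_orthogonal hM Sp Sq).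
Qed.

End CutType.
Theorem theorem4p10 (K : Type) (U : porderZmodType) (hU : monster_DOAG U K) :
  [/\ (forall p q : global_set U, Sinv K p -> Sinv K q -> Sinv K (tensor K p q)),
      tensor_respects_dominates U K,
      (forall p q : global_set U, Sinv K p -> Sinv K q ->
         (dom_equiv K p q <-> equidominant K p q)) &
      exists F : set (global_set U) -> set (set U), Inv_tilde_iso K F].
Proof.
split.
- exact: (tensor_SinvM hU).
- move=> p0 p1 q S0 S1 Sq /(dominatesP hU S0 S1) sub.
  split; apply/(dominatesP hU); try exact: (tensor_SinvM hU).
    by rewrite !(tensor_cuts hU) //; apply: setSU.
  by rewrite !(tensor_cuts hU) //; apply: setUS.
- by move=> p q Sp Sq; rewrite (dom_equivP hU) // (equidominantP hU).
- by exists (class_cuts (U := U) K); apply: class_cuts_iso.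
Qed.
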